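(* Let $K$ be a field and let $\Lambda = KQ/I$ be the truncated path algebra of Loewy length $L+1$ (with $L\ge 1$) on a finite quiver $Q$ with vertices $e_1,\dots,e_n$. Let $\mathbb{S} = (\mathbb{S}_0, \mathbb{S}_1, \dots, \mathbb{S}_L)$ be a sequence of semisimple $\Lambda$-modules, of total dimension $d$, such that $\mathbf{Mod}(\mathbb{S}) \ne \varnothing$, and let $P$ be a projective cover of $\mathbb{S}_0$. Moreover, suppose $$J^l P / J^{l+1}P = \Bigl(\bigoplus_{1 \le i \le n} S_i^{s(i,l)}\Bigr) \oplus \Bigl(\bigoplus_{1 \le i \le n} S_i^{r(i,l)}\Bigr)$$ for suitable nonnegative integers $r(i,l)$; here $s(i,l)$ is the multiplicity of the simple module $S_i$ in $\mathbb{S}_l$. (1) The projective dimension of a (finitely generated) module $M$ depends only on its radical layering $\mathbb{S}(M)$. In other words, the projective dimension is constant on each of the varieties $\mathbf{Mod}(\mathbb{S})$. This constant value, denoted $\operatorname{p\,dim}\mathbb{S}$, is the generic projective dimension of the irreducible subvariety $\overline{\mathbf{Mod}(\mathbb{S})}$ of $\mathbf{Mod}_d(\Lambda)$. (2) If $\operatorname{p\,dim}\mathbb{S} > 0$, then $$\operatorname{p\,dim}\mathbb{S} = 1 + \sup\{\, l\text{-}\deg(c(e_i)) \mid i \le n,\ l \le L \text{ with } r(i,l) \ne 0 \,\}.$$ (The convention $1+\infty=\infty$ is adopted.) In particular, $\operatorname{p\,dim}\mathbb{S}$ is finite if and only if $r(i,l) = 0$ for all cyclebound vertices $e_i$, that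 is, if and only if every simple module of infinite projective dimension has the same composition multiplicity in $P$ as in $\bigoplus_{0 \le l \le L}\mathbb{S}_l$. (3) The generic finitistic dimension of $\Lambda$ coincides with $\operatorname{fin\,dim}\Lambda$. It is the projective dimension of a tree module $\mathcal{T}$, of dimension $d'$ say, whose orbit closure is an irreducible component of $\mathbf{Mod}_{d'}(\Lambda)$.
   Context: $L$ is a positive integer, $K$ a field, $Q$ a finite quiver, $\Lambda = KQ/I$ with $I \subseteq KQ$ the ideal generated by all paths of length $L+1$, and $J$ is the Jacobson radical of $\Lambda$ (so $J^{L+1}=0$). Modules are left modules; $p'p$ means ''$p'$ after $p$'' for paths. The vertices $e_1,\dots,e_n$ of $Q$ are identified with the corresponding primitive idempotents of $\Lambda$, and $S_i = \Lambda e_i/Je_i$. A path in $\Lambda$ is the (nonzero) $I$-residue of a path of length at most $L$ in $KQ$. $\operatorname{p\,dim}$ denotes projective dimension, and $\operatorname{fin\,dim}\Lambda$ is the supremum of the projective dimensions of the finitely generated left $\Lambda$-modules of finite projective dimension. $c(e)\in\mathbb{N}\cup\{0,\infty\}$ is the supremum of the lengths of the paths in $KQ$ starting in the vertex $e$. A vertex $e$ is cyclebound if there is a path (possibly of length $0$) from $e$ to a vertex lying on an oriented cycle. For $0\le l\le L$ and an integer $c\ge 0$, $l\text{-}\deg(c) = [\frac{c}{L+1}] + [\frac{c+l}{L+1}]$, where $[x]$ is the largest integer $\le x$; moreover $l\text{-}\deg(\infty)=\infty$. Module varieties: with the algebra generators $a_1,\dots,a_r$ of $\Lambda$ given by the vertices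 $e_i$ and the residue classes of the arrows, $\mathbf{Mod}_d(\Lambda)$ is the affine variety of tuples $(x_i)\in\prod_{i\le r}\operatorname{End}_K(K^d)$ satisfying all relations satisfied by the $a_i$. Each point $x$ gives a $d$-dimensional module on $K^d$ via $a_i v = x_i(v)$, and isomorphism classes of $d$-dimensional modules correspond to $\operatorname{GL}_d$-conjugation orbits; the orbit closure of a $d$-dimensional module is the closure in $\mathbf{Mod}_d(\Lambda)$ of the corresponding orbit. The modules represented by the points of a subvariety $\mathcal{C}$ are called the modules in $\mathcal{C}$. The radical layering of a finitely generated module $M$ is $\mathbb{S}(M) = (J^lM/J^{l+1}M)_{0\le l\le L}$; isomorphic semisimple modules are identified. A sequence $\mathbb{S}=(\mathbb{S}_0,\dots,\mathbb{S}_L)$ of semisimple modules has total dimension $d=\sum_l\dim_K\mathbb{S}_l$, and $\mathbf{Mod}(\mathbb{S})$ is the subset of $\mathbf{Mod}_d(\Lambda)$ consisting of the points corresponding to modules with radical layering $\mathbb{S}$; it is a locally closed subvariety, irreducible by a known result, with closure $\overline{\mathbf{Mod}(\mathbb{S})}$ in $\mathbf{Mod}_d(\Lambda)$. When $\mathbf{Mod}(\mathbb{S})\neq\varnothing$, $\mathbb{S}_l$ is a direct summand of $J^lP/J^{l+1}P$ for every $l$, where $P$ is a projective cover of $\mathbb{S}_0$. For an irreducible subvariety $\mathcal{C}$ of $\mathbf{Mod}_d(\Lambda)$, the generic projective dimension of $\mathcal{C}$ is the constant value that $\operatorname{p\,dim}$ takes on some dense open subset of $\mathcal{C}$ (such a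 subset is known to exist). The generic (left) finitistic dimension of $\Lambda$ is the supremum of those generic projective dimensions that are finite, taken over all irreducible components $\mathcal{C}$ of the varieties $\mathbf{Mod}_d(\Lambda)$. A tree module with root $e$ ($e$ a vertex) is a module isomorphic to $\Lambda e/V$, where $V=\sum_{v\in\mathfrak{V}}\Lambda v$ for some (possibly empty) set $\mathfrak{V}$ of paths of positive length in $\Lambda e$.
   Formalization: Irreducibility of the closure of Mod(S) in (1) and the claim in (3) that the orbit closure of the tree module is an irreducible component are asserted only for infinite K (they fail on K-points over finite fields); Q is assumed to have at least one vertex. *)

(* Defs.v *)
From HB Require Import structures.
From mathcomp Require Import all_boot all_algebra.
From mathcomp Require Import boolp classical_sets cardinality topology.
From mathcomp Require Import mpoly.

Set Implicit Arguments.
Unset Strict Implicit.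
Unset Printing Implicit Defensive.

Import GRing.Theory.
Local Open Scope ring_scope.
Local Open Scope quotient_scope.
Local Open Scope classical_set_scope.

Inductive enat := Fin of nat | Infty.

Definition le_enat (u v : enat) : Prop :=
  match u, v with
  | _, Infty => True
  | Infty, Fin _ => False
  | Fin m, Fin n => (m <= n)%N
  end.

Definition esucc (u : enat) : enat := if u is Fin n then Fin n.+1 else Infty.

(* The least n satisfying P, and Infty when there is none. *)
Definition least (P : nat -> Prop) : enat :=
  match pselect (exists n, `[< P n >]) with
  | left exP => Fin (ex_minn exP)
  | right _ => Infty
  end.

(* The least upper bound; esup set0 = Fin 0. *)
Definition esup (A : set enat) : enat :=
  least (fun n => forall u, A u -> le_enat u (Fin n)).

Section Modules.
Variable R : pzRingType.
Implicit Types M N P : lmodType R.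

Definition lmod_iso M N : Prop := exists f : {linear M -> N}, bijective f.

Definition surjective (A B : Type) (f : A -> B) : Prop :=
  forall b, exists a, f a = b.

(* Submodules of M are the inhabitants of submodClosed M; boolean predicates
   lose no generality here since propositions are decided classically. *)

Section Submodule.
Variables (M : lmodType R) (N : submodClosed M).

Definition submodule := {x : M | x \in N}.

HB.instance Definition _ := SubChoice.on submodule.
HB.instance Definition _ := [SubChoice_isSubLmodule of submodule by <:].

Definition submod_pred : {pred M} := [pred x | x \in N].

Lemma submod_pred_closed : GRing.zmod_closed submod_pred.
Proof. exact: GRing.submod_closedB (submodClosedP N). Qed.

HB.instance Definition _ := GRing.isZmodClosed.Build M submod_pred submod_pred_closed.

Definition quotmodule := Quotient.quot submod_pred.

HB.instance Definition _ := GRing.Zmodule.on quotmodule.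

Definition quot_scale (a : R) : quotmodule -> quotmodule :=
  lift_op1 (Quotient.quot submod_pred) (fun x : M => a *: x).

Lemma quot_scaleE a : {morph \pi_(Quotient.quot submod_pred) : x / a *: x >-> quot_scale a x}.
Proof.
move=> x; unlock quot_scale; apply/eqP.
rewrite piE Quotient.equivE -scalerBr.
apply: (@rpredZ _ _ N).
have := Quotient.idealrBE submod_pred x (repr (\pi_(Quotient.quot submod_pred) x)).
by rewrite reprK eqxx.
Qed.

Local Notation proj := (\pi_(Quotient.quot submod_pred)).

Lemma quot_add x y : proj (x + y) = proj x + proj y.
Proof. exact: raddfD. Qed.

Lemma quot_scaleA a b v : quot_scale a (quot_scale b v) = quot_scale (a * b) v.
Proof. by rewrite -[v]reprK -!quot_scaleE scalerA. Qed.

Lemma quot_scale1 : left_id 1 quot_scale.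
Proof. by move=> v; rewrite -[v]reprK -quot_scaleE scale1r. Qed.

Lemma quot_scaleDr : right_distributive quot_scale +%R.
Proof.
move=> a u v; rewrite -[u]reprK -[v]reprK -quot_add -!quot_scaleE.
by rewrite scalerDr quot_add.
Qed.

Lemma quot_scaleDl v : {morph quot_scale^~ v : a b / a + b}.
Proof.
by move=> a b /=; rewrite -[v]reprK -!quot_scaleE scalerDl quot_add.
Qed.

HB.instance Definition _ := GRing.Zmodule_isLmodule.Build R quotmodule
  quot_scaleA quot_scale1 quot_scaleDr quot_scaleDl.

End Submodule.

Section DirectSum.
Variables (I : finType) (M : I -> lmodType R).

Definition dsum := forall i, M i.

HB.instance Definition _ := gen_eqMixin dsum.
HB.instance Definition _ := gen_choiceMixin dsum.

Definition dsum_add (u v : dsum) : dsum := fun i => u i + v i.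
Definition dsum_opp (u : dsum) : dsum := fun i => - u i.
Definition dsum_zero : dsum := fun i => 0.
Definition dsum_scale (a : R) (u : dsum) : dsum := fun i => a *: u i.

Lemma dsum_addA : associative dsum_add.
Proof. by move=> u v w; apply: functional_extensionality_dep => i; exact: addrA. Qed.
Lemma dsum_addC : commutative dsum_add.
Proof. by move=> u v; apply: functional_extensionality_dep => i; exact: addrC. Qed.
Lemma dsum_add0 : left_id dsum_zero dsum_add.
Proof. by move=> u; apply: functional_extensionality_dep => i; exact: add0r. Qed.
Lemma dsum_addN : left_inverse dsum_zero dsum_opp dsum_add.
Proof. by move=> u; apply: functional_extensionality_dep => i; exact: addNr. Qed.

HB.instance Definition _ :=
  GRing.isZmodule.Build dsum dsum_addA dsum_addC dsum_add0 dsum_addN.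

Lemma dsum_scaleA a b u : dsum_scale a (dsum_scale b u) = dsum_scale (a * b) u.
Proof. by apply: functional_extensionality_dep => i; exact: scalerA. Qed.
Lemma dsum_scale1 : left_id 1 dsum_scale.
Proof. by move=> u; apply: functional_extensionality_dep => i; exact: scale1r. Qed.
Lemma dsum_scaleDr : right_distributive dsum_scale +%R.
Proof. by move=> a u v; apply: functional_extensionality_dep => i; exact: scalerDr. Qed.
Lemma dsum_scaleDl u : {morph dsum_scale^~ u : a b / a + b}.
Proof. by move=> a b; apply: functional_extensionality_dep => i; exact: scalerDl. Qed.

HB.instance Definition _ := GRing.Zmodule_isLmodule.Build R dsum
  dsum_scaleA dsum_scale1 dsum_scaleDr dsum_scaleDl.

End DirectSum.

Section Span.
Variables (M : lmodType R) (X : set M).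

Definition gen_byP (v : M) : Prop :=
  exists2 s : seq (R * M), (forall p, p \in s -> X p.2) & v = \sum_(p <- s) p.1 *: p.2.

Definition gen_by : {pred M} := [pred v | `[< gen_byP v >]].

Lemma gen_by_closed : GRing.submod_closed gen_by.
Proof.
split; first by apply/asboolP; exists [::] => //; rewrite big_nil.
move=> a u v /asboolP[s Xs ->] /asboolP[t Xt ->]; apply/asboolP.
exists ([seq (a * p.1, p.2) | p <- s] ++ t).
  by move=> p; rewrite mem_cat => /orP[/mapP[q /Xs Xq ->]|/Xt].
rewrite big_cat big_map scaler_sumr; congr (_ + _).
by apply: eq_bigr => p _; rewrite scalerA.
Qed.

HB.instance Definition _ := GRing.isSubmodClosed.Build R M gen_by
  (GRing.submod_closed_semi gen_by_closed).

End Span.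

Definition fin_gen M : Prop :=
  exists s : seq M, forall v, v \in gen_by [set x | x \in s].

Definition simple_module M : Prop :=
  (exists x : M, x != 0) /\
  forall N : submodClosed M, (forall x, x \in N -> x = 0) \/ (forall x, x \in N).

(* comp_mult T M m: peeling off simple factors M/N along some composition
   series of M, exactly m of them are isomorphic to T. *)
Inductive comp_mult (T : lmodType R) : lmodType R -> nat -> Prop :=
| comp_mult0 M : (forall x : M, x = 0) -> comp_mult T M 0%N
| comp_multS M (N : submodClosed M) m :
    simple_module (quotmodule N) -> comp_mult T (submodule N) m ->
    comp_mult T M (`[< lmod_iso (quotmodule N) T >] + m)%N.

Definition maximal_left_ideal (I : submodClosed R^o) : Prop :=
  (1 : R^o) \notin I /\
  forall I' : submodClosed R^o,
    {subset I <= I'} -> (1 : R^o) \notin I' -> {subset I' <= I}.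

Definition jacobson : set R :=
  [set a | forall I : submodClosed R^o, maximal_left_ideal I -> (a : R^o) \in I].

Definition rad_gens M : set M := [set v | exists2 a, jacobson a & exists x : M, v = a *: x].
Arguments rad_gens M : clear implicits.

(* J^l M, with J^(l+1) M = J (J^l M). *)
Fixpoint radpow M (l : nat) : lmodType R :=
  if l is l'.+1 then submodule (gen_by (rad_gens (radpow M l'))) else M.

(* J^l M / J^(l+1) M. *)
Definition layer M (l : nat) : lmodType R :=
  quotmodule (gen_by (rad_gens (radpow M l))).

Definition projective P : Prop :=
  forall (A B : lmodType R) (g : {linear A -> B}) (f : {linear P -> B}),
    surjective g -> exists h : {linear P -> A}, forall x, g (h x) = f x.

Definition projective_cover P M : Prop :=
  projective P /\
  exists f : {linear P -> M}, surjective f /\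
    forall N : submodClosed P,
      (forall x, exists2 y, y \in N & f (x - y) = 0) -> forall x, x \in N.

Definition has_projective_resolution M (n : nat) : Prop :=
  exists (P : nat -> lmodType R)
         (d : forall k, {linear P k.+1 -> P k}) (eps : {linear P 0%N -> M}),
  [/\ forall k, projective (P k),
      forall k, (n < k)%N -> forall x : P k, x = 0,
      surjective eps,
      forall x, eps x = 0 <-> exists y, d 0%N y = x
    & forall k x, d k x = 0 <-> exists y, d k.+1 y = x].

Definition pdim M : enat := least (has_projective_resolution M).

Definition findim : enat :=
  esup [set v | exists M, [/\ fin_gen M, pdim M = v & v <> Infty]].

End Modules.

Record quiver := Quiver {
  vertex : finType;
  arrow : finType;
  source : arrow -> vertex;
  target : arrow -> vertex
}.

Section Quiver.
Variable Q : quiver.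

(* A path of KQ is a starting vertex together with the list of its arrows in
   the order in which they are traversed; in product notation this list is
   read from right to left. *)
Fixpoint is_path (e : vertex Q) (w : seq (arrow Q)) : bool :=
  if w is a :: w' then (source a == e) && is_path (target a) w' else true.

Definition endpoint (e : vertex Q) (w : seq (arrow Q)) : vertex Q :=
  last e [seq target a | a <- w].

Definition pathlen_sup (e : vertex Q) : enat :=
  esup [set u | exists2 w, is_path e w & u = Fin (size w)].

Definition on_oriented_cycle (f : vertex Q) : Prop :=
  exists w, [/\ is_path f w, (0 < size w)%N & endpoint f w = f].

Definition cyclebound (e : vertex Q) : Prop :=
  exists2 w, is_path e w & on_oriented_cycle (endpoint e w).

Lemma is_path_cat e w w' :
  is_path e (w ++ w') = is_path e w && is_path (endpoint e w) w'.
Proof. by elim: w e => //= a w IH e; rewrite IH andbA. Qed.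

Lemma endpoint_cat e w w' : endpoint e (w ++ w') = endpoint (endpoint e w) w'.
Proof. by rewrite /endpoint map_cat last_cat. Qed.

End Quiver.

Definition ldeg (L l : nat) (c : enat) : enat :=
  if c is Fin n then Fin (n %/ L.+1 + (n + l) %/ L.+1)%N else Infty.

Section Algebra.
Variables (K : fieldType) (Q : quiver) (L : nat).

(* The ideal I is spanned by the paths of length > L, so the residues of the
   paths of length at most L (the paths in Lambda) form a K-basis of KQ/I.
   Lambda is built on this basis. *)
Definition tpath := {p : vertex Q * L.-bseq (arrow Q) | is_path p.1 p.2}.

Definition tstart (p : tpath) : vertex Q := (val p).1.
Definition tarrows (p : tpath) : seq (arrow Q) := (val p).2.
Definition tend (p : tpath) : vertex Q := endpoint (tstart p) (tarrows p).

Definition tpa := {ffun tpath -> K^o}.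

HB.instance Definition _ := GRing.Lmodule.on tpa.

Definition path_elt (p : tpath) : tpa := [ffun q => (q == p)%:R].

(* The I-residue of a path of KQ (and 0 if w is not a path starting in e). *)
Definition residue (e : vertex Q) (w : seq (arrow Q)) : tpa :=
  if insub w is Some b then
    if insub (e, b) is Some p then path_elt p else 0
  else 0.

Definition tpa_mul (f g : tpa) : tpa :=
  \sum_p \sum_q (f p * g q) *:
    (if tend q == tstart p then residue (tstart q) (tarrows q ++ tarrows p) else 0).

Definition tpa_one : tpa := \sum_(e : vertex Q) residue e [::].

Lemma residue_tpath p : residue (tstart p) (tarrows p) = path_elt p.
Proof.
case: p => p pp; rewrite /residue /tarrows /tstart /= valK.
by rewrite -surjective_pairing insubT.
Qed.

Variant residue_spec e w : tpa -> Prop :=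
| ResidueBasis p of tstart p = e & tarrows p = w & is_path e w & (size w <= L)%N :
    residue_spec e w (path_elt p)
| ResidueZero of ~~ (is_path e w && (size w <= L)%N) : residue_spec e w 0.

Lemma residueP e w : residue_spec e w (residue e w).
Proof.
rewrite /residue; case: insubP => [b sb bw|/negbTE sw]; last first.
  by constructor; rewrite sw andbF.
case: insubP => [p pp pw|/= /negbTE pw]; last first.
  by constructor; rewrite -bw pw.
by constructor; rewrite /tstart /tarrows ?pw //= -bw.
Qed.

Lemma tpaE (f : tpa) : f = \sum_p f p *: path_elt p.
Proof.
apply/ffunP => q; rewrite sum_ffunE (bigD1 q) //= big1 ?addr0.
  by rewrite !ffunE eqxx /GRing.scale /= mulr1.
by move=> p pq; rewrite !ffunE eq_sym (negbTE pq) /GRing.scale /= mulr0.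
Qed.

Lemma tpa_mulDl : left_distributive tpa_mul +%R.
Proof.
move=> f g h; rewrite /tpa_mul -big_split; apply: eq_bigr => p _.
rewrite -big_split; apply: eq_bigr => q _.
by rewrite ffunE mulrDl scalerDl.
Qed.

Lemma tpa_mulDr : right_distributive tpa_mul +%R.
Proof.
move=> f g h; rewrite /tpa_mul -big_split; apply: eq_bigr => p _.
rewrite -big_split; apply: eq_bigr => q _.
by rewrite ffunE mulrDr scalerDl.
Qed.

Lemma tpa_mulZl a f g : tpa_mul (a *: f) g = a *: tpa_mul f g.
Proof.
rewrite /tpa_mul scaler_sumr; apply: eq_bigr => p _.
rewrite scaler_sumr; apply: eq_bigr => q _.
by rewrite ffunE scalerA mulrA.
Qed.

Lemma tpa_mulZr a f g : tpa_mul f (a *: g) = a *: tpa_mul f g.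
Proof.
rewrite /tpa_mul scaler_sumr; apply: eq_bigr => p _.
rewrite scaler_sumr; apply: eq_bigr => q _.
by rewrite ffunE scalerA mulrCA.
Qed.

Lemma tpa_mul0l f : tpa_mul 0 f = 0.
Proof. by rewrite -[X in tpa_mul X](scale0r 0) tpa_mulZl scale0r. Qed.

Lemma tpa_mul0r f : tpa_mul f 0 = 0.
Proof. by rewrite -[X in tpa_mul _ X](scale0r 0) tpa_mulZr scale0r. Qed.

Lemma tpa_mul_suml (I : Type) (s : seq I) (F : I -> tpa) g :
  tpa_mul (\sum_(i <- s) F i) g = \sum_(i <- s) tpa_mul (F i) g.
Proof.
by elim/big_rec2: _ => [|i x y _ <-]; [exact: tpa_mul0l | rewrite tpa_mulDl].
Qed.

Lemma tpa_mul_sumr (I : Type) (s : seq I) (F : I -> tpa) g :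
  tpa_mul g (\sum_(i <- s) F i) = \sum_(i <- s) tpa_mul g (F i).
Proof.
by elim/big_rec2: _ => [|i x y _ <-]; [exact: tpa_mul0r | rewrite tpa_mulDr].
Qed.

Lemma tpa_mul_basis p q :
  tpa_mul (path_elt p) (path_elt q) =
  if tend q == tstart p then residue (tstart q) (tarrows q ++ tarrows p) else 0.
Proof.
rewrite /tpa_mul (bigD1 p) //= [X in _ + X]big1 ?addr0; last first.
  move=> p' pp'; apply: big1 => q' _.
  by rewrite ffunE (negbTE pp') mul0r scale0r.
rewrite (bigD1 q) //= [X in _ + X]big1 ?addr0; last first.
  by move=> q' qq'; rewrite [path_elt q q']ffunE (negbTE qq') mulr0 scale0r.
by rewrite !ffunE !eqxx mulr1 scale1r.
Qed.

Lemma tpath_path p : is_path (tstart p) (tarrows p).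
Proof. exact: (valP p). Qed.

Lemma tpath_size p : (size (tarrows p) <= L)%N.
Proof. exact: (valP (val p).2). Qed.

Lemma tpa_mul_residue e w e' w' : is_path e w -> is_path e' w' ->
  tpa_mul (residue e' w') (residue e w) =
  if endpoint e w == e' then residue e (w ++ w') else 0.
Proof.
move=> pw pw'; case: residueP => [p <- <- _ _|]; last first.
  rewrite pw' /= tpa_mul0l => sw'; case: eqP => // _.
  case: residueP => // p _ _ _; rewrite size_cat => /(leq_trans (leq_addl _ _)).
  by move/negbTE: sw' => ->.
case: residueP => [q <- <- _ _|]; last first.
  rewrite pw /= tpa_mul0r => sw; case: eqP => // _.
  case: residueP => // r _ _ _; rewrite size_cat => /(leq_trans (leq_addr _ _)).
  by move/negbTE: sw => ->.
by rewrite tpa_mul_basis.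
Qed.

Lemma residue_not_path e w : ~~ is_path e w -> residue e w = 0.
Proof. by move=> pw; case: residueP => // p _ _ pw'; rewrite pw' in pw. Qed.

Lemma tpa_mulA_basis p q r :
  tpa_mul (path_elt p) (tpa_mul (path_elt q) (path_elt r)) =
  tpa_mul (tpa_mul (path_elt p) (path_elt q)) (path_elt r).
Proof.
rewrite !tpa_mul_basis -!residue_tpath.
have [[pp pq] pr] := (tpath_path p, tpath_path q, tpath_path r).
case: ifPn => rq; case: ifPn => qp.
- rewrite !tpa_mul_residue // ?is_path_cat ?pp ?pq ?pr ?(eqP rq) ?(eqP qp) //=.
  + by rewrite -/(tend r) rq endpoint_cat -/(tend r) (eqP rq) qp catA.
  + by rewrite -/(tend q) (eqP qp).
  + by rewrite -/(tend r) (eqP rq).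
- rewrite tpa_mul0l tpa_mul_residue ?is_path_cat ?pr -/(tend r) ?(eqP rq) //.
  by rewrite endpoint_cat -/(tend r) (eqP rq) -/(tend q) (negbTE qp).
- rewrite tpa_mul0r tpa_mul_residue ?is_path_cat ?pq -/(tend q) ?(eqP qp) //.
  by rewrite -/(tend r) (negbTE rq).
- by rewrite tpa_mul0l tpa_mul0r.
Qed.

Lemma tpa_mulA : associative tpa_mul.
Proof.
move=> f g h; rewrite [f]tpaE (tpa_mul_suml _ _ (tpa_mul g h)).
rewrite (tpa_mul_suml _ _ g) (tpa_mul_suml _ _ h); apply: eq_bigr => p _.
rewrite (tpa_mulZl _ _ (tpa_mul g h)) (tpa_mulZl _ _ g) (tpa_mulZl _ _ h).
congr (_ *: (_ : tpa)).
rewrite [g]tpaE (tpa_mul_suml _ _ h) 2!(tpa_mul_sumr _ _ (path_elt p)).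
rewrite (tpa_mul_suml _ _ h); apply: eq_bigr => q _.
rewrite (tpa_mulZl _ _ h) 2!(tpa_mulZr _ (path_elt p)) (tpa_mulZl _ _ h).
congr (_ *: (_ : tpa)).
rewrite [h]tpaE (tpa_mul_sumr _ _ (path_elt q)) (tpa_mul_sumr _ _ (path_elt p)).
rewrite (tpa_mul_sumr _ _ (tpa_mul _ _)); apply: eq_bigr => r _.
by rewrite (tpa_mulZr _ (path_elt q)) (tpa_mulZr _ (path_elt p)) !tpa_mulZr tpa_mulA_basis.
Qed.

Lemma tpa_mul1l : left_id tpa_one tpa_mul.
Proof.
move=> f; rewrite [f in RHS]tpaE {1}[f]tpaE tpa_mul_sumr; apply: eq_bigr => p _.
rewrite tpa_mulZr /tpa_one tpa_mul_suml; congr (_ *: _).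
have pp := tpath_path p.
rewrite -residue_tpath (bigD1 (tend p)) //= tpa_mul_residue //.
rewrite eqxx cats0 big1 ?addr0 // => e.
by rewrite tpa_mul_residue // -/(tend p) eq_sym => /negbTE ->.
Qed.

Lemma tpa_mul1r : right_id tpa_one tpa_mul.
Proof.
move=> f; rewrite [f in RHS]tpaE {1}[f]tpaE tpa_mul_suml; apply: eq_bigr => p _.
rewrite tpa_mulZl /tpa_one tpa_mul_sumr; congr (_ *: _).
have pp := tpath_path p.
rewrite -residue_tpath (bigD1 (tstart p)) //= tpa_mul_residue //.
rewrite /endpoint /= eqxx big1 ?addr0 // => e.
by rewrite tpa_mul_residue // /endpoint /= => /negbTE ->.
Qed.

HB.instance Definition _ := GRing.Zmodule_isPzRing.Build tpa
  tpa_mulA tpa_mul1l tpa_mul1r tpa_mulDl tpa_mulDr.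

Definition proj_indec (e : vertex Q) : lmodType tpa :=
  submodule (gen_by [set residue e [::] : tpa^o]).

Definition simple_at (e : vertex Q) : lmodType tpa := layer (proj_indec e) 0%N.

Definition semisimple (m : vertex Q -> nat) : lmodType tpa :=
  dsum (fun e => dsum (fun _ : 'I_(m e) => simple_at e)).

Definition is_tree_module (e : vertex Q) (T : lmodType tpa) : Prop :=
  exists2 V : set tpath,
    forall v, V v -> tstart v = e /\ (0 < size (tarrows v))%N &
    lmod_iso T (quotmodule (gen_by
      [set u : proj_indec e | exists2 v, V v & val u = path_elt v])).

Definition generator := (vertex Q + arrow Q)%type.

Definition gen_elt (g : generator) : tpa :=
  match g with
  | inl e => residue e [::]
  | inr a => residue (source a) [:: a]
  end.

Inductive ncpoly :=
| NCvar of generator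
| NCconst of K
| NCadd of ncpoly & ncpoly
| NCmul of ncpoly & ncpoly.

Fixpoint nceval (A : pzRingType) (c : K -> A) (x : generator -> A) (t : ncpoly) : A :=
  match t with
  | NCvar g => x g
  | NCconst k => c k
  | NCadd t u => nceval c x t + nceval c x u
  | NCmul t u => nceval c x t * nceval c x u
  end.

Definition eval_tpa : ncpoly -> tpa := nceval (fun k => k *: (1 : tpa)) gen_elt.

Definition eval_mx d (x : generator -> 'M[K]_d) : ncpoly -> 'M[K]_d :=
  nceval (fun k => k%:M) x.

(* The points of Mod_d(Lambda): the matrices satisfy all the relations, i.e.
   the noncommutative polynomials vanishing at the generators of Lambda. *)
Definition modvar d :=
  {x : {ffun generator -> 'M[K]_d} |
    `[< forall t, eval_tpa t = 0 -> eval_mx x t = 0 >]}.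

HB.instance Definition _ d := Choice.on (modvar d).

Definition nc_path (p : tpath) : ncpoly :=
  foldl (fun t a => NCmul (NCvar (inr a)) t) (NCvar (inl (tstart p))) (tarrows p).

(* A noncommutative polynomial whose value at the generators is f. *)
Definition nc_of (f : tpa) : ncpoly :=
  foldr NCadd (NCconst 0)
    [seq NCmul (NCconst (f p)) (nc_path p) | p <- index_enum tpath].

Lemma eval_tpaM t u : eval_tpa (NCmul t u) = tpa_mul (eval_tpa t) (eval_tpa u).
Proof. by []. Qed.

Lemma eval_tpaD t u : eval_tpa (NCadd t u) = eval_tpa t + eval_tpa u.
Proof. by []. Qed.

Lemma eval_tpaC k : eval_tpa (NCconst k) = k *: (1 : tpa).
Proof. by []. Qed.

Lemma eval_nc_path p : eval_tpa (nc_path p) = path_elt p.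
Proof.
rewrite -residue_tpath /nc_path; move: (tstart p) (tarrows p) (tpath_path p) => e w.
elim/last_ind: w => [//|w a IH]; rewrite -cats1 is_path_cat foldl_cat => /andP[pw].
rewrite /= andbT => /eqP sa; rewrite eval_tpaM IH //.
by rewrite tpa_mul_residue //= ?sa ?eqxx.
Qed.

Lemma eval_nc_of f : eval_tpa (nc_of f) = f.
Proof.
rewrite [RHS]tpaE /nc_of; elim: (index_enum _) => [|p s IH].
  by rewrite big_nil /= eval_tpaC scale0r.
rewrite big_cons -IH /= eval_tpaD eval_tpaM eval_tpaC eval_nc_path.
by rewrite tpa_mulZl tpa_mul1l.
Qed.

Definition point_module d (x : modvar d) := 'cV[K]_d.

Section Point.
Variables (d : nat) (x : modvar d).

Definition point_act (f : tpa) : 'M[K]_d := eval_mx (val x) (nc_of f).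

Lemma point_actP t f : eval_tpa t = f -> eval_mx (val x) t = point_act f.
Proof.
move=> tf; have /asboolP := valP x.
move=> /(_ (NCadd t (NCmul (NCconst (-1)) (nc_of f)))).
rewrite eval_tpaD eval_tpaM eval_tpaC eval_nc_of tf.
rewrite tpa_mulZl tpa_mul1l scaleN1r subrr => /(_ erefl).
rewrite /eval_mx /= -/(eval_mx _ _) -/(eval_mx _ _) => H.
by apply/eqP; rewrite -subr_eq0; apply/eqP; rewrite -[RHS]H raddfN mulN1r.
Qed.

Lemma point_act_gen g : point_act (gen_elt g) = val x g.
Proof. by rewrite -(@point_actP (NCvar g)). Qed.

HB.instance Definition _ := GRing.Zmodule.on (point_module x).

Definition point_scale (f : tpa) (v : point_module x) : point_module x := point_act f *m v.

Lemma point_scaleA f g v : point_scale f (point_scale g v) = point_scale (f * g) v.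
Proof.
rewrite /point_scale mulmxA -(@point_actP (NCmul (nc_of f) (nc_of g)) (f * g)) //.
by rewrite eval_tpaM !eval_nc_of.
Qed.

Lemma point_scale1 : left_id 1 point_scale.
Proof.
by move=> v; rewrite /point_scale -(@point_actP (NCconst 1)) ?mul1mx // eval_tpaC scale1r.
Qed.

Lemma point_scaleDr : right_distributive point_scale +%R.
Proof. by move=> f u v; rewrite /point_scale mulmxDr. Qed.

Lemma point_scaleDl v : {morph point_scale^~ v : f g / f + g}.
Proof.
move=> f g; rewrite /point_scale -mulmxDl.
rewrite -(@point_actP (NCadd (nc_of f) (nc_of g)) (f + g)) //.
by rewrite eval_tpaD !eval_nc_of.
Qed.

(* The module structure on K^d given by x; see point_act_gen. *)
HB.instance Definition _ := GRing.Zmodule_isLmodule.Build tpa (point_module x)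
  point_scaleA point_scale1 point_scaleDr point_scaleDl.

Definition GL_orbit : set (modvar d) :=
  [set y : modvar d | exists2 g : 'M[K]_d, g \in unitmx &
     forall a, val y a = g *m val x a *m invmx g].

End Point.

(* The Zariski topology on the K-rational points of Mod_d(Lambda). For finite K
   it is discrete, so that only singletons are irreducible. *)
Section Zariski.
Variable d : nat.

Local Notation coord := (generator * 'I_d * 'I_d)%type.

Definition coords (x : modvar d) (k : 'I_#|{: coord}|) : K :=
  let: (a, i, j) := enum_val k in val x a i j.

Definition zero_locus (F : set {mpoly K[#|{: coord}|]}) : set (modvar d) :=
  [set x | forall p, F p -> p.@[coords x] = 0].

Definition zariski_open : set (set (modvar d)) :=
  [set U | exists F, U = ~` zero_locus F].

Lemma zariski_openT : zariski_open setT.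
Proof.
exists [set 1]; apply/esym; rewrite -setC0; congr (~` _).
apply/seteqP; split=> // x /(_ 1 erefl) /eqP.
by rewrite meval1 oner_eq0.
Qed.

Lemma zariski_openI : setI_closed zariski_open.
Proof.
move=> _ _ [F ->] [G ->]; exists [set r | exists p q, [/\ F p, G q & r = p * q]].
rewrite -setCU; congr (~` _); apply/seteqP; split=> x.
  by move=> xFG r [p [q [Fp Gq ->]]]; rewrite mevalM;
    case: xFG => [/(_ p Fp) ->|/(_ q Gq) ->]; rewrite ?mul0r ?mulr0.
move=> xFG; have [xF|/existsNP[p /not_implyP[Fp /eqP xp]]] := pselect (zero_locus F x).
  by left.
right=> q Gq; have /eqP := xFG (p * q) (ex_intro _ p (ex_intro _ q (And3 Fp Gq erefl))).
by rewrite mevalM mulf_eq0 (negbTE xp) => /eqP.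
Qed.

Lemma zariski_open_bigU (I : Type) (f : I -> set (modvar d)) :
  (forall i, zariski_open (f i)) -> zariski_open (\bigcup_i f i).
Proof.
move=> /choice[F fF]; exists (\bigcup_i F i).
apply/seteqP; split=> x.
  by move=> [i _]; rewrite fF => xF xU; apply: xF => p Fp; apply: xU; exists i.
move=> xU; apply: contrapT => xf; apply: xU => p [i _ Fp].
by apply: contrapT => xp; apply: xf; exists i => //; rewrite fF => /(_ p Fp).
Qed.

HB.instance Definition _ := isOpenTopological.Build (modvar d)
  zariski_openT zariski_openI zariski_open_bigU.

End Zariski.

End Algebra.

Section Irreducible.
Variable X : topologicalType.

Definition irreducible (C : set X) : Prop :=
  C !=set0 /\
  forall A B : set X, closed A -> closed B -> C `<=` A `|` B -> C `<=` A \/ C `<=` B.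

Definition irreducible_component (C : set X) : Prop :=
  irreducible C /\ forall D, irreducible D -> C `<=` D -> D = C.

(* f takes the value v on a dense open subset of C. *)
Definition generic_value (T : Type) (f : X -> T) (C : set X) (v : T) : Prop :=
  exists O : set X,
    [/\ open O, C `<=` closure (C `&` O) & forall x, (C `&` O) x -> f x = v].

End Irreducible.

Section Generic.
Variables (K : fieldType) (Q : quiver) (L : nat).

Definition pdim_at d (x : modvar K Q L d) : enat := pdim (point_module x).

Definition generic_findim : enat :=
  esup [set v | v <> Infty /\ exists d (C : set (modvar K Q L d)),
                  irreducible_component C /\ generic_value (@pdim_at d) C v].

(* The stratum Mod(S) of the modules with radical layering S. *)
Definition rad_stratum (S : 'I_L.+1 -> lmodType (tpa K Q L)) d : set (modvar K Q L d) :=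
  [set x | forall l : 'I_L.+1, lmod_iso (layer (point_module x) l) (S l)].

End Generic.

Arguments rad_stratum {K Q L} S d _.

(* Main.v *)
Require Import Defs.
From HB Require Import structures.
From mathcomp Require Import all_boot all_algebra.
From mathcomp Require Import boolp classical_sets cardinality topology.
From mathcomp Require Import mpoly.
From mathcomp Require Import zify.

(** The proof replaces a finitely generated module M by a skeleton: generators m_k,
    supported at vertices, and a set B of paths closed under initial subpaths such
    that the vectors p m_k, p in B, form a K-basis of M. Choosing B one radical layer
    at a time (ex_skeleton) makes the number of paths of length l in B ending in e_i
    equal to the multiplicity of S_i in J^l M / J^(l+1) M. A path is critical if it is
    outside B while its initial subpaths are in B; its relation expresses it through
    paths of B that are at least as long.

    For a truncated path algebra these relations can be brought into triangular form,
    and the kernel of the projective cover of M becomes the direct sum, over the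
    critical paths, of modules Lambda e / J^(L+1-l) e, where l is the length and e the
    endpoint of the path (skeleton_syzygy). This kernel has an obvious skeleton, with
    critical paths of length L + 1 - l, so taking syzygies is a recursion on pairs (l,
    e), and l-deg is the solution of that recursion (ldeg_step, skeleton_pd). As l-deg
    does not increase along a path, the critical paths may be replaced by all paths
    outside B (pd_leS_nonskel). These are counted by the multiplicities of the
    projective cover of M minus those of M, that is, by the numbers r(i,l). Thus the
    radical layering determines the projective dimension (pdim_layering), by the
    asserted formula (pdim_formula); finiteness is a matter of cyclebound vertices
    because these are the vertices with c(e) infinite (cyclebound_pathlen), and the
    vertices e_i with S_i of infinite projective dimension (labelled_pdim).

    On the module variety the dimensions of e_i J^l M are ranks of matrices of regular
    functions, so the stratum of a layering is open in its closure and the common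
    projective dimension of its points is the generic one (stratum_generic). It is
    irreducible since two of its points have normal forms with respect to a common
    basis, the conditions on normal forms are affine, and a line of normal forms,
    conjugated by a line of base changes, joins the two points inside the stratum up
    to finitely many exceptions (irreducible_stratum).

    The finitistic dimension is attained by a tree module T_e, the quotient of Lambda
    e by all paths of positive length ending in vertices that are not cyclebound: in a
    module of finite projective dimension the critical paths end in such vertices, so
    each of them is a relation of T_e, e being its starting vertex (pdim_tree_bound).
    The orbit of T_e is open, for the module vanishes at all vertices into which
    arrows lead out of its tree, so that every nearby module satisfies the same
    relations (open_orbit). The closure of an open irreducible orbit is a component,
    on which the projective dimension of T_e is the generic one. Conversely, a generic
    projective dimension is the projective dimension of some finitely generated
    module. *)

Set Implicit Arguments.
Unset Strict Implicit.
Unset Printing Implicit Defensive.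

Import GRing.Theory.
Local Open Scope ring_scope.
Local Open Scope quotient_scope.
Local Open Scope classical_set_scope.


(** * Extended natural numbers *)

Lemma enat_le_ext u v :
  (forall n, le_enat u (Fin n) <-> le_enat v (Fin n)) -> u = v.
Proof.
case: u => [m|]; case: v => [n|] //= H.
- have [_ /(_ (leqnn n)) mn] := H n; have [/(_ (leqnn m)) nm _] := H m.
  by congr Fin; apply/eqP; rewrite eqn_leq mn nm.
- by have [/(_ (leqnn m))] := H m.
- by have [_ /(_ (leqnn n))] := H n.
Qed.

Lemma neq_Infty u : u <> Infty <-> exists n, le_enat u (Fin n).
Proof. by case: u => [m|]; split=> //; [exists m => /= | case]. Qed.

Lemma le_enat_trans v u w : le_enat u v -> le_enat v w -> le_enat u w.
Proof. by case: u v w => [u|] [v|] [w|] //=; apply: leq_trans. Qed.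

Lemma le_esucc u n : le_enat (esucc u) (Fin n.+1) <-> le_enat u (Fin n).
Proof. by case: u. Qed.

Lemma leastP (P : nat -> Prop) n : (forall m k, (m <= k)%N -> P m -> P k) ->
  le_enat (least P) (Fin n) <-> P n.
Proof.
move=> upP; rewrite /least; case: pselect => [exP|nexP] /=; last first.
  by split => // Pn; apply: nexP; exists n; apply/asboolP.
case: ex_minnP => m /asboolP Pm minm; split=> [mn|Pn].
  exact: upP Pm.
by apply: minm; apply/asboolP.
Qed.

Lemma esup_leP (A : set enat) n :
  le_enat (esup A) (Fin n) <-> forall u, A u -> le_enat u (Fin n).
Proof.
apply: leastP => m k mk H u /H {H}; case: u => //= u.
by move=> /leq_trans; apply.
Qed.

(** * Lengths of paths *)

Section Paths.
Variable Q : quiver.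
Implicit Types (e f : vertex Q) (w u : seq (arrow Q)).

Lemma pathlen_leP e n :
  le_enat (pathlen_sup e) (Fin n) <-> forall w, is_path e w -> (size w <= n)%N.
Proof.
rewrite esup_leP; split=> [H w pw|H u [w pw ->]]; last exact: H.
by apply: (H (Fin (size w))); exists w.
Qed.

Lemma is_path_take e w k : is_path e w -> is_path e (take k w).
Proof. by rewrite -{1}[w](cat_take_drop k) is_path_cat => /andP[]. Qed.

Lemma is_path_rcons e w a :
  is_path e (rcons w a) = is_path e w && (source a == endpoint e w).
Proof. by rewrite -cats1 is_path_cat /= andbT. Qed.

Lemma endpoint_rcons e w a : endpoint e (rcons w a) = target a.
Proof. by rewrite -cats1 endpoint_cat. Qed.

Lemma pathlen_suffix e u n : is_path e u ->
  le_enat (pathlen_sup e) (Fin n) ->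
  (size u <= n)%N /\ le_enat (pathlen_sup (endpoint e u)) (Fin (n - size u)).
Proof.
move=> pu /pathlen_leP en; split; first exact: en.
apply/pathlen_leP => w pw; have := en (u ++ w).
by rewrite is_path_cat pu pw size_cat => /(_ isT); lia.
Qed.

(** For finite c(e) the initial subpath of length k of a longest path does it; for
    infinite c(e), not every one of the finitely many endpoints of paths of length k
    can have finite c. *)
Lemma pathlen_prefix e w k : is_path e w -> (k <= size w)%N ->
  exists2 u, is_path e u /\ size u = k &
    forall n, le_enat (pathlen_sup (endpoint e u)) (Fin n) ->
              le_enat (pathlen_sup e) (Fin (n + k)).
Proof.
move=> pw kw; case ce: (pathlen_sup e) => [m|].
  have [w' pw' sw'] : exists2 w', is_path e w' & size w' = m.
    apply: contrapT => H; have [m0|mp] := posnP m.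
      by apply: H; exists [::] => //; rewrite m0.
    have : ~ le_enat (pathlen_sup e) (Fin m.-1) by rewrite ce /=; lia.
    apply; apply/pathlen_leP => w' pw'.
    have /pathlen_leP/(_ w' pw') : le_enat (pathlen_sup e) (Fin m) by rewrite ce /=.
    have : size w' <> m by move=> sw'; apply: H; exists w'.
    lia.
  have km : (k <= m)%N.
    apply: leq_trans kw _.
    by have /pathlen_leP -> : le_enat (pathlen_sup e) (Fin m) by rewrite ce /=.
  exists (take k w'); first by rewrite is_path_take // size_takel ?sw'.
  move=> n /pathlen_leP/(_ (drop k w')).
  move: pw'; rewrite -{1}[w'](cat_take_drop k) is_path_cat => /andP[_ ->] /(_ isT).
  by rewrite size_drop /=; lia.
apply: contrapT => H.
have [N HN] : exists N, forall f n, pathlen_sup f = Fin n -> (n <= N)%N.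
  exists (\max_(f : vertex Q) (if pathlen_sup f is Fin n then n else 0%N)) => f n fn.
  by apply: leq_trans (leq_bigmax f); rewrite fn.
have : ~ le_enat (pathlen_sup e) (Fin (N + k)) by rewrite ce.
apply; apply/pathlen_leP => w' pw'.
have [|kw'] := leqP (size w') k; first by lia.
case cu: (pathlen_sup (endpoint e (take k w'))) => [n|]; last first.
  case: H; exists (take k w'); last by rewrite cu.
  by rewrite is_path_take // size_take kw'.
have /pathlen_leP/(_ (drop k w')) : le_enat (pathlen_sup (endpoint e (take k w'))) (Fin N).
  by rewrite cu /=; apply: HN cu.
move: pw'; rewrite -{1}[w'](cat_take_drop k) is_path_cat => /andP[_ ->] /(_ isT).
by rewrite size_drop /=; lia.
Qed.

Lemma cyclebound_cat e w : is_path e w -> cyclebound (endpoint e w) -> cyclebound e.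
Proof.
move=> pw [u pu cu]; exists (w ++ u); first by rewrite is_path_cat pw.
by rewrite endpoint_cat.
Qed.

(** A path with at least as many arrows as there are vertices revisits one. *)
Lemma cyclebound_pathlen e : cyclebound e <-> pathlen_sup e = Infty.
Proof.
split=> [[w pw [z [pz sz ez]]]|ce].
  apply: enat_le_ext => n; split=> // /pathlen_leP le_n.
  (* Going around the cycle n + 1 times gives a path of length greater than n. *)
  pose zs := iter n.+1 (cat z) [::].
  have [pzs szs] : is_path (endpoint e w) zs /\ (n < size zs)%N.
    rewrite /zs; elim: (n.+1) => // m [IHp IHs]; rewrite /= is_path_cat pz ez IHp; split=> //.
    by rewrite size_cat; lia.
  have := le_n (w ++ zs); rewrite is_path_cat pw pzs size_cat => /(_ isT).
  by lia.
have [w pw sw] : exists2 w, is_path e w & (#|vertex Q| <= size w)%N.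
  apply: contrapT => H.
  have : ~ le_enat (pathlen_sup e) (Fin #|vertex Q|) by rewrite ce.
  apply; apply/pathlen_leP => w pw; rewrite leqNgt; apply/negP => ww.
  by apply: H; exists w => //; apply: ltnW.
pose E := [seq endpoint e (take j w) | j <- iota 0 (size w).+1].
have /(uniqPn e)[i [j [ij jE]]] : ~~ uniq E.
  apply/negP => /card_uniqP; rewrite size_map size_iota => cE.
  by have := max_card (mem E); rewrite cE; lia.
rewrite size_map size_iota in jE.
rewrite !(nth_map 0%N) ?size_iota ?nth_iota ?add0n; try lia.
move=> Eij.
have: is_path e (take j w) by exact: is_path_take.
have: take j w = take i w ++ drop i (take j w).
  by rewrite -{1}(cat_take_drop i (take j w)) take_takel ?(ltnW ij).
move=> ->; rewrite is_path_cat => /andP[pi pd].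
exists (take i w) => //; exists (drop i (take j w)); split=> //.
  by rewrite size_drop size_takel //; lia.
rewrite -endpoint_cat Eij; congr endpoint.
by rewrite -[RHS](cat_take_drop i) take_takel ?(ltnW ij).
Qed.

Lemma ldeg_suffix L l e u n : is_path e u ->
  le_enat (ldeg L l (pathlen_sup e)) (Fin n) ->
  le_enat (ldeg L (l + size u) (pathlen_sup (endpoint e u))) (Fin n).
Proof.
move=> pu; case ce: (pathlen_sup e) => [m|//] /= mn.
have /(pathlen_suffix pu)[um] : le_enat (pathlen_sup e) (Fin m) by rewrite ce /=.
case: pathlen_sup => //= k kmu; apply: leq_trans mn.
by apply: leq_add; apply: leq_div2r; lia.
Qed.

(** For 0 < l, the number l-deg(c) vanishes exactly when c + l <= L. *)
Lemma ldeg_eq0 L l e : (0 < l)%N -> (l <= L)%N ->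
  le_enat (ldeg L l (pathlen_sup e)) (Fin 0) <->
  forall u, is_path e u -> size u <> (L.+1 - l)%N.
Proof.
move=> l0 lL; split=> [|H].
  case ce: (pathlen_sup e) => [m|//] /=; rewrite leqn0 addn_eq0 => /andP[_ m0] u pu su.
  have /pathlen_leP/(_ u pu) : le_enat (pathlen_sup e) (Fin m) by rewrite ce /=.
  rewrite su => lm; move: m0; rewrite -leqn0 leqNgt divn_gt0 //; lia.
have : le_enat (pathlen_sup e) (Fin (L - l)).
  apply/pathlen_leP => w pw; rewrite leqNgt; apply/negP => lw.
  by apply: (H (take (L.+1 - l) w)); rewrite ?is_path_take // size_takel //; lia.
by case: pathlen_sup => //= m mLl; rewrite !divn_small //; lia.
Qed.

(** The recursion behind l-deg: passing to the syzygy trades a weight l for the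
    weight L + 1 - l at the endpoints of the paths of length L + 1 - l. *)
Lemma ldeg_step L l e n : (0 < l)%N -> (l <= L)%N ->
  le_enat (ldeg L l (pathlen_sup e)) (Fin n.+1) <->
  forall u, is_path e u -> size u = (L.+1 - l)%N ->
    le_enat (ldeg L (L.+1 - l) (pathlen_sup (endpoint e u))) (Fin n).
Proof.
move=> l0 lL.
have shift k : ((k + (L.+1 - l)) %/ L.+1 + (k + (L.+1 - l) + l) %/ L.+1 =
    (k %/ L.+1 + (k + (L.+1 - l)) %/ L.+1).+1)%N.
  have -> : (k + (L.+1 - l) + l = k + L.+1)%N by lia.
  by rewrite (divnDr k (dvdnn L.+1)) divnn; lia.
split=> [|H].
  case ce: (pathlen_sup e) => [m|//] mn u pu su.
  have /(pathlen_suffix pu)[um] : le_enat (pathlen_sup e) (Fin m) by rewrite ce /=.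
  case: pathlen_sup => //= k km; rewrite -ltnS -shift; apply: leq_trans mn.
  by apply: leq_add; apply: leq_div2r; lia.
have [[w pw lw]|short] := pselect (exists2 w, is_path e w & (L.+1 - l <= size w)%N).
  have [u [pu su] Hu] := pathlen_prefix pw lw.
  move: (H u pu su) Hu; case: (pathlen_sup (endpoint e u)) => //= k kn.
  move=> /(_ k (leqnn k)); case: pathlen_sup => //= m mk.
  apply: leq_trans (_ : n.+1 <= _)%N => //; rewrite -ltnS -shift in kn.
  by apply: leq_trans kn; apply: leq_add; apply: leq_div2r; lia.
have : le_enat (ldeg L l (pathlen_sup e)) (Fin 0).
  by apply/ldeg_eq0 => // u pu su; apply: short; exists u => //; rewrite su.
by case: ldeg => //= k; lia.
Qed.

End Paths.

(** * Modules over a ring *)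

Section ModuleTheory.
Variable R : pzRingType.
Implicit Types M N P X Y C : lmodType R.

Lemma ex_linear M N (f : M -> N) : linear f -> exists g : {linear M -> N}, g =1 f.
Proof.
move=> lf; pose g : {linear M -> N} := HB.pack f (GRing.isLinear.Build R M N *:%R f lf).
by exists g.
Qed.

Lemma ex_linear_id M : exists g : {linear M -> M}, g =1 id.
Proof. by exists idfun. Qed.

Lemma ex_linear_comp M N P (f : {linear M -> N}) (g : {linear N -> P}) :
  exists h : {linear M -> P}, h =1 g \o f.
Proof. by exists (g \o f). Qed.

Lemma pair_linE M N a (x y : M) (u v : N) :
  a *: ((x, u) : (M * N)%type) + (y, v) = (a *: x + y, a *: u + v).
Proof. by []. Qed.

Lemma inj_surj_iso M N (f : {linear M -> N}) : injective f -> surjective f -> lmod_iso M N.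
Proof.
move=> fI /choice[g fg]; exists f; exists g => // x.
by apply: fI; rewrite fg.
Qed.

Lemma lmod_iso_refl M : lmod_iso M M.
Proof. by have [f fE] := ex_linear_id M; exists f; exists id => x; rewrite fE. Qed.

Lemma lmod_iso_sym M N : lmod_iso M N -> lmod_iso N M.
Proof.
move=> [f [g fK gK]].
have [h hE] : exists h : {linear N -> M}, h =1 g.
  by apply: ex_linear => a x y; apply: (can_inj fK); rewrite linearP !gK.
by exists h; exists f => x; rewrite hE.
Qed.

Lemma lmod_iso_trans M N P : lmod_iso M N -> lmod_iso N P -> lmod_iso M P.
Proof.
move=> [f fb] [g gb]; have [h hE] := ex_linear_comp f g.
by exists h; apply: (eq_bij (bij_comp gb fb)) => x; rewrite hE.
Qed.

Lemma mem_gen_by M (X : set M) x : X x -> x \in gen_by X.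
Proof.
move=> Xx; apply/asboolP; exists [:: (1, x)]; first by move=> p; rewrite inE => /eqP->.
by rewrite big_seq1 scale1r.
Qed.

Lemma gen_by_min M (X : set M) (N : submodClosed M) :
  (forall x, X x -> x \in N) -> {subset gen_by X <= N}.
Proof.
move=> XN x /asboolP[s sX ->]; rewrite big_seq; apply: rpred_sum => p /sX /XN pN.
exact: rpredZ.
Qed.

Lemma submodB M (N : submodClosed M) x y : x \in N -> y \in N -> x - y \in N.
Proof. by move=> Nx Ny; rewrite -scaleN1r rpredD // rpredZ. Qed.

Section Quotient.
Variables (M : lmodType R) (N : submodClosed M).

Lemma quotmodule_proj : exists p : {linear M -> quotmodule N},
  surjective p /\ forall x, p x = 0 <-> x \in N.
Proof.
have [p pE] : exists p : {linear M -> quotmodule N},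
    p =1 \pi_(Quotient.quot (submod_pred N)).
  by apply: ex_linear => a x y; rewrite quot_add; congr (_ + _); apply: quot_scaleE.
exists p; split=> [y|x]; first by exists (repr y); rewrite pE reprK.
have := Quotient.idealrBE (submod_pred N) x 0; rewrite subr0 => xN.
rewrite pE; split=> [x0|xN0].
  suff : x \in submod_pred N by [].
  by rewrite xN; apply/eqP; rewrite [LHS]x0 raddf0.
have : x \in submod_pred N by [].
by rewrite xN => /eqP ->; rewrite raddf0.
Qed.

Lemma submodule_incl : exists i : {linear submodule N -> M}, i =1 val.
Proof. by apply: ex_linear => a x y; rewrite linearP. Qed.

Lemma lift_submodule X (f : {linear X -> M}) : (forall x, f x \in N) ->
  exists g : {linear X -> submodule N}, forall x, val (g x) = f x.
Proof.
move=> fN.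
have [g gE] : exists g : {linear X -> submodule N}, g =1 (fun x => exist _ (f x) (fN x)).
  by apply: ex_linear => a x y; apply: val_inj; rewrite [RHS]linearP; apply: linearP.
by exists g => x; rewrite gE.
Qed.

End Quotient.

Definition kernel M N (f : {linear M -> N}) : {pred M} := [pred x | f x == 0].

Lemma kernel_closed M N (f : {linear M -> N}) : GRing.submod_closed (kernel f).
Proof.
split; first by rewrite inE /= linear0.
by move=> a x y /eqP fx /eqP fy; rewrite inE /= linearP fx fy scaler0 addr0.
Qed.

HB.instance Definition _ M N (f : {linear M -> N}) :=
  GRing.isSubmodClosed.Build R M (kernel f) (kernel_closed f).

(** * Projective dimension *)

Lemma projective_iso P P' : lmod_iso P P' -> projective P -> projective P'.
Proof.
move=> PP' pP A B g f gS; have [u [v uK vK]] := PP'.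
have [fu fuE] := ex_linear_comp u f.
have [v' v'E] : exists v' : {linear P' -> P}, v' =1 v.
  by apply: ex_linear => a x y; apply: (can_inj uK); rewrite linearP !vK.
have [h hE] := pP _ _ g fu gS.
have [h' h'E] := ex_linear_comp v' h.
by exists h' => x; rewrite h'E /= hE fuE /= v'E vK.
Qed.

Lemma projective_summand P X (i : {linear X -> P}) (r : {linear P -> X}) :
  cancel i r -> projective P -> projective X.
Proof.
move=> iK pP A B g f gS.
have [fr frE] := ex_linear_comp r f.
have [h hE] := pP _ _ g fr gS.
have [h' h'E] := ex_linear_comp i h.
by exists h' => x; rewrite h'E /= hE frE /= iK.
Qed.

Lemma projective_prod P P' : projective P -> projective P' -> projective (P * P')%type.
Proof.
move=> pP pP' A B g f gS.
have [f1 f1E] : exists f1 : {linear P -> B}, f1 =1 fun x => f (x, 0).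
  by apply: ex_linear => a x y; rewrite -linearP pair_linE scaler0 addr0.
have [f2 f2E] : exists f2 : {linear P' -> B}, f2 =1 fun x => f (0, x).
  by apply: ex_linear => a x y; rewrite -linearP pair_linE scaler0 addr0.
have [[h1 h1E] [h2 h2E]] := (pP _ _ g f1 gS, pP' _ _ g f2 gS).
have [h hE] : exists h : {linear (P * P')%type -> A}, h =1 fun x => h1 x.1 + h2 x.2.
  by apply: ex_linear => a x y; rewrite /= !linearP scalerDr addrACA.
exists h => -[x y]; rewrite hE /= linearD h1E h2E f1E f2E -linearD.
by congr (f (_, _)); rewrite ?addr0 ?add0r.
Qed.

Record ses C P M (i : {linear C -> P}) (g : {linear P -> M}) : Prop := Ses {
  ses_inj : injective i;
  ses_surj : surjective g;
  ses_exact : forall x, g x = 0 <-> exists y, i y = x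
}.

Lemma ses_kernel P M (g : {linear P -> M}) : surjective g ->
  exists i : {linear submodule (kernel g) -> P}, ses i g.
Proof.
move=> gS; have [i iE] := submodule_incl (kernel g); exists i; split=> // [x y|x].
  by rewrite !iE => /val_inj.
split=> [gx|[y <-]]; last by rewrite iE; apply/eqP; exact: valP y.
have xk : x \in kernel g by rewrite inE /= gx.
by exists (exist _ x xk); rewrite iE.
Qed.

(** A resolution of length n, unwound into successive syzygies with respect to
    arbitrary projective presentations. *)
Fixpoint pd_le (n : nat) M : Prop :=
  if n is n'.+1 then
    exists P C (i : {linear C -> P}) (g : {linear P -> M}),
      [/\ projective P, ses i g & pd_le n' C]
  else projective M.

Lemma pd_le_iso n M N : lmod_iso M N -> pd_le n M -> pd_le n N.
Proof.
case: n => [|n] /=; first exact: projective_iso.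
move=> [u [v uK vK]] [P [C [i [g [pP [iI gS ex] pC]]]]].
have [h hE] := ex_linear_comp g u.
exists P, C, i, h; split=> //; split=> // [y|x].
  by have [x gx] := gS (v y); exists x; rewrite hE /= gx vK.
by rewrite hE /= -ex; split=> [|->]; rewrite ?linear0 // -(linear0 u) => /(can_inj uK).
Qed.

Definition zero_module : lmodType R := dsum (fun _ : void => R^o).

Lemma zero_moduleE (x : zero_module) : x = 0.
Proof. by apply: functional_extensionality_dep => -[]. Qed.

Lemma has_resolution0 M : has_projective_resolution M 0 <-> projective M.
Proof.
split=> [[P [d [eps [pP P0 epsS exE _]]]]|pM].
  apply: projective_iso (pP 0%N); apply: (@inj_surj_iso _ _ eps) => // x y exy.
  apply/eqP; rewrite -subr_eq0; apply/eqP.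
  have /exE[z <-] : eps (x - y) = 0 by rewrite linearB exy subrr.
  by rewrite (P0 1%N isT z) linear0.
have [e eE] := ex_linear_id M.
exists (fun k => if k is 0%N then M else zero_module).
exists (fun k => \0), e; split=> [[|k]|[|k]|y|x|k x] //.
- move=> A B g f gS; exists \0 => x; by rewrite !linear0 (zero_moduleE x) linear0.
- by move=> _ x; exact: zero_moduleE.
- by exists y; rewrite eE.
- rewrite eE; split=> [->|[y <-]]; last by [].
  by exists 0.
- by split=> _ //; exists 0; rewrite (zero_moduleE x).
Qed.

(** Splicing a resolution of the kernel of P -> M with P. *)
Lemma pd_leP n M : has_projective_resolution M n <-> pd_le n M.
Proof.
elim: n M => [|n IH] M; first exact: has_resolution0.
split=> [[P [d [eps [pP P0 epsS exE exd]]]]|[P [C [i [g [pP [iI gS ex] /IH]]]]]].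
  have [i si] := ses_kernel epsS.
  exists (P 0%N), (submodule (kernel eps)), i, eps; split=> //; apply/IH.
  have dk x : d 0%N x \in kernel eps by apply/eqP/exE; exists x.
  have [e eE] := lift_submodule dk.
  exists (fun k => P k.+1), (fun k => d k.+1), e; split=> //.
  - by move=> k nk; apply: P0.
  - by move=> y; have /eqP/exE[x xE] := valP y; exists x; apply: val_inj; rewrite eE.
  - move=> x; rewrite -exd -eE; split=> [->|e0]; first exact: raddf0.
    by apply: val_inj; rewrite e0 raddf0.
move=> [P' [d [eps [pP' P'0 epsS exE exd]]]].
have [d0 d0E] := ex_linear_comp eps i.
pose PP k : lmodType R := if k is k'.+1 then P' k' else P.
pose dd k : {linear PP k.+1 -> PP k} :=
  match k return {linear PP k.+1 -> PP k} with 0%N => d0 | k'.+1 => d k' end.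
exists PP, dd, g; split=> // [[|k]|[|k]|x|[|k] x] //=.
- exact: P'0.
- rewrite ex; split=> [[y <-]|[y <-]]; last by exists (eps y); rewrite d0E.
  by have [z <-] := epsS y; exists z; rewrite d0E.
- by rewrite -exE d0E /=; split=> [|->]; rewrite ?linear0 // -(linear0 i) => /iI.
- exact: exd.
Qed.

(** Both C * P' and C' * P are the pullback of P and P' over M. *)
Lemma schanuel M C P C' P' (i : {linear C -> P}) (g : {linear P -> M})
    (i' : {linear C' -> P'}) (g' : {linear P' -> M}) :
  projective P -> projective P' -> ses i g -> ses i' g' ->
  lmod_iso (C * P')%type (C' * P)%type.
Proof.
move=> pP pP' s s'.
pose T : lmodType R := (P * P')%type.
have [D DE] : exists D : {linear T -> M}, D =1 fun z => g z.1 - g' z.2.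
  by apply: ex_linear => a x y; rewrite /= !linearP scalerDr addrACA.
(* The pullback of p and p' is an extension of B' by A, and B' is projective. *)
have aux (A B B' : lmodType R) (j : {linear A -> B}) (p : {linear B -> M})
    (p' : {linear B' -> M}) (E : {linear (B * B')%type -> M}) :
    projective B' -> ses j p -> (forall z, E z = 0 <-> p z.1 = p' z.2) ->
    lmod_iso (A * B')%type (submodule (kernel E)).
  move=> pB' [jI pS ex] EE; have [h hE] := pB' _ _ p p' pS.
  have [f fE] : exists f : {linear (A * B')%type -> (B * B')%type},
      f =1 fun z => (j z.1 + h z.2, z.2).
    apply: ex_linear => a x y; congr (_, _); rewrite /= !linearP scalerDr addrACA //.
  have fk z : f z \in kernel E.
    apply/eqP/EE; rewrite fE /= linearD hE.
    suff -> : p (j z.1) = 0 by rewrite add0r.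
    by apply/ex; exists z.1.
  have [u uE] := lift_submodule fk.
  apply: (@inj_surj_iso _ _ u) => [[x y] [x' y']|[z zk]].
    move=> /(congr1 val); rewrite !uE !fE /= => -[+ yy']; rewrite yy' => /addIr /jI -> //.
  have /eqP/EE pz := zk.
  have /ex[a ja] : p (z.1 - h z.2) = 0 by rewrite linearB hE pz subrr.
  exists (a, z.2); apply: val_inj; rewrite uE fE /= ja subrK.
  by case: z {zk pz ja}.
have D0 z : D z = 0 <-> g z.1 = g' z.2.
  by rewrite DE; split=> [/eqP|->]; [rewrite subr_eq0 => /eqP | rewrite subrr].
apply: lmod_iso_trans (aux _ _ _ _ _ _ D pP' s D0) _; apply: lmod_iso_sym.
pose T' : lmodType R := (P' * P)%type.
have [D' D'E] : exists D' : {linear T' -> M}, D' =1 fun z => D (z.2, z.1).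
  by apply: ex_linear => a x y; rewrite -linearP.
have D'0 z : D' z = 0 <-> g' z.1 = g z.2.
  by rewrite D'E D0; split.
apply: lmod_iso_trans (aux _ _ _ _ _ _ D' pP s' D'0) _.
have [sw swE] : exists sw : {linear T' -> T}, sw =1 fun z => (z.2, z.1).
  by apply: ex_linear.
have [k' k'E] := submodule_incl (kernel D').
have [swk swkE] := ex_linear_comp k' sw.
have swkK z : swk z \in kernel D.
  by rewrite inE /= swkE /= swE k'E -D'E; exact: valP z.
have [u uE] := lift_submodule swkK.
apply: (@inj_surj_iso _ _ u) => [[[x y] zk] [[x' y'] zk']|[[x y] zk]].
  move=> /(congr1 val); rewrite !uE !swkE /= !swE !k'E /= => -[yy' xx'].
  by apply: val_inj; rewrite /= xx' yy'.
have zk' : ((y, x) : T') \in kernel D' by rewrite inE /= D'E.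
by exists (exist (fun z : T' => z \in kernel D') _ zk'); apply: val_inj; rewrite uE swkE /= swE k'E.
Qed.

Lemma pd_le_add_projective n C P : pd_le n C -> projective P -> pd_le n (C * P)%type.
Proof.
case: n => [|n] /=; first exact: projective_prod.
move=> [P0 [C0 [i [g [pP0 [iI gS ex] pC]]]]] pP.
have [j jE] : exists j : {linear C0 -> (P0 * P)%type}, j =1 fun x => (i x, 0).
  by apply: ex_linear => a x y; rewrite linearP pair_linE scaler0 addr0.
have [h hE] : exists h : {linear (P0 * P)%type -> (C * P)%type}, h =1 fun x => (g x.1, x.2).
  by apply: ex_linear => a x y; rewrite linearP.
exists (P0 * P)%type, C0, j, h; split=> //; first exact: projective_prod.
split=> [x y|[x y]|[x y]].
- by rewrite !jE => -[/iI].
- by have [z <-] := gS x; exists (z, y); rewrite hE.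
- rewrite hE /=; split=> [[/ex[z <-] ->]|[z]]; first by exists z; rewrite jE.
  rewrite jE => -[<- <-]; congr (_, _); apply/ex; by exists z.
Qed.

(** If P covers X * Y, it also covers X and Y separately, and Schanuel's lemma
    compares the two covers P and P * P of X * Y. *)
Lemma pd_le_summand n X Y : pd_le n (X * Y)%type -> pd_le n X.
Proof.
elim: n X Y => [|n IH] X Y /=.
  have [i iE] : exists i : {linear X -> (X * Y)%type}, i =1 fun x => (x, 0).
    by apply: ex_linear => a x y; rewrite pair_linE scaler0 addr0.
  have [r rE] : exists r : {linear (X * Y)%type -> X}, r =1 fst by apply: ex_linear.
  by apply: (@projective_summand _ _ i r) => x; rewrite rE iE.
move=> [P [C [i [g [pP s pC]]]]]; have [iI gS ex] := s.
have [g1 g1E] : exists g1 : {linear P -> X}, g1 =1 fst \o g.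
  by apply: ex_linear => a x y; rewrite /= linearP.
have [g2 g2E] : exists g2 : {linear P -> Y}, g2 =1 snd \o g.
  by apply: ex_linear => a x y; rewrite /= linearP.
have g1S : surjective g1 by move=> x; have [z gz] := gS (x, 0); exists z; rewrite g1E /= gz.
have g2S : surjective g2 by move=> x; have [z gz] := gS (0, x); exists z; rewrite g2E /= gz.
have [[i1 s1] [i2 s2]] := (ses_kernel g1S, ses_kernel g2S).
set C1 := submodule (kernel g1) in i1 s1 *; set C2 := submodule (kernel g2) in i2 s2 *.
exists P, C1, i1, g1; split=> //.
apply: (IH _ C2); apply: (IH _ P).
have [j jE] : exists j : {linear (C1 * C2)%type -> (P * P)%type},
    j =1 fun x => (i1 x.1, i2 x.2).
  by apply: ex_linear => a x y; rewrite /= !linearP.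
have [h hE] : exists h : {linear (P * P)%type -> (X * Y)%type}, h =1 fun x => (g1 x.1, g2 x.2).
  by apply: ex_linear => a x y; rewrite /= !linearP.
have sj : ses j h.
  case: s1 s2 => [i1I _ e1] [i2I _ e2]; split=> [[a b] [a' b']|[x y]|[x y]].
  - by rewrite !jE /= => -[/i1I -> /i2I ->].
  - have [[a <-] [b <-]] := (g1S x, g2S y); by exists (a, b); rewrite hE.
  - rewrite hE /=; split=> [[/e1[a <-] /e2[b <-]]|[[a b]]]; first by exists (a, b); rewrite jE.
    rewrite jE /= => -[<- <-]; congr (_, _); first by apply/e1; exists a.
    by apply/e2; exists b.
have pPP := projective_prod pP pP.
apply: pd_le_iso (schanuel pP pPP s sj) _.
exact: pd_le_add_projective.
Qed.

(** By Schanuel's lemma, the syzygies of two presentations of M agree up to projective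
    summands. *)
Lemma pd_le_syzygy n M C P (i : {linear C -> P}) (g : {linear P -> M}) :
  projective P -> ses i g -> pd_le n.+1 M <-> pd_le n C.
Proof.
move=> pP s; split=> [[P0 [C0 [i0 [g0 [pP0 s0 pC0]]]]]|pC]; last by exists P, C, i, g.
apply: (@pd_le_summand _ _ P0); apply: pd_le_iso (schanuel pP0 pP s0 s) _.
exact: pd_le_add_projective.
Qed.

Lemma pdim_leP M n : le_enat (pdim M) (Fin n) <-> pd_le n M.
Proof.
rewrite -pd_leP; apply: leastP => m k mk [P [d [eps [pP P0 epsS exE exd]]]].
exists P, d, eps; split=> // j kj; apply: P0; exact: leq_ltn_trans kj.
Qed.

Lemma pdim_iso M N : lmod_iso M N -> pdim M = pdim N.
Proof.
move=> MN; apply: enat_le_ext => n; rewrite !pdim_leP.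
by split; apply: pd_le_iso => //; apply: lmod_iso_sym.
Qed.

End ModuleTheory.

(** * Linear algebra over the ground field *)

Section LinearAlgebra.
Variables (K : fieldType) (Q : quiver) (L : nat).
Local Notation Lam := (tpa K Q L).
Implicit Types (M N : lmodType Lam) (k : K).

Definition scal k : Lam := k *: (1 : Lam).

Lemma scalE k (f : Lam) : scal k * f = k *: f.
Proof. by rewrite /scal [LHS]tpa_mulZl tpa_mul1l. Qed.

Lemma scalC k (f : Lam) : f * scal k = scal k * f.
Proof. by rewrite scalE [LHS]tpa_mulZr [X in _ *: X]tpa_mul1r. Qed.

Lemma scal0 : scal 0 = 0. Proof. exact: scale0r. Qed.
Lemma scal1 : scal 1 = 1. Proof. exact: scale1r. Qed.
Lemma scalD k k' : scal (k + k') = scal k + scal k'. Proof. exact: scalerDl. Qed.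
Lemma scalN k : scal (- k) = - scal k. Proof. exact: scaleNr. Qed.
Lemma scalM k k' : scal (k * k') = scal k * scal k'.
Proof. by rewrite scalE [RHS]scalerA. Qed.
Lemma scal_sum (I : finType) (P : pred I) (c : I -> K) :
  scal (\sum_(i | P i) c i) = \sum_(i | P i) scal (c i).
Proof. exact: scaler_suml. Qed.

Lemma tpa_act M (f : Lam) (x : M) :
  f *: x = \sum_p scal (f p) *: ((path_elt K p : Lam) *: x).
Proof.
rewrite {1}[f]tpaE scaler_suml; apply: eq_bigr => p _.
by rewrite scalerA scalE.
Qed.

Section Combinations.
Variable M : lmodType Lam.

Definition lcomb (F : finType) (S : pred F) (b : F -> M) (c : F -> K) : M :=
  \sum_(f | S f) scal (c f) *: b f.

Definition span (F : finType) (S : pred F) (b : F -> M) (x : M) : Prop :=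
  exists c, x = lcomb S b c.

Definition free_mod (Y : {pred M}) (F : finType) (S : pred F) (b : F -> M) : Prop :=
  forall c, lcomb S b c \in Y -> forall f, S f -> c f = 0.

Definition free (F : finType) (S : pred F) (b : F -> M) : Prop :=
  forall c, lcomb S b c = 0 -> forall f, S f -> c f = 0.

Variables (F : finType).
Implicit Types (S T : pred F) (b : F -> M) (c : F -> K).

Lemma lcombD S b c c' : lcomb S b c + lcomb S b c' = lcomb S b (fun f => c f + c' f).
Proof. by rewrite -big_split; apply: eq_bigr => f _; rewrite scalD scalerDl. Qed.

Lemma lcombZ S b k c : scal k *: lcomb S b c = lcomb S b (fun f => k * c f).
Proof. by rewrite scaler_sumr; apply: eq_bigr => f _; rewrite scalM scalerA. Qed.

Lemma eq_lcomb S b c c' : (forall f, S f -> c f = c' f) -> lcomb S b c = lcomb S b c'.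
Proof. by move=> cc'; apply: eq_bigr => f /cc' ->. Qed.

Lemma lcomb0 S b c : (forall f, S f -> c f = 0) -> lcomb S b c = 0.
Proof. by move=> c0; apply: big1 => f /c0 ->; rewrite scal0 scale0r. Qed.

Lemma lcomb1 S b f : S f -> lcomb S b (fun g => (g == f)%:R) = b f.
Proof.
move=> Sf; rewrite /lcomb (bigD1 f) //= eqxx scal1 scale1r big1 ?addr0 // => g.
by move=> /andP[_ /negbTE ->]; rewrite scal0 scale0r.
Qed.

Lemma lcomb_enum S b c :
  lcomb S b c = \sum_(j < #|S|) scal (c (enum_val j)) *: b (enum_val j).
Proof. by rewrite /lcomb (eq_bigl (mem S)) // big_enum_val. Qed.

Lemma ex_enum_coef S (u : 'I_#|S| -> K) : exists c, forall j, c (enum_val j) = u j.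
Proof.
exists (fun f => \sum_(j < #|S| | enum_val j == f) u j) => j.
by rewrite (eq_bigl (pred1 j)) ?big_pred1_eq // => k; rewrite (inj_eq enum_val_inj).
Qed.

Lemma span0 S b : span S b 0.
Proof. by exists (fun=> 0); rewrite lcomb0. Qed.

Lemma spanD S b x y : span S b x -> span S b y -> span S b (x + y).
Proof. by move=> [c ->] [c' ->]; eexists; rewrite lcombD. Qed.

Lemma spanZ S b k x : span S b x -> span S b (scal k *: x).
Proof. by move=> [c ->]; eexists; rewrite lcombZ. Qed.

Lemma spanN S b x : span S b x -> span S b (- x).
Proof. by move=> /(spanZ (-1)); rewrite scalN scal1 scaleN1r. Qed.

Lemma spanB S b x y : span S b x -> span S b y -> span S b (x - y).
Proof. by move=> Sx Sy; apply: spanD => //; apply: spanN. Qed.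

Lemma span_mem S b f : S f -> span S b (b f).
Proof. by move=> Sf; exists (fun g => (g == f)%:R); rewrite lcomb1. Qed.

Lemma span_sum S b (I : Type) (r : seq I) (P : pred I) (x : I -> M) :
  (forall i, P i -> span S b (x i)) -> span S b (\sum_(i <- r | P i) x i).
Proof. by move=> H; elim/big_ind: _ => //; [exact: span0 | exact: spanD]. Qed.

Lemma lcomb_inj S b c c' : free S b -> lcomb S b c = lcomb S b c' ->
  forall f, S f -> c f = c' f.
Proof.
move=> fr cc' f Sf; apply/eqP; rewrite -subr_eq0; apply/eqP.
apply: (fr (fun f => c f - c' f)) => //.
have -> : (fun f => c f - c' f) = (fun f => c f + (-1) * c' f).
  by apply: funext => g; rewrite mulN1r.
by rewrite -lcombD -lcombZ cc' scalN scal1 scaleN1r subrr.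
Qed.

Lemma free_sub S T b : (forall f, T f -> S f) -> free S b -> free T b.
Proof.
move=> TS fr c c0 f Tf; pose c' g := if T g then c g else 0.
have := fr c'; rewrite /c'; move/(_ _ f (TS f Tf)); rewrite Tf; apply.
rewrite -[RHS]c0 /lcomb big_mkcond [RHS]big_mkcond; apply: eq_bigr => g _.
case Tg: (T g); first by rewrite TS.
by case: ifP => // _; rewrite scal0 scale0r.
Qed.

End Combinations.

Lemma span_trans M (F G : finType) (S : pred F) (T : pred G) (b : F -> M) (d : G -> M) x :
  (forall f, S f -> span T d (b f)) -> span S b x -> span T d x.
Proof. by move=> H [c ->]; apply: span_sum => f /H; apply: spanZ. Qed.

Lemma span_sub M (F : finType) (S T : pred F) (b : F -> M) x :
  (forall f, S f -> T f) -> span S b x -> span T b x.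
Proof. by move=> ST; apply: span_trans => f /ST; apply: span_mem. Qed.

Lemma linear_lcomb M N (h : {linear M -> N}) (F : finType) (S : pred F) b c :
  h (lcomb S b c) = lcomb S (h \o b) c.
Proof. by rewrite linear_sum; apply: eq_bigr => f _; rewrite linearZ. Qed.

Lemma act_lcomb M (a : Lam) (F : finType) (S : pred F) (b : F -> M) c :
  a *: lcomb S b c = lcomb S (fun f => a *: b f) c.
Proof.
by rewrite scaler_sumr; apply: eq_bigr => f _; rewrite scalerA scalC -scalerA.
Qed.

Lemma free_inj M N (h : {linear M -> N}) (F : finType) (S : pred F) b :
  injective h -> free S b -> free S (h \o b).
Proof. by move=> hI fr c; rewrite -linear_lcomb -(linear0 h) => /hI; apply: fr. Qed.

Lemma span_act M (a : Lam) (F G : finType) (S : pred F) (T : pred G) (b : F -> M)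
    (d : G -> M) x :
  (forall f, S f -> span T d (a *: b f)) -> span S b x -> span T d (a *: x).
Proof. by move=> H [c ->]; rewrite act_lcomb; apply: (span_trans H); eexists. Qed.

(** If more than n vectors are combinations of n others, the left kernel of the matrix
    of coefficients contains a nontrivial relation between them. *)
Lemma free_card_le M (F G : finType) (S : pred F) (T : pred G) (b : F -> M) (d : G -> M) :
  free S b -> (forall f, S f -> span T d (b f)) -> (#|S| <= #|T|)%N.
Proof.
move=> fr sp.
have /choice[A AE] : forall f : F, exists c : G -> K, S f -> b f = lcomb T d c.
  move=> f; case Sf: (S f); last by exists (fun=> 0).
  by have [c ->] := sp f Sf; exists c.
rewrite leqNgt; apply/negP => TS.
pose B := \matrix_(i < #|S|, j < #|T|) A (enum_val i) (enum_val j).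
have : kermx B != 0.
  rewrite -mxrank_eq0 mxrank_ker subn_eq0 -ltnNge.
  by apply: leq_ltn_trans TS; apply: rank_leq_col.
move=> /rowV0Pn[v /sub_kermxP vB /rV0Pn[i vi]].
have [c cE] := ex_enum_coef (fun j : 'I_#|S| => v 0 j).
have : c (enum_val i) = 0.
  apply: fr; last exact: enum_valP.
  rewrite lcomb_enum.
  under eq_bigr => j _ do rewrite cE (AE _ (enum_valP j)) lcombZ.
  rewrite exchange_big /= (eq_bigl (mem T)) // big_enum_val /= big1 // => j _.
  rewrite -scaler_suml -scal_sum.
  have := congr1 (fun X : 'rV_ _ => X 0 j) vB; rewrite !mxE => vBj.
  rewrite (eq_bigr (fun i' => v 0 i' * B i' j)) ?vBj ?scal0 ?scale0r // => i' _.
  by rewrite mxE.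
by rewrite cE => /eqP; rewrite (negbTE vi).
Qed.

(** Among the subfamilies free modulo Y take a largest one. *)
Lemma extract_free M (Y : submodClosed M) (F : finType) (S : pred F) (b : F -> M) :
  exists T : pred F, [/\ forall f, T f -> S f, free_mod Y T b &
    forall f, S f -> exists2 y, y \in Y & span T b (b f - y)].
Proof.
pose P (A : {set F}) := `[< {subset A <= S} /\ free_mod Y (mem A) b >].
have P0 : P finset.set0.
  by apply/asboolP; split=> [f|c _ f]; rewrite /= inE.
have [A /maxsetP[/asboolP[AS fA] maxA] _] := maxset_exists P0.
exists (mem A); split=> // f Sf.
case Af: (f \in A).
  by exists 0; [exact: rpred0 | rewrite subr0; apply: span_mem].
have : ~ (free_mod Y (mem (f |: A)) b).
  move=> fr; have /maxA -/(_ (finset.subsetUr _ _))/setP/(_ f) : P (f |: A).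
    by apply/asboolP; split=> // g; rewrite !inE => /orP[/eqP->|/AS].
  by rewrite !inE eqxx Af.
move=> /existsNP[c /not_implyP[cY /existsNP[g /not_implyP[gA cg]]]].
have E : lcomb (mem (f |: A)) b c = scal (c f) *: b f + lcomb (mem A) b c.
  by rewrite /lcomb (big_setU1 _ (negbT Af)).
have cf : c f != 0.
  apply/eqP => cf; move: cY; rewrite E cf scal0 scale0r add0r => /fA c0.
  by apply: cg; move: gA; rewrite /= !inE => /orP[/eqP->//|/c0].
exists (scal (c f)^-1 *: (scal (c f) *: b f + lcomb (mem A) b c)).
  by apply: rpredZ; rewrite -E.
rewrite scalerDr scalerA -scalM mulVf // scal1 scale1r opprD addNKr.
by apply: spanN; apply: spanZ; eexists.
Qed.

(** Unitriangular changes of families: lead g is the leading term of d g, and rho is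
    larger at the other terms. Both lemmas are inductions on rho. *)
Section Triangular.
Variables (M : lmodType Lam) (F G : finType) (S : pred F) (T : pred G).
Variables (b : F -> M) (d : G -> M) (lead : G -> F) (rho : F -> nat).
Hypothesis lead_in : forall g, T g -> S (lead g).
Hypothesis tri : forall g, T g ->
  span (fun f => S f && (rho (lead g) < rho f)%N) b (d g - b (lead g)).

Lemma triangular_span : (forall f, S f -> exists2 g, T g & lead g = f) ->
  forall f, S f -> span T d (b f).
Proof.
move=> onto; pose m := (\max_f rho f).+1.
suff H n f : S f -> (m - rho f < n)%N -> span T d (b f).
  by move=> f Sf; apply: (H (m - rho f).+1).
elim: n f => // n IH f Sf fn; have [g Tg gf] := onto f Sf.
have -> : b f = d g - (d g - b f) by rewrite opprB addrCA subrr addr0.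
apply: spanB; first exact: span_mem.
have := tri Tg; rewrite gf; apply: span_trans => h /andP[Sh fh].
apply: IH => //.
have : (rho h < m)%N by rewrite ltnS leq_bigmax.
by lia.
Qed.

Lemma triangular_free : {in T &, injective lead} -> free S b -> free T d.
Proof.
move=> leadI fr c c0.
have /choice[A AE] : forall g, exists a : F -> K, T g ->
    d g = b (lead g) + lcomb (fun f => S f && (rho (lead g) < rho f)%N) b a.
  move=> g; case Tg: (T g); last by exists (fun=> 0).
  by have [a aE] := tri Tg; exists a; rewrite -aE addrC subrK.
(* The coefficient of lead g in the relation is c g plus terms c h with h of smaller
   lead. *)
pose A' g f := if (rho (lead g) < rho f)%N then A g f else 0.
have A'E g : T g -> d g = lcomb S b (fun f => (f == lead g)%:R + A' g f).
  move=> Tg; rewrite (AE g Tg) -lcombD lcomb1; last exact: lead_in.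
  congr (_ + _); rewrite /lcomb big_mkcondr; apply: eq_bigr => f _.
  by rewrite /A'; case: ifP => // _; rewrite scal0 scale0r.
have c0' : lcomb S b (fun f => \sum_(g | T g) c g * ((f == lead g)%:R + A' g f)) = 0.
  rewrite -[RHS]c0 [RHS](eq_bigr (fun g => lcomb S b (fun f => c g * ((f == lead g)%:R + A' g f)))).
    rewrite exchange_big; apply: eq_bigr => f _.
    by rewrite scal_sum scaler_suml.
  by move=> g Tg; rewrite {1}(A'E g Tg) lcombZ.
suff H n g : T g -> (rho (lead g) < n)%N -> c g = 0 by move=> g Tg; apply: (H _ g Tg (leqnn _)).
elim: n g => // n IH g Tg gn.
have := fr _ c0' (lead g) (lead_in Tg).
rewrite (bigD1 g) //= eqxx /A' ltnn addr0 mulr1 big1 ?addr0 // => h /andP[Th hg].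
rewrite (negbTE (_ : lead g != lead h)); last first.
  by apply: contra_neq hg => /leadI ->.
rewrite add0r; case: ltnP => gh; last by rewrite mulr0.
by rewrite (IH h) ?mul0r //; apply: leq_trans gh _; rewrite -ltnS.
Qed.

End Triangular.

(** * Bases and isomorphisms *)

Definition basis M (F : finType) (S : pred F) (b : F -> M) : Prop :=
  free S b /\ forall x, span S b x.

(** Families with the same structure constants: every path multiplies b and d
    by the same formulas. *)
Definition same_action M N (F : finType) (S : pred F) (b : F -> M) (d : F -> N) : Prop :=
  forall (p : tpath Q L) f, S f -> exists c,
    (path_elt K p : Lam) *: b f = lcomb S b c /\ (path_elt K p : Lam) *: d f = lcomb S d c.

(** The K-linear map from b to d commutes with the paths, which span the algebra. *)
Lemma basis_iso M N (F : finType) (S : pred F) (b : F -> M) (d : F -> N) :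
  basis S b -> basis S d -> same_action S b d -> lmod_iso M N.
Proof.
move=> [bf bs] [df ds] same.
have /choice[co coE] := bs.
have hE c : lcomb S d (co (lcomb S b c)) = lcomb S d c.
  by apply: eq_lcomb => f Sf; apply: (lcomb_inj bf) Sf; rewrite -coE.
pose h x := lcomb S d (co x).
have hD x y : h (x + y) = h x + h y.
  by rewrite /h lcombD {1}[x]coE {1}[y]coE lcombD hE.
have hZ k x : h (scal k *: x) = scal k *: h x.
  by rewrite /h lcombZ {1}[x]coE lcombZ hE.
have h0 : h 0 = 0 by rewrite -(scale0r 0) -scal0 hZ scal0 scale0r.
have hsum (I : finType) (P : pred I) (u : I -> M) :
    h (\sum_(i | P i) u i) = \sum_(i | P i) h (u i).
  by elim/big_rec2: _ => // i u' v' _ <-.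
have hb f : S f -> h (b f) = d f by move=> Sf; rewrite /h -(lcomb1 b Sf) hE lcomb1.
have hp (p : tpath Q L) x : h ((path_elt K p : Lam) *: x) = (path_elt K p : Lam) *: h x.
  rewrite {1}[x]coE act_lcomb /h act_lcomb -/(h _) /lcomb hsum; apply: eq_bigr => f Sf.
  have [c [cb cd]] := same p f Sf.
  by rewrite hZ cb cd; congr (_ *: _); apply: hE.
have [g gE] : exists g : {linear M -> N}, g =1 h.
  apply: ex_linear => a x y; rewrite hD tpa_act hsum [a *: h x]tpa_act; congr (_ + _).
  by apply: eq_bigr => p _; rewrite hZ hp.
apply: (@inj_surj_iso _ _ _ g) => [x y|y].
  rewrite !gE /h => /(lcomb_inj df) cxy; rewrite [x]coE [y]coE.
  exact: eq_lcomb.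
by have [c ->] := ds y; exists (lcomb S b c); rewrite gE /h hE.
Qed.

(** Allows bases of two modules with equal multiplicities to be compared over one index
    set; the labels are the vertices of the basis vectors, possibly with their layers. *)
Lemma relabel N (F G T : finType) (S : pred F) (S' : pred G) (l : F -> T) (l' : G -> T)
    (d : G -> N) :
  (forall t, #|[pred f | S f && (l f == t)]| = #|[pred g | S' g && (l' g == t)]|) ->
  exists d' : F -> N, [/\ free S' d -> free S d',
    forall f, S f -> exists g, [/\ S' g, l' g = l f & d' f = d g] &
    forall g, S' g -> exists f, [/\ S f, l f = l' g & d' f = d g]].
Proof.
move=> cE.
have [f0 Sf0|S0] := pickP S; last first.
  exists (fun=> 0); split=> [_ c _ f|f|g S'g]; rewrite ?S0 //.
  have := cE (l' g); rewrite eq_card0 => [/esym|f]; last by rewrite /= !inE; have /= -> := S0 f.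
  by move=> /card0_eq/(_ g); rewrite !inE S'g eqxx.
pose E t := enum [pred f | S f && (l f == t)].
pose E' t := enum [pred g | S' g && (l' g == t)].
have sE t : size (E t) = size (E' t) by rewrite -!cardE cE.
have : (0 < size (E (l f0)))%N.
  by rewrite -has_predT; apply/hasP; exists f0; rewrite ?mem_enum ?inE ?Sf0 ?eqxx.
rewrite sE; case: (E' (l f0)) => // g0 _ _.
pose phi f := nth g0 (E' (l f)) (index f (E (l f))).
pose psi g := nth f0 (E (l' g)) (index g (E' (l' g))).
have phiP f : S f -> [/\ S' (phi f), l' (phi f) = l f & psi (phi f) = f].
  move=> Sf; have fE : f \in E (l f) by rewrite mem_enum inE Sf eqxx.
  have iE' : (index f (E (l f)) < size (E' (l f)))%N by rewrite -sE index_mem.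
  have : phi f \in E' (l f) by apply: mem_nth.
  rewrite mem_enum inE => /andP[S'f /eqP lf]; split=> //.
  by rewrite /psi lf index_uniq ?enum_uniq // nth_index.
have psiP g : S' g -> [/\ S (psi g), l (psi g) = l' g & phi (psi g) = g].
  move=> Sg; have gE : g \in E' (l' g) by rewrite mem_enum inE Sg eqxx.
  have iE : (index g (E' (l' g)) < size (E (l' g)))%N by rewrite sE index_mem.
  have : psi g \in E (l' g) by apply: mem_nth.
  rewrite mem_enum inE => /andP[Sg' /eqP lg]; split=> //.
  by rewrite /phi lg index_uniq ?enum_uniq // nth_index.
exists (d \o phi); split=> [fr c c0 f Sf|f Sf|g Sg].
- have [S'f _ ff] := phiP f Sf.
  have <- : c (psi (phi f)) = c f by rewrite ff.
  apply: (fr (c \o psi)) => //; rewrite -[RHS]c0 /lcomb.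
  rewrite (reindex_onto phi psi) /=; last by move=> g /psiP[].
  apply: eq_big => [h|h /andP[_ /eqP -> //]].
  apply/andP/idP => [[S'h /eqP <-]|/phiP[-> _ ->] //].
  by have [] := psiP _ S'h.
- by have [S'f lf _] := phiP f Sf; exists (phi f).
- by have [Sg' lg pg] := psiP g Sg; exists (psi g); rewrite /= pg.
Qed.

End LinearAlgebra.

(** * Radical powers of modules over a truncated path algebra *)

Section RadicalPowers.
Variables (K : fieldType) (Q : quiver) (L : nat).
Local Notation Lam := (tpa K Q L).
Implicit Types (M N : lmodType Lam) (e i : vertex Q) (w u : seq (arrow Q)) (a : arrow Q).

Definition res e w : Lam := residue K L e w.
Definition ver i : Lam := res i [::].
Definition arr a : Lam := res (source a) [:: a].

Lemma res_tpath (p : tpath Q L) : path_elt K p = res (tstart p) (tarrows p).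
Proof. by rewrite /res residue_tpath. Qed.

Lemma res_nonpath e w : ~~ is_path e w -> res e w = 0.
Proof. exact: residue_not_path. Qed.

Lemma res_long e w : (L < size w)%N -> res e w = 0.
Proof. by rewrite /res; case: residueP => // p _ _ _; rewrite ltnNge => ->. Qed.

Lemma ex_tpath e w : is_path e w -> (size w <= L)%N ->
  exists p : tpath Q L, tstart p = e /\ tarrows p = w.
Proof.
move=> pw wL; pose s : L.-bseq (arrow Q) := Bseq wL.
by exists (exist (fun p : vertex Q * L.-bseq (arrow Q) => is_path p.1 p.2) (e, s) pw).
Qed.

Lemma tpath_inj (p q : tpath Q L) : tstart p = tstart q -> tarrows p = tarrows q -> p = q.
Proof.
move=> pq1 pq2; apply: val_inj; apply: injective_projections => //.
exact: val_inj.
Qed.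

Lemma res_cat e w w' : res (endpoint e w) w' * res e w = res e (w ++ w').
Proof.
have [pw|nw] := boolP (is_path e w); last first.
  by rewrite (res_nonpath nw) mulr0 res_nonpath // is_path_cat (negbTE nw).
have [pw'|nw'] := boolP (is_path (endpoint e w) w'); last first.
  by rewrite (res_nonpath nw') mul0r res_nonpath // is_path_cat pw.
by rewrite /res [LHS]tpa_mul_residue // eqxx.
Qed.

Lemma res_mul0 e w e' w' : e' != endpoint e w -> res e' w' * res e w = 0.
Proof.
move=> ne; have [pw|nw] := boolP (is_path e w); last by rewrite (res_nonpath nw) mulr0.
have [pw'|nw'] := boolP (is_path e' w'); last by rewrite (res_nonpath nw') mul0r.
by rewrite /res [LHS]tpa_mul_residue // eq_sym (negbTE ne).
Qed.

Lemma ver_res i e w : ver i * res e w = if i == endpoint e w then res e w else 0.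
Proof.
case: eqP => [->|/eqP ne]; last exact: res_mul0.
by rewrite res_cat cats0.
Qed.

Lemma res_ver e w : res e w * ver e = res e w.
Proof. by rewrite -{1}[e]/(endpoint e [::]) res_cat. Qed.

Lemma arr_res a e w : endpoint e w = source a -> arr a * res e w = res e (rcons w a).
Proof. by rewrite /arr => <-; rewrite res_cat cats1. Qed.

Lemma ver_sum : \sum_i ver i = 1.
Proof. by []. Qed.

Lemma sum_ver M (x : M) : x = \sum_i ver i *: x.
Proof. by rewrite -scaler_suml ver_sum scale1r. Qed.

(** The submodule J^l M, see radpow_incl. *)
Definition Jpow M (l : nat) : {pred M} :=
  gen_by [set v : M | exists e w y, size w = l /\ v = res e w *: y].

Arguments Jpow M l : clear implicits.

HB.instance Definition _ M l := GRing.SubmodClosed.on (Jpow M l).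

Lemma Jpow_res M l e w (y : M) : (l <= size w)%N -> res e w *: y \in Jpow M l.
Proof.
move=> lw; rewrite -[w](cat_take_drop (size w - l)) -res_cat -scalerA.
apply: mem_gen_by; exists (endpoint e (take (size w - l) w)), (drop (size w - l) w).
by eexists; split=> //; rewrite size_drop; lia.
Qed.

Lemma Jpow_ind M l (P : M -> Prop) : P 0 -> (forall x y, P x -> P y -> P (x + y)) ->
  (forall e w y, (l <= size w)%N -> P (res e w *: y)) -> forall x, x \in Jpow M l -> P x.
Proof.
move=> P0 PD Pr x /asboolP[s sX ->]; rewrite big_seq.
elim/big_ind: _ => // -[f v] /sX [e [w [y [sw vE]]]]; move: vE => /= ->.
rewrite (tpa_act f); elim/big_ind: _ => // p _; rewrite res_tpath scalerA.
have [ps|ps] := eqVneq (tstart p) (endpoint e w); last first.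
  by rewrite scalerA -mulrA res_mul0 // mulr0 scale0r.
rewrite scalerA -mulrA ps res_cat -scalC -scalerA.
by apply: Pr; rewrite size_cat sw leq_addr.
Qed.

Lemma Jpow0 M (x : M) : x \in Jpow M 0.
Proof. by rewrite [x]sum_ver; apply: rpred_sum => i _; apply: Jpow_res. Qed.

Lemma Jpow_le M l l' (x : M) : (l <= l')%N -> x \in Jpow M l' -> x \in Jpow M l.
Proof.
move=> ll'; elim/Jpow_ind => [|y z|e w y lw]; first exact: rpred0.
  exact: rpredD.
by apply: Jpow_res; apply: leq_trans lw.
Qed.

Lemma Jpow_top M (x : M) : x \in Jpow M L.+1 -> x = 0.
Proof.
elim/Jpow_ind => // [y z -> ->|e w y Lw]; first by rewrite addr0.
by rewrite res_long // scale0r.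
Qed.

Lemma Jpow_indS M l (P : M -> Prop) : P 0 -> (forall x y, P x -> P y -> P (x + y)) ->
  (forall a y, y \in Jpow M l -> P (arr a *: y)) -> forall x, x \in Jpow M l.+1 -> P x.
Proof.
move=> P0 PD Pa; apply: Jpow_ind => // e w y.
case/lastP: w => // w a; rewrite size_rcons => lw.
have [/andP[pw /eqP sa]|nw] := boolP (is_path e w && (source a == endpoint e w)).
  by rewrite -arr_res // -scalerA; apply: Pa; apply: Jpow_res.
by rewrite res_nonpath ?scale0r // is_path_rcons.
Qed.

Lemma Jpow_act M l e w (x : M) : x \in Jpow M l -> res e w *: x \in Jpow M (l + size w).
Proof.
elim/Jpow_ind => [|y z yJ zJ|e' w' y lw].
- by rewrite scaler0 rpred0.
- by rewrite scalerDr rpredD.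
have [->|ne] := eqVneq e (endpoint e' w'); last first.
  by rewrite scalerA res_mul0 // scale0r rpred0.
by rewrite scalerA res_cat; apply: Jpow_res; rewrite size_cat leq_add2r.
Qed.

Lemma Jpow_arr M l a (x : M) : x \in Jpow M l -> arr a *: x \in Jpow M l.+1.
Proof. by move=> /(Jpow_act (source a) [:: a]); rewrite addn1. Qed.

Lemma Jpow_linear_surj M N (h : {linear M -> N}) l y : surjective h ->
  y \in Jpow N l -> exists2 x, x \in Jpow M l & h x = y.
Proof.
move=> hS; elim/Jpow_ind => [|y1 y2 [x1 J1 <-] [x2 J2 <-]|e w z lw].
- by exists 0; rewrite ?rpred0 ?linear0.
- by exists (x1 + x2); rewrite ?rpredD ?linearD.
have [x <-] := hS z; exists (res e w *: x); last by rewrite linearZ.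
exact: Jpow_res.
Qed.

(** * The Jacobson radical is spanned by the paths of positive length *)

Definition triv i : tpath Q L :=
  exist (fun p : vertex Q * L.-bseq (arrow Q) => is_path p.1 p.2) (i, [bseq]) isT.

Lemma res_triv e w i : res e w (triv i) = ((e == i) && (w == [::]))%:R.
Proof.
rewrite /res; case: residueP => [p <- <- _ _|].
  rewrite ffunE; congr (_%:R); congr nat_of_bool.
  apply/eqP/andP => [<- //|[/eqP pi /eqP pw]].
  by apply: tpath_inj.
by rewrite ffunE; case: eqP => //= ->; case: eqP => //= ->.
Qed.

Lemma eq_triv i p : (p == triv i) = (tstart p == i) && (tarrows p == [::]).
Proof.
by apply/eqP/andP => [-> //|[/eqP pi /eqP pw]]; apply: tpath_inj.
Qed.

(** A product of two paths is a vertex only if both factors are. *)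
Lemma mul_triv (f g : Lam) i : (f * g) (triv i) = f (triv i) * g (triv i).
Proof.
have E p q : (if tend q == tstart p then residue K L (tstart q) (tarrows q ++ tarrows p)
    else 0) (triv i) = ((p == triv i) && (q == triv i))%:R :> K.
  rewrite !eq_triv; case: eqP => [qp|qp].
    rewrite -/(res _ _) res_triv -qp -!size_eq0 size_cat addn_eq0.
    case q0: (size (tarrows q)) => [|n] /=; last by rewrite !andbF.
    by rewrite /tend (size0nil q0) /endpoint /=; case: (tstart q == i); rewrite ?andbT ?andbF.
  rewrite ffunE; case: eqP => //= pi; case: eqP => //= p0; case: eqP => //= qi.
  by case: eqP => // q0; case: qp; rewrite pi /tend q0 qi.
rewrite [LHS]sum_ffunE (bigD1 (triv i)) //= sum_ffunE (bigD1 (triv i)) //=.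
rewrite !big1 ?addr0 => [|p /negbTE pi|q /negbTE qi].
- by rewrite ffunE E eqxx /=; apply: mulr1.
- by rewrite sum_ffunE big1 // => q _; rewrite ffunE E pi; apply: mulr0.
- by rewrite ffunE E qi andbF; apply: mulr0.
Qed.

Definition triv_ideal i : {pred Lam^o} := [pred f | (f : Lam) (triv i) == 0].

Lemma triv_ideal_closed i : GRing.submod_closed (triv_ideal i).
Proof.
split=> [|b f g /eqP f0 /eqP g0]; first by rewrite inE /= ffunE.
by rewrite inE /= ffunE [X in X + _]mul_triv f0 g0 mulr0 addr0.
Qed.

HB.instance Definition _ i :=
  GRing.isSubmodClosed.Build Lam Lam^o (triv_ideal i) (triv_ideal_closed i).

Lemma one_triv i : (1 : Lam) (triv i) = 1.
Proof.
rewrite -ver_sum sum_ffunE (bigD1 i) //= [ver i _]res_triv !eqxx big1 ?addr0 // => j ji.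
by rewrite [ver j _]res_triv (negbTE ji).
Qed.

(** The quotient by this left ideal is one-dimensional over K. *)
Lemma triv_ideal_maximal i : maximal_left_ideal (triv_ideal i).
Proof.
split=> [|I sI I1 f If]; first by rewrite inE /= one_triv oner_eq0.
rewrite inE /=; apply: contraT => f0; case/negP: I1.
pose c : K := f (triv i).
have g0 : f - scal Q L c *: (1 : Lam^o) \in triv_ideal i.
  rewrite inE /= !ffunE [_ *: _]mulr1 /scal ffunE one_triv.
  by rewrite [_ *: 1]mulr1 subrr.
have : scal Q L c^-1 *: (f - (f - scal Q L c *: (1 : Lam^o))) \in I.
  by apply: rpredZ; apply: submodB => //; apply: sI.
by rewrite opprB addrC subrK scalerA -scalM mulVf // scal1 scale1r.
Qed.

(** A non-member a of a maximal left ideal I would satisfy 1 - b a in I for some b;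
    then 1 - (b a)^j is in I for all j, although b a is nilpotent. *)
Lemma jacobsonP (f : Lam) : jacobson f <-> forall i, f (triv i) = 0.
Proof.
split=> [jf i|f0 I [I1 maxI]].
  by have /eqP := jf (triv_ideal i) (triv_ideal_maximal i).
apply: contrapT => nI.
pose I' : {pred Lam^o} := gen_by [set g : Lam^o | g \in I \/ g = f].
have : (1 : Lam^o) \in I'.
  apply: contraT => I'1; case: nI.
  apply: (maxI [the submodClosed _ of I']) => //; last by apply: mem_gen_by; right.
  by move=> g Ig; apply: mem_gen_by; left.
have : forall g, g \in I' -> exists b, g - b *: (f : Lam^o) \in I.
  move=> g /asboolP[s sX ->]; rewrite big_seq; elim/big_ind: _ => [|x y [b xb] [c yc]|[h x] /sX].
  - by exists 0; rewrite scale0r subr0 rpred0.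
  - by exists (b + c); rewrite scalerDl opprD addrACA rpredD.
  - move=> /= [xI|->]; last by exists h; rewrite subrr rpred0.
    by exists 0; rewrite scale0r subr0 rpredZ.
move=> H /H[b bI]; set c : Lam := b * f.
have cI j : (1 : Lam^o) - (c ^+ j : Lam) \in I.
  elim: j => [|j IH]; first by rewrite expr0 subrr rpred0.
  have -> : (1 : Lam^o) - (c ^+ j.+1 : Lam) =
      (1 - (c ^+ j : Lam^o)) + (c ^+ j : Lam) *: ((1 : Lam^o) - c).
    by rewrite scalerBr /GRing.scale /= mulr1 -exprSr addrA subrK.
  by apply: rpredD => //; apply: rpredZ.
have cJ j : (c ^+ j : Lam^o) \in Jpow Lam^o j.
  elim: j => [|j IH]; first exact: Jpow0.
  have -> : (c ^+ j.+1 : Lam^o) =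
      \sum_p scal Q L (c p) *: ((path_elt K p : Lam) *: (c ^+ j : Lam^o)).
    by rewrite -tpa_act exprS.
  apply: rpred_sum => p _; rewrite res_tpath.
  case sp: (size (tarrows p)) => [|n]; last first.
    by apply: rpredZ; apply: Jpow_le (Jpow_act _ _ IH); rewrite sp addnS ltnS leq_addr.
  suff -> : c p = 0 by rewrite scal0 scale0r rpred0.
  have -> : p = triv (tstart p) by apply/eqP; rewrite eq_triv eqxx -size_eq0 sp.
  by rewrite mul_triv f0 mulr0.
by have := cI L.+1; rewrite (Jpow_top (cJ L.+1)) subr0 (negbTE I1).
Qed.

Lemma rad_gensE M x : x \in gen_by (@rad_gens _ M) = (x \in Jpow M 1).
Proof.
apply/idP/idP; apply: gen_by_min => y.
  move=> [f /jacobsonP f0 [z ->]]; rewrite tpa_act; apply: rpred_sum => p _.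
  rewrite res_tpath; case sp: (size (tarrows p)) => [|n]; last first.
    by apply: rpredZ; apply: Jpow_res; rewrite sp.
  suff -> : f p = 0 by rewrite scal0 scale0r rpred0.
  have -> : p = triv (tstart p) by apply/eqP; rewrite eq_triv eqxx -size_eq0 sp.
  exact: f0.
move=> [e [w [z [sw ->]]]]; apply: mem_gen_by; exists (res e w); last by exists z.
by apply/jacobsonP => i; rewrite res_triv; case: w sw => // b w _; rewrite andbF.
Qed.

Lemma radpow_incl M l : exists j : {linear radpow M l -> M},
  injective j /\ forall x, x \in Jpow M l <-> exists z, j z = x.
Proof.
elim: l => [|l [j [jI jJ]]].
  have [j jE] := ex_linear_id M.
  exists j; split=> [x y|x]; first by rewrite !jE.
  by split=> [_|_]; [exists x | exact: Jpow0].
have [k kE] := submodule_incl (gen_by (@rad_gens _ (radpow M l))).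
have [h hE] := ex_linear_comp k j.
exists h; split=> [x y|x]; first by rewrite !hE /= => /jI; rewrite !kE; apply: val_inj.
split=> [|[z <-]].
  elim/Jpow_indS => [|y1 y2 [z1 <-] [z2 <-]|a y /jJ[z <-]].
  - by exists 0; rewrite linear0.
  - by exists (z1 + z2); rewrite linearD.
  have az : arr a *: z \in gen_by (@rad_gens _ (radpow M l)).
    by rewrite rad_gensE; apply: Jpow_res.
  by exists (exist _ (arr a *: z) az); rewrite hE /= kE /= linearZ.
rewrite hE /= kE; have := valP z; rewrite rad_gensE.
elim/(@Jpow_indS (radpow M l) 0) => [|y1 y2 J1 J2|a y _].
- by rewrite linear0 rpred0.
- by rewrite linearD rpredD.
by rewrite linearZ; apply: Jpow_arr; apply/jJ; exists y.
Qed.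

(** Describes the layers, defined through iterated submodules, inside M itself. *)
Lemma layer_proj M l : exists (T : lmodType Lam) (j : {linear T -> M})
    (p : {linear T -> layer M l}),
  [/\ injective j, forall x, x \in Jpow M l <-> exists z, j z = x, surjective p &
      forall z, p z = 0 <-> j z \in Jpow M l.+1].
Proof.
have [j [jI jJ]] := radpow_incl M l.
have [p [pS pK]] := quotmodule_proj (gen_by (@rad_gens _ (radpow M l))).
exists (radpow M l), j, p; split=> // z; rewrite pK rad_gensE.
split=> [|jz].
  elim/(@Jpow_indS (radpow M l) 0) => [|y1 y2 J1 J2|a y _].
  - by rewrite linear0 rpred0.
  - by rewrite linearD rpredD.
  by rewrite linearZ; apply: Jpow_arr; apply/jJ; exists y.
suff : exists2 z', z' \in Jpow (radpow M l) 1 & j z' = j z by move=> [z' ? /jI <-].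
elim/Jpow_indS: jz => [|y1 y2 [z1 J1 <-] [z2 J2 <-]|a y /jJ[z' <-]].
- by exists 0; rewrite ?rpred0 ?linear0.
- by exists (z1 + z2); rewrite ?rpredD ?linearD.
by exists (arr a *: z'); rewrite ?linearZ //; apply: Jpow_res.
Qed.

Lemma layer_basis M l (F : finType) (S : pred F) (b : F -> M) :
  (forall f, S f -> b f \in Jpow M l) -> free_mod (Jpow M l.+1) S b ->
  (forall x, x \in Jpow M l -> exists2 y, y \in Jpow M l.+1 & span S b (x - y)) ->
  exists d : F -> layer M l, basis S d /\
    forall g f, S f -> g *: b f = b f -> g *: d f = d f.
Proof.
move=> bJ fr sp; have [T [j [p [jI jJ pS pK]]]] := layer_proj M l.
have /choice[z zE] : forall f, exists z, S f -> j z = b f.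
  move=> f; case Sf: (S f); last by exists 0.
  by have /jJ[z] := bJ f Sf; exists z.
have jlc c : j (lcomb S z c) = lcomb S b c.
  by rewrite linear_lcomb; apply: eq_bigr => f Sf /=; rewrite zE.
exists (p \o z); split; first split=> [c|x].
- by rewrite -linear_lcomb => /pK; rewrite jlc; apply: fr.
- have [t <-] := pS x; have [y yJ [c cE]] := sp (j t) ((jJ _).2 (ex_intro _ t erefl)).
  exists c; rewrite -linear_lcomb; apply/eqP; rewrite -subr_eq0 -linearB; apply/eqP/pK.
  by rewrite linearB jlc -cE opprB addrC subrK.
move=> g f Sf gb; rewrite /= -linearZ; congr (p _); apply: jI.
by rewrite linearZ zE.
Qed.

Lemma layer_arr M l a (x : layer M l) : arr a *: x = 0.
Proof.
have [T [j [p [jI jJ pS pK]]]] := layer_proj M l.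
have [t <-] := pS x; rewrite -linearZ; apply/pK; rewrite linearZ.
by apply: Jpow_arr; apply/jJ; exists t.
Qed.

End RadicalPowers.

Arguments Jpow {K Q L} M l _.

(** * Direct sums of indecomposable projectives *)

Section Skeletons.
Variables (K : fieldType) (Q : quiver) (L : nat).
Local Notation Lam := (tpa K Q L).
Local Notation path := (tpath Q L).
Local Notation res := (res K L).
Local Notation ver := (ver K L).
Implicit Types (M N : lmodType Lam) (e : vertex Q) (w u : seq (arrow Q)) (a : arrow Q).

Definition pelt (p : path) : Lam := path_elt K p.

Lemma peltE p : pelt p = res (tstart p) (tarrows p).
Proof. exact: res_tpath. Qed.

Lemma pelt_tend p : ver (tend p) * pelt p = pelt p.
Proof. by rewrite peltE ver_res eqxx. Qed.

(** Concatenation of paths; the default value p is taken when p and q do not compose to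
    a path of length at most L. *)
Definition tcat (p q : path) : path :=
  odflt p [pick r | (tstart r == tstart p) && (tarrows r == tarrows p ++ tarrows q)].

Lemma tcatP p q : tstart q = tend p -> (size (tarrows p) + size (tarrows q) <= L)%N ->
  tstart (tcat p q) = tstart p /\ tarrows (tcat p q) = tarrows p ++ tarrows q.
Proof.
move=> qp pqL; have pq : is_path (tstart p) (tarrows p ++ tarrows q).
  by rewrite is_path_cat tpath_path -/(tend p) -qp tpath_path.
have [|r [r1 r2]] := @ex_tpath _ L _ _ pq; first by rewrite size_cat.
rewrite /tcat; case: pickP => [s /andP[/eqP-> /eqP->] //|/(_ r)].
by rewrite r1 r2 !eqxx.
Qed.

Lemma pelt_mul (p q : path) : pelt q * pelt p =
  if (tstart q == tend p) && (size (tarrows p) + size (tarrows q) <= L)%N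
  then pelt (tcat p q) else 0.
Proof.
rewrite !peltE; have [qp|qp] /= := eqVneq (tstart q) (tend p); last exact: res_mul0.
rewrite {1}qp res_cat; case: leqP => pqL; last by rewrite res_long // size_cat.
by have [-> ->] := tcatP qp pqL.
Qed.

Section Cover.
Variables (I : finType) (v : I -> vertex Q).

Definition pcover : lmodType Lam := dsum (fun k => proj_indec K L (v k)).

Definition pcoef (x : pcover) k : Lam := val (x k).

Lemma mem_proj_indec e (x : Lam^o) :
  (x \in gen_by [set residue K L e [::] : Lam^o]) = ((x : Lam) * ver e == x).
Proof.
apply/idP/eqP => [/asboolP[s sX ->]|<-]; last by apply: rpredZ; apply: mem_gen_by.
rewrite big_seq [LHS]mulr_suml; apply: eq_bigr => -[f y] /sX /= ->.
by rewrite [f *: _]/(f * ver e) -mulrA res_ver.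
Qed.

Lemma pcoef_ver x k : pcoef x k * ver (v k) = pcoef x k.
Proof. by apply/eqP; rewrite -mem_proj_indec; exact: (valP (x k)). Qed.

Lemma pcover_intro (h : I -> Lam) : (forall k, h k * ver (v k) = h k) ->
  exists x : pcover, forall k, pcoef x k = h k.
Proof.
move=> hE; have hk k : (h k : Lam^o) \in gen_by [set residue K L (v k) [::] : Lam^o].
  by rewrite mem_proj_indec hE.
by exists (fun k => exist _ (h k : Lam^o) (hk k)).
Qed.

Lemma pcover_ext (x y : pcover) : (forall k, pcoef x k = pcoef y k) -> x = y.
Proof. by move=> xy; apply: functional_extensionality_dep => k; apply: val_inj; apply: xy. Qed.

Lemma pcoefD (x y : pcover) k : pcoef (x + y) k = pcoef x k + pcoef y k.
Proof. by []. Qed.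

Lemma pcoef0 k : pcoef 0 k = 0.
Proof. by []. Qed.

Lemma pcoefZ (f : Lam) (x : pcover) k : pcoef (f *: x) k = f * pcoef x k.
Proof. by []. Qed.

Lemma pcoef_sum (J : Type) (r : seq J) (P : pred J) (x : J -> pcover) k :
  pcoef (\sum_(j <- r | P j) x j) k = \sum_(j <- r | P j) pcoef (x j) k.
Proof. by elim/big_rec2: _ => // j y z _ <-. Qed.

Lemma pcover_gen : exists g : I -> pcover,
  forall k k', pcoef (g k) k' = if k' == k then ver (v k) else 0.
Proof.
suff /choice[g gE] : forall k, exists x : pcover,
    forall k', pcoef x k' = if k' == k then ver (v k) else 0 by exists g.
move=> k; apply: pcover_intro => k' /=; case: eqP => [->|_]; last exact: mul0r.
exact: res_ver.
Qed.

Definition pgen : I -> pcover := projT1 (cid pcover_gen).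

Lemma pgenE k k' : pcoef (pgen k) k' = if k' == k then ver (v k) else 0.
Proof. by rewrite /pgen; case: cid. Qed.

Lemma pgen_ver k : ver (v k) *: pgen k = pgen k.
Proof.
apply: pcover_ext => k'; rewrite pcoefZ pgenE; case: eqP => _; last exact: mulr0.
exact: res_ver.
Qed.

Lemma pcover_decomp x : x = \sum_k pcoef x k *: pgen k.
Proof.
apply: pcover_ext => k; rewrite pcoef_sum (bigD1 k) //= pcoefZ pgenE eqxx pcoef_ver.
by rewrite big1 ?addr0 // => j /negbTE jk; rewrite pcoefZ pgenE eq_sym jk mulr0.
Qed.

Lemma ex_pmap M (m : I -> M) : exists h : {linear pcover -> M},
  (forall x, h x = \sum_k pcoef x k *: m k) /\
  ((forall k, ver (v k) *: m k = m k) -> forall k, h (pgen k) = m k).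
Proof.
have [h hE] : exists h : {linear pcover -> M}, h =1 fun x => \sum_k pcoef x k *: m k.
  apply: ex_linear => f x y; rewrite scaler_sumr -big_split; apply: eq_bigr => k _.
  by rewrite pcoefD pcoefZ scalerDl scalerA.
exists h; split=> // mE k; rewrite hE (bigD1 k) //= pgenE eqxx mE.
by rewrite big1 ?addr0 // => j /negbTE jk; rewrite pgenE jk scale0r.
Qed.

Lemma pcover_projective : projective pcover.
Proof.
move=> A B g f gS; have /choice[m mE] : forall k, exists x, g x = f (pgen k).
  by move=> k; apply: gS.
have [h [hE _]] := ex_pmap m; exists h => x.
rewrite hE linear_sum [in RHS](pcover_decomp x) linear_sum; apply: eq_bigr => k _.
by rewrite !linearZ mE.
Qed.

(** A path p starting at v k, taken as an element of the k-th summand. *)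
Definition valid (kp : I * path) : bool := tstart kp.2 == v kp.1.

Definition pel M (m : I -> M) (kp : I * path) : M := pelt kp.2 *: m kp.1.

Lemma pel_ver M (m : I -> M) kp : ver (tend kp.2) *: pel m kp = pel m kp.
Proof. by rewrite /pel scalerA pelt_tend. Qed.

Lemma pcover_basis : basis valid (pel pgen).
Proof.
split=> [c c0 [k p] /eqP /= pk|x].
  have := congr1 (fun x => pcoef x k p) c0; rewrite pcoef_sum pcoef0 ffunE.
  rewrite sum_ffunE (bigD1 (k, p)) /=; last by rewrite /valid pk.
  rewrite pcoefZ pcoefZ pgenE eqxx scalE ffunE /=.
  rewrite -pk peltE res_ver -peltE ffunE eqxx [_ *: _]mulr1 big1 ?addr0 //.
  move=> [k' p'] /andP[/eqP /= p'k' ne]; rewrite 2!pcoefZ pgenE.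
  case: eqP => [kk'|_]; last by rewrite !mulr0 ffunE.
  rewrite -p'k' peltE res_ver -peltE scalE !ffunE; case: eqP => [pp'|_]; last by rewrite scaler0.
  by case/eqP: ne; rewrite pp' kk'.
rewrite [x]pcover_decomp; apply: span_sum => k _.
rewrite tpa_act; apply: span_sum => p _; apply: spanZ.
have [pk|pk] := eqVneq (tstart p) (v k).
  by apply: (@span_mem _ _ _ _ _ valid (pel pgen) (k, p)); rewrite /valid pk.
rewrite -pgen_ver scalerA -/(pelt p) peltE res_mul0 ?scale0r //.
exact: span0.
Qed.

(** * Skeletons *)

(** A skeleton exhibits a K-basis of M consisting of the paths in B, applied to the
    generators m k. Since B is closed under initial subpaths, M is governed by the
    minimal paths outside B, the critical ones. *)
Definition skel (B : I -> pred (seq (arrow Q))) (kp : I * path) : bool :=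
  valid kp && B kp.1 (tarrows kp.2).

Definition critical (B : I -> pred (seq (arrow Q))) (kp : I * path) : bool :=
  [&& valid kp, ~~ B kp.1 (tarrows kp.2) &
      B kp.1 (take (size (tarrows kp.2)).-1 (tarrows kp.2))].

(** In sk_red, the relation of a critical path involves only paths of B that are at least
    as long: this compatibility with the radical filtration makes the change of basis in
    the syzygy triangular, and lets B read off the radical layering of M. *)
Record skeleton M (m : I -> M) (B : I -> pred (seq (arrow Q))) : Prop := Skeleton {
  sk_ver : forall k, ver (v k) *: m k = m k;
  sk_nil : forall k, B k [::];
  sk_pre : forall k w a, B k (rcons w a) -> B k w;
  sk_basis : basis (skel B) (pel m);
  sk_red : forall k w a, is_path (v k) (rcons w a) -> (size w < L)%N ->
    B k w -> ~~ B k (rcons w a) ->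
    span (fun kp => skel B kp && (size w < size (tarrows kp.2))%N) (pel m)
      (res (v k) (rcons w a) *: m k)
}.

Section PrefixClosed.
Variable B : I -> pred (seq (arrow Q)).
Hypothesis B_nil : forall k, B k [::].
Hypothesis B_pre : forall k w a, B k (rcons w a) -> B k w.

Lemma skel_prefix k w u : B k (w ++ u) -> B k w.
Proof.
elim/last_ind: u => [|u a IH]; first by rewrite cats0.
by rewrite -rcons_cat => /B_pre.
Qed.

Lemma criticalP k p : critical B (k, p) -> (0 < size (tarrows p))%N /\
  exists w a, [/\ tarrows p = rcons w a, B k w & ~~ B k (rcons w a)].
Proof.
move=> /and3P[_ /=]; case/lastP: (tarrows p) => [|w a]; first by rewrite B_nil.
rewrite size_rcons /= -cats1 take_size_cat // cats1 => nB Bw; split=> //.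
by exists w, a.
Qed.

Lemma critical_ex k p : valid (k, p) -> ~~ B k (tarrows p) -> exists q u,
  [/\ critical B (k, q), is_path (tend q) u & tarrows p = tarrows q ++ u].
Proof.
move=> /eqP /= pk nB.
(* The shortest initial subpath outside B is critical. *)
have [j jP minj] := ex_minnP (ex_intro (fun j => ~~ B k (take j (tarrows p))) _
  (etrans (congr1 (fun w => ~~ B k w) (take_size _)) nB)).
have j0 : (0 < j)%N by case: j jP {minj} => //; rewrite take0 B_nil.
have jp : (j <= size (tarrows p))%N by apply: minj; rewrite take_size.
have pp := tpath_path p.
have [||q [q1 q2]] := @ex_tpath _ L (tstart p) (take j (tarrows p)).
- exact: is_path_take.
- by apply: leq_trans (tpath_size p); rewrite size_takel.
exists q, (drop j (tarrows p)); split; last by rewrite q2 cat_take_drop.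
  rewrite /critical /valid /= q1 pk eqxx q2 jP /= size_takel // take_takel ?leq_pred //.
  by apply: contraT => /minj; lia.
move: pp; rewrite -{1}(cat_take_drop j (tarrows p)) is_path_cat => /andP[_].
by rewrite /tend q1 q2.
Qed.

(** Tells how long ago a path left B: this breaks the ties between paths of equal length
    in the triangular change of basis for the syzygy. *)
Definition excess k w := count (fun j => ~~ B k (take j w)) (iota 0 (size w).+1).

Lemma excess_skel k w u : B k w -> (excess k (w ++ u) <= size u)%N.
Proof.
move=> Bw; rewrite /excess size_cat -addSn iotaD count_cat.
rewrite (_ : count _ (iota 0 _) = 0)%N.
  by rewrite add0n; apply: leq_trans (count_size _ _) _; rewrite size_iota.
apply/eqP; rewrite -leqn0 leqNgt -has_count; apply/hasPn => j.
rewrite mem_iota add0n ltnS /= => jw; rewrite negbK takel_cat //.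
by apply: (@skel_prefix k _ (drop j w)); rewrite cat_take_drop.
Qed.

Lemma excess_nonskel k w u : ~~ B k w -> (size u < excess k (w ++ u))%N.
Proof.
move=> Bw; rewrite /excess size_cat -addnS iotaD count_cat.
apply: leq_trans (leq_addl _ _); rewrite (_ : count _ _ = (size u).+1) //.
rewrite -[RHS](size_iota (0 + size w)); apply/eqP; rewrite -all_count; apply/allP => j.
rewrite mem_iota add0n => /andP[wj _]; rewrite /=; apply: contra Bw => Bj.
move: Bj; rewrite take_cat ltnNge wj /=; exact: skel_prefix.
Qed.

End PrefixClosed.

End Cover.

End Skeletons.

(** * The first syzygy of a module with a skeleton *)

Section Syzygy.
Variables (K : fieldType) (Q : quiver) (L : nat).
Local Notation Lam := (tpa K Q L).
Local Notation path := (tpath Q L).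
Local Notation res := (res K L).
Local Notation ver := (ver K L).
Local Notation pelt := (pelt K).
Local Notation len p := (size (tarrows p)).

Section OneModule.
Variables (M : lmodType Lam) (I : finType) (v : I -> vertex Q) (m : I -> M).
Variable B : I -> pred (seq (arrow Q)).
Hypothesis sk : skeleton v m B.

Local Notation P := (pcover K L v).
Local Notation g := (pgen K L v).

Let pm : {linear P -> M} := projT1 (cid (ex_pmap v m)).

Let pm_gen k : pm (g k) = m k.
Proof. by rewrite /pm; case: cid => h [_ hE] /=; apply/hE/(sk_ver sk). Qed.

Let pm_pel kp : pm (pel g kp) = pel m kp.
Proof. by rewrite /pel linearZ /= pm_gen. Qed.

Let pm_lcomb S c : pm (lcomb S (pel g) c) = lcomb S (pel m) c.
Proof. by rewrite linear_lcomb; apply: eq_bigr => kp _ /=; rewrite pm_pel. Qed.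

Let pm_surj : surjective pm.
Proof.
move=> x; have [c ->] := (sk_basis sk).2 x.
by exists (lcomb (skel v B) (pel g) c); rewrite pm_lcomb.
Qed.

(** The relation satisfied in M by a critical path q, made homogeneous. *)
Let ex_relation (q : I * path) : exists y : P, critical v B q ->
  [/\ pm y = 0, ver (tend q.2) *: y = y &
      exists c, y = ver (tend q.2) *: (pel g q -
        lcomb (fun kp => skel v B kp && (len q.2 <= len kp.2)%N) (pel g) c)].
Proof.
case: (boolP (critical v B q)) => cq; last by exists 0.
case: q cq => k p cq.
have [_ [w [a [pE Bw nB]]]] := criticalP (sk_nil sk) cq.
have /andP[/eqP /= pk _] := cq.
have pp : is_path (v k) (rcons w a) by rewrite -pE -pk tpath_path.
have wL : (size w < L)%N by have := tpath_size p; rewrite pE size_rcons.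
have [c cE] := sk_red sk pp wL Bw nB.
exists (ver (tend p) *: (pel g (k, p) -
  lcomb (fun kp => skel v B kp && (len p <= len kp.2)%N) (pel g) c)) => _.
split; last by exists c.
  rewrite linearZ linearB /= pm_pel pm_lcomb.
  have -> : pel m (k, p) = res (v k) (rcons w a) *: m k.
    by rewrite /pel peltE /= -pE pk.
  rewrite cE pE size_rcons subrr; exact: scaler0.
by rewrite scalerA -[X in ver X]/(endpoint (tend p) [::]) res_ver.
Qed.

Let J := {q : I * path | critical v B q}.
Let v' (q : J) : vertex Q := tend (val q).2.
(* The relation of q lies in J^l, l the length of q: longer paths annihilate it. *)
Let B' (q : J) : pred (seq (arrow Q)) := fun u => (size u + len (val q).2 <= L)%N.
Let y (q : J) : P := projT1 (cid (ex_relation (val q))).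

Let yP q : [/\ pm (y q) = 0, ver (v' q) *: y q = y q &
      exists c, y q = ver (v' q) *: (pel g (val q) -
        lcomb (fun kp => skel v B kp && (len (val q).2 <= len kp.2)%N) (pel g) c)].
Proof. by rewrite /y; case: cid => x /= /(_ (valP q)). Qed.

Let qvalid (q : J) : tstart (val q).2 = v (val q).1.
Proof. by have /andP[/eqP] := valP q. Qed.

Let crit (q : J) : critical v B ((val q).1, (val q).2).
Proof. by rewrite -surjective_pairing; exact: valP q. Qed.

Let crit_pos (q : J) : (0 < len (val q).2)%N.
Proof. by have [] := criticalP (sk_nil sk) (crit q). Qed.

Let y_Jpow q : y q \in Jpow P (len (val q).2).
Proof.
have [_ _ [c ->]] := yP q; apply: rpredZ; apply: submodB.
  by rewrite /pel peltE; apply: Jpow_res.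
apply: rpred_sum => kp /andP[_ lkp]; apply: rpredZ.
by rewrite /pel peltE; apply: Jpow_res.
Qed.

Let T (t : (I * path) + (J * path)) : bool :=
  match t with inl kp => skel v B kp | inr qp => skel v' B' qp end.
Let d (t : (I * path) + (J * path)) : P :=
  match t with inl kp => pel g kp | inr qp => pel y qp end.
Let lead (t : (I * path) + (J * path)) : I * path :=
  match t with inl kp => kp | inr qp => ((val qp.1).1, tcat (val qp.1).2 qp.2) end.
(* Longer paths are smaller terms; among paths of equal length, those staying
   longer inside B are smaller. *)
Let rho (kp : I * path) : nat := (len kp.2 * L.+1 + (L - excess B kp.1 (tarrows kp.2)))%N.

Let lead_inr q p : skel v' B' (q, p) ->
  tstart (tcat (val q).2 p) = v (val q).1 /\
  tarrows (tcat (val q).2 p) = tarrows (val q).2 ++ tarrows p.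
Proof.
move=> /andP[/eqP /= pq]; rewrite /B' /= addnC => pL.
by rewrite -qvalid; apply: tcatP.
Qed.

Let lead_in t : T t -> valid v (lead t).
Proof.
case: t => [kp /andP[] //|[q p] Tqp]; have [sE _] := lead_inr Tqp.
by rewrite /valid /= sE.
Qed.

Let pre := skel_prefix (sk_pre sk).

Let nonskel (q : J) : ~~ B (val q).1 (tarrows (val q).2).
Proof. by have /and3P[_ /=] := valP q. Qed.

(* The multiple of y q by p is the path q p minus paths r p with r in B at least as long
   as q; if r has the length of q, then r p stays in B longer than q p. *)
Let tri t : T t ->
  span (fun f => valid v f && (rho (lead t) < rho f)%N) (pel g) (d t - pel g (lead t)).
Proof.
case: t => [kp _|[q p] Tqp]; first by rewrite subrr; apply: span0.
have [sE tE] := lead_inr Tqp; have /andP[/eqP /= pq pL] := Tqp.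
have [_ _ [c yE]] := yP q.
have -> : pel y (q, p) - pel g (lead (inr (q, p))) = - (pelt p *:
    lcomb (fun kp => skel v B kp && (len (val q).2 <= len kp.2)%N) (pel g) c).
  rewrite /pel /= yE scalerA.
  have -> : pelt p * ver (v' q) = pelt p by rewrite peltE -pq res_ver.
  rewrite scalerBr /pel scalerA pelt_mul.
  rewrite pq eqxx /= addnC [(_ <= _)%N]pL.
  by rewrite addrAC subrr add0r.
apply: spanN; rewrite act_lcomb; apply: span_sum => -[k r] /andP[/andP[/eqP /= rk Br] /= qr].
apply: spanZ; rewrite /pel scalerA pelt_mul /=.
case: ifP => [/andP[/eqP pr rpL]|_]; last by rewrite scale0r; apply: span0.
have [s1 s2] := tcatP pr rpL.
apply: (@span_mem _ _ _ _ _ (fun f => valid v f && (rho (lead (inr (q, p))) < rho f)%N)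
  (pel g) (k, tcat r p)).
rewrite /valid /= s1 rk eqxx /= /rho /= s2 tE !size_cat.
have e1 := excess_skel (sk_pre sk) (tarrows p) Br.
have e2 := excess_nonskel (sk_pre sk) (tarrows p) (nonskel q).
have pL' : (len p < L)%N.
  by move: pL (crit_pos q); rewrite /B' /=; lia.
set eq := excess _ _ _ in e2 *; set er := excess _ _ _ in e1 *.
have := leq_mul2r L.+1 (len (val q).2 + len p).+1 (len r + len p).
move: qr; rewrite leq_eqVlt => /orP[/eqP ->|qr]; first by lia.
rewrite mulSn => H.
have {H} : (L.+1 + (len (val q).2 + len p) * L.+1 <= (len r + len p) * L.+1)%N.
  by rewrite H ltn_add2r; apply/orP; right.
by set x := (_ * _)%N; set x' := (_ * _)%N; lia.
Qed.

(* The critical initial subpath of a path outside B is unique. *)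
Let lead_inj : {in T &, injective lead}.
Proof.
have disj kp q p : skel v B kp -> skel v' B' (q, p) -> kp = lead (inr (q, p)) -> False.
  move=> /andP[_ Bkp] /lead_inr[_ tE] kpE; move: Bkp; rewrite kpE /= tE => /pre Bq.
  by have/negP := nonskel q; apply.
have cmp q p q' p' : skel v' B' (q, p) -> skel v' B' (q', p') ->
    lead (inr (q, p)) = lead (inr (q', p')) -> (len (val q').2 <= len (val q).2)%N.
  move=> /lead_inr[_ tE] /lead_inr[_ tE'] [k12 t12]; rewrite leqNgt; apply/negP => qq'.
  have [_ [w [a [qE Bw _]]]] := criticalP (sk_nil sk) (crit q').
  have/negP := nonskel q; apply; rewrite k12.
  have -> : tarrows (val q).2 = take (len (val q).2) w.
    rewrite -[LHS](take_size_cat (tarrows p) erefl) -tE t12 tE' qE -cats1 -catA.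
    by rewrite takel_cat //; move: qq'; rewrite qE size_rcons ltnS.
  by apply: (@pre _ _ (drop (len (val q).2) w)); rewrite cat_take_drop.
move=> [kp|[q p]] [kp'|[q' p']] Tt Tt' tt'.
- by rewrite [kp]tt'.
- by case: (disj _ _ _ Tt Tt' tt').
- by case: (disj _ _ _ Tt' Tt (esym tt')).
have qq' : len (val q).2 = len (val q').2.
  by apply/eqP; rewrite eqn_leq (cmp _ _ _ _ Tt Tt' tt') (cmp _ _ _ _ Tt' Tt (esym tt')).
have [_ tE] := lead_inr Tt; have [_ tE'] := lead_inr Tt'.
have [k12 t12] : (val q).1 = (val q').1 /\ tcat (val q).2 p = tcat (val q').2 p'.
  by case: tt'.
have : tarrows (val q).2 ++ tarrows p == tarrows (val q').2 ++ tarrows p'.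
  by rewrite -tE -tE' t12.
rewrite eqseq_cat // => /andP[/eqP q12 /eqP p12].
have {q12} qE : q = q'.
  apply: val_inj; apply: injective_projections => //.
  by apply: tpath_inj => //; rewrite !qvalid k12.
subst q'; have /andP[/eqP /= pq _] := Tt; have /andP[/eqP /= pq' _] := Tt'.
by rewrite (@tpath_inj _ _ p p') // pq pq'.
Qed.

Let lead_onto f : valid v f -> exists2 t, T t & lead t = f.
Proof.
case: f => k p vp; case Bp: (B k (tarrows p)).
  by exists (inl (k, p)); rewrite //= /skel vp.
have [q [u [cq pu pE]]] := critical_ex (sk_nil sk) vp (negbT Bp).
have uL : (size u + len q <= L)%N by have := tpath_size p; rewrite pE size_cat addnC.
have [|u' [u1 u2]] := @ex_tpath _ L _ _ pu; first by lia.
have Tqu : T (inr (exist _ (k, q) cq, u')).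
  by rewrite /T /skel /valid /v' /B' /= u1 eqxx u2.
exists (inr (exist _ (k, q) cq, u')) => //.
have [sE tE] := lead_inr Tqu; congr (_, _); apply: tpath_inj.
  by rewrite sE; move/eqP: vp.
by rewrite tE u2.
Qed.

Let d_free : free T d := triangular_free lead_in tri lead_inj (pcover_basis K L v).1.

Let d_span x : span T d x.
Proof.
apply: span_trans ((pcover_basis K L v).2 x) => f.
exact: (triangular_span tri lead_onto).
Qed.

Let lcomb_d c : lcomb T d c =
  lcomb (skel v B) (pel g) (c \o inl) + lcomb (skel v' B') (pel y) (c \o inr).
Proof. by rewrite /lcomb big_sumType. Qed.

(** A triangular change of basis turns the path basis of the projective cover
    into the given basis of M together with the multiples u y_q of the relations
    of the critical paths q. So the kernel is the span of the u y_q: it is a direct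
    sum of modules Lam e / J^(L + 1 - l) e, one for each critical path of
    length l ending in e. *)
Theorem skeleton_syzygy : exists (C : lmodType Lam) (i : {linear C -> P})
    (p : {linear P -> M}) (m' : J -> C),
  [/\ ses i p, skeleton v' m' B' & forall x, i x \in Jpow P 1].
Proof.
have [i s] := ses_kernel pm_surj; set C := submodule _ in i s *.
exists C, i, pm; have [iI _ ex] := s.
have /choice[m' m'E] : forall q, exists x : C, i x = y q.
  by move=> q; have [/ex] := yP q.
have im' : i \o pel m' = pel y.
  by apply: funext => qp /=; rewrite /pel linearZ /= m'E.
have i_span x : span (skel v' B') (pel y) (i x).
  have [c cE] := d_span (i x).
  have : pm (i x) = 0 by apply/ex; exists x.
  rewrite cE lcomb_d linearD pm_lcomb linear_lcomb [X in _ + X]big1 => [|qp _]; last first.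
    suff -> : (pm \o pel y) qp = 0 by rewrite scaler0.
    by have [y0 _ _] := yP qp.1; rewrite /= /pel linearZ /= y0; apply: scaler0.
  rewrite addr0 => /((sk_basis sk).1) c0; rewrite lcomb0; last by move=> f /c0.
  by rewrite add0r; eexists.
exists m'; split=> // [|x]; last first.
  have [c ->] := i_span x; apply: rpred_sum => -[q p] _; apply: rpredZ.
  rewrite /pel peltE; apply: Jpow_le (Jpow_act _ _ (y_Jpow q)).
  by rewrite ltn_addr // crit_pos.
have i_lcomb c : i (lcomb (skel v' B') (pel m') c) = lcomb (skel v' B') (pel y) c.
  by rewrite linear_lcomb im'.
split.
- by move=> q; apply: iI; rewrite linearZ m'E; have [] := yP q.
- by move=> q; rewrite /B' add0n tpath_size.
- by move=> q w a; rewrite /B' size_rcons; apply: ltnW.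
- split=> [c c0 qp Tqp|x]; last first.
    by have [c cE] := i_span x; exists c; apply: iI; rewrite i_lcomb.
  pose c' (t : (I * path) + (J * path)) : K := if t is inr qp then c qp else 0.
  have := @d_free c'; rewrite lcomb_d lcomb0 // add0r => /(_ _ (inr qp) Tqp); apply.
  by rewrite -i_lcomb c0 linear0.
move=> q w a pw wL Bw nB.
suff -> : res (v' q) (rcons w a) *: m' q = 0 by apply: span0.
apply: iI; rewrite linearZ m'E linear0; apply: Jpow_top.
apply: Jpow_le (Jpow_act _ _ (y_Jpow q)); move: nB.
by rewrite /B' size_rcons -ltnNge addnC.
Qed.

End OneModule.

End Syzygy.

(** * Projective dimension in terms of critical paths *)

Section SkeletonPdim.
Variables (K : fieldType) (Q : quiver) (L : nat).
Local Notation Lam := (tpa K Q L).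
Local Notation path := (tpath Q L).
Local Notation len p := (size (tarrows p)).
Implicit Types M P : lmodType Lam.

(** A direct summand contained in the radical vanishes: a retraction onto it
    maps J^l P to J^(l + 1) P. *)
Lemma section_kernel0 M (P : lmodType Lam) (i : {linear M -> P}) (h : {linear P -> P}) :
  (forall x, h (i x) = i x) -> (forall y, h y \in Jpow P 1) -> forall x, i x = 0.
Proof.
move=> hi hJ x; apply: Jpow_top; elim: L.+1 => [|l IH]; first exact: Jpow0.
rewrite -hi; elim/Jpow_ind: IH => [|y z yJ zJ|e w y lw].
- by rewrite linear0 rpred0.
- by rewrite linearD rpredD.
rewrite linearZ; apply: Jpow_le (Jpow_act _ _ (hJ y)); lia.
Qed.

Section OneModule.
Variables (M : lmodType Lam) (I : finType) (v : I -> vertex Q) (m : I -> M).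
Variable B : I -> pred (seq (arrow Q)).
Hypothesis sk : skeleton v m B.

Lemma skeleton_projective : projective M <-> forall kp : I * path, ~~ critical v B kp.
Proof.
have [C [i [p [m' [[iI pS ex] sk' iJ]]]]] := skeleton_syzygy sk.
split=> [pM [k q]|nc].
  apply/negP => cq; have [id idE] := ex_linear_id M.
  have [s sE] := pM _ _ p id pS.
  have [h hE] : exists h : {linear pcover K L v -> pcover K L v}, h =1 fun x => x - s (p x).
    by apply: ex_linear => a x y; rewrite !linearP scalerDr addrACA.
  have hJ y : h y \in Jpow (pcover K L v) 1.
    have /ex[x <-] : p (h y) = 0 by rewrite hE linearB sE idE subrr.
    exact: iJ.
  have i0 : forall x, i x = 0.
    apply: (section_kernel0 _ hJ) => x; rewrite hE.
    suff -> : p (i x) = 0 by rewrite linear0 subr0.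
    by apply/ex; exists x.
  (* A critical path gives a nonzero element of the kernel C. *)
  pose j : {q | critical v B q} := exist _ (k, q) cq.
  have := (sk_basis sk').1 (fun f => (f == (j, triv L (tend q)))%:R).
  have S1 : skel (fun q : {q | critical v B q} => tend (val q).2)
    (fun (q : {q | critical v B q}) u => (size u + len (val q).2 <= L)%N) (j, triv L (tend q)).
    by rewrite /skel /valid /= eqxx add0n tpath_size.
  rewrite lcomb1 // => /(_ _ _ S1); rewrite eqxx => /(_ _)/eqP; rewrite oner_eq0 => H.
  by apply/notF/H; apply: iI; rewrite i0 linear0.
have i0 (x : C) : x = 0.
  have [c ->] := (sk_basis sk').2 x; apply: big1 => -[[q cq] r] _.
  by have := nc q; rewrite cq.
apply: projective_iso (pcover_projective (v := v)); apply: (@inj_surj_iso _ _ _ p) => // x y pxy.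
have /ex[z] : p (x - y) = 0 by rewrite linearB pxy subrr.
by rewrite (i0 z) linear0 => /eqP; rewrite eq_sym subr_eq0 => /eqP.
Qed.

End OneModule.

(** The syzygy has the skeleton (q, u) with q critical and |u| <= L - |q|, whose
    critical paths have length L + 1 - |q|: this is the recursion of l-deg. *)
Theorem skeleton_pd n M (I : finType) (v : I -> vertex Q) (m : I -> M) B :
  skeleton v m B ->
  pd_le n.+1 M <-> forall kp : I * path, critical v B kp ->
    le_enat (ldeg L (len kp.2) (pathlen_sup (tend kp.2))) (Fin n).
Proof.
elim: n M I v m B => [|n IH] M I v m B sk;
  have [C [i [p [m' [s sk' _]]]]] := skeleton_syzygy sk;
  rewrite (pd_le_syzygy _ (@pcover_projective K Q L I v) s).
  have pC := skeleton_projective sk'; split=> [/pC nc [k q] cq|H].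
    have [q0 _] := criticalP (sk_nil sk) cq; have qL := tpath_size q.
    apply/ldeg_eq0 => //= u pu su.
    have [|u' [u1 u2]] := @ex_tpath _ L _ _ pu; first by lia.
    have /negP := nc (exist _ (k, q) cq, u'); apply.
    rewrite /critical /valid /= u1 eqxx u2 size_takel ?leq_pred // su; lia.
  apply/pC => -[[[k q] cq] u]; apply/negP => cu.
  have [q0 _] := criticalP (sk_nil sk) cq; have qL := tpath_size q.
  have /ldeg_eq0 H' := H _ cq.
  move: cu; rewrite /critical /valid /= size_takel ?leq_pred // => /and3P[/eqP u1 u2 u3].
  have pu := tpath_path u; rewrite u1 in pu.
  by apply: (H' _ _ _ pu) => //=; lia.
rewrite (IH _ _ _ _ _ sk'); split=> [H [k q] cq|H [[[k q] cq] u] cu].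
  have [q0 _] := criticalP (sk_nil sk) cq; have qL := tpath_size q.
  apply/ldeg_step => //= u pu su.
  have [|u' [u1 u2]] := @ex_tpath _ L _ _ pu; first by lia.
  have := H (exist _ (k, q) cq, u'); rewrite /= /tend u1 u2 su; apply.
  rewrite /critical /valid /= u1 eqxx u2 size_takel ?leq_pred // su; lia.
have [q0 _] := criticalP (sk_nil sk) cq; have qL := tpath_size q.
move: cu; rewrite /critical /valid /= size_takel ?leq_pred // => /and3P[/eqP u1 u2 u3].
have pu := tpath_path u; rewrite u1 in pu.
have /ldeg_step H' := H _ cq.
have su : len u = (L.+1 - len q)%N by lia.
have -> : tend u = endpoint (tend q) (tarrows u) by rewrite /tend u1.
by rewrite su; apply: (H' _ _ _ pu).
Qed.

Lemma skeleton_pd0 M (I : finType) (v : I -> vertex Q) (m : I -> M) B :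
  skeleton v m B -> pd_le 0 M <-> forall kp : I * path, ~~ critical v B kp.
Proof. exact: skeleton_projective. Qed.

End SkeletonPdim.

(** * Finitely generated modules have skeletons *)

Section ExistsSkeleton.
Variables (K : fieldType) (Q : quiver) (L : nat).
Local Notation Lam := (tpa K Q L).
Local Notation path := (tpath Q L).
Local Notation len p := (size (tarrows p)).
Local Notation res := (res K L).
Local Notation ver := (ver K L).
Local Notation arr := (arr K L).
Local Notation scal := (scal Q L).
Local Notation pelt := (pelt K).
Implicit Types M N X Y : lmodType Lam.

Lemma free_mod_reindex M (Y : {pred M}) (F G : finType) (S : pred F) (T : pred G)
    (b : F -> M) (d : G -> M) (phi : F -> G) :
  {in S &, injective phi} -> (forall f, S f -> T (phi f) /\ b f = d (phi f)) ->
  free_mod Y T d -> free_mod Y S b.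
Proof.
move=> phiI H fr c cY f Sf; pose c' g := \sum_(f | S f && (phi f == g)) c f.
have -> : c f = c' (phi f).
  rewrite /c' (bigD1 f) /=; last by rewrite Sf eqxx.
  rewrite big1 ?addr0 // => f' /andP[/andP[Sf' /eqP ff'] /eqP ne].
  by case: ne; apply: phiI.
apply: fr; last by have [] := H f Sf.
suff -> : lcomb T d c' = lcomb S b c by [].
rewrite /lcomb (partition_big phi T) /=; last by move=> f' /H[].
apply: eq_bigr => g Tg; rewrite /c' scal_sum scaler_suml.
by apply: eq_bigr => f' /andP[/H[_ ->] /eqP ->].
Qed.

Lemma arr_pelt a (p : path) : arr a * pelt p =
  if (source a == tend p) && (len p < L)%N then res (tstart p) (rcons (tarrows p) a) else 0.
Proof.
rewrite peltE; have [sa|sa] /= := eqVneq (source a) (tend p); last exact: res_mul0.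
by rewrite arr_res // ?sa //; case: ltnP => // pL; rewrite res_long // size_rcons.
Qed.

Section Levels.
Variables (M : lmodType Lam) (I : finType) (v : I -> vertex Q) (m : I -> M).
Implicit Types B : I -> pred (seq (arrow Q)).

Definition spans_mod (F : finType) (S : pred F) (b : F -> M) (Y : {pred M}) (x : M) :=
  exists2 y, y \in Y & span S b (x - y).

Lemma spans_mod_span (F : finType) (S : pred F) (b : F -> M) (Y : submodClosed M) :
  [/\ spans_mod S b Y 0,
      forall x y, spans_mod S b Y x -> spans_mod S b Y y -> spans_mod S b Y (x + y) &
      forall k x, spans_mod S b Y x -> spans_mod S b Y (scal k *: x)].
Proof.
split=> [|x y [x' Yx' Sx] [y' Yy' Sy]|k x [x' Yx' Sx]].
- by exists 0; rewrite ?rpred0 // subr0; apply: span0.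
- exists (x' + y'); first exact: rpredD.
  by rewrite opprD addrACA; apply: spanD.
exists (scal k *: x'); first exact: rpredZ.
by rewrite -scalerBr; apply: spanZ.
Qed.

Definition level B (l : nat) : Prop :=
  free_mod (Jpow M l.+1) (fun kp => skel v B kp && (len kp.2 == l)) (pel m) /\
  forall x, x \in Jpow M l ->
    spans_mod (fun kp => skel v B kp && (len kp.2 == l)) (pel m) (Jpow M l.+1) x.

(** The arrows carry a basis of J^n M / J^(n + 1) M to generators of the next layer; a
    maximal free family among them prolongs B. *)
Lemma level_step B n : (n < L)%N ->
  (forall k, B k [::]) -> (forall k w a, B k (rcons w a) -> B k w) ->
  (forall k w, B k w -> (size w <= n)%N) -> (forall l, (l <= n)%N -> level B l) ->
  exists B', [/\ forall k, B' k [::], forall k w a, B' k (rcons w a) -> B' k w,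
    forall k w, B' k w -> (size w <= n.+1)%N & forall l, (l <= n.+1)%N -> level B' l].
Proof.
move=> nL Bnil Bpre Bn lev.
pose cand (kp : I * path) := [&& valid v kp, len kp.2 == n.+1 & B kp.1 (take n (tarrows kp.2))].
have [T [Tc Tf Ts]] := extract_free (Jpow M n.+2) cand (pel m).
pose B' k w := B k w || [exists p : path, T (k, p) && (tarrows p == w)].
have B'T k w : B' k w -> ~~ B k w -> exists2 p, T (k, p) & tarrows p = w.
  by move=> /orP[->//|/existsP[p /andP[Tp /eqP pw]]] _; exists p.
have B'n kp : valid v kp -> (len kp.2 <= n)%N -> B' kp.1 (tarrows kp.2) = B kp.1 (tarrows kp.2).
  case: kp => k p _ /= pn; rewrite /B'; case: (B k _) => //=.
  apply/existsP => -[p' /andP[/Tc/and3P[_ /= /eqP p'n _] /eqP p'p]].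
  by move: pn; rewrite -p'p p'n ltnn.
have skl l : (l <= n)%N -> (fun kp => skel v B' kp && (len kp.2 == l)) =
    (fun kp => skel v B kp && (len kp.2 == l)).
  move=> ln; apply: funext => kp; rewrite /skel; case: eqP => [pl|]; last by rewrite !andbF.
  by rewrite !andbT; case vp: (valid v kp) => //=; rewrite B'n // pl.
have skn : (fun kp => skel v B' kp && (len kp.2 == n.+1)) = T.
  apply: funext => -[k p]; apply/andP/idP => [[/andP[/eqP /= vp] B'p /eqP pn]|Tp].
    have [|p' Tp' p'p] := B'T _ _ B'p; first by apply/negP => /Bn; rewrite pn ltnn.
    have /and3P[/eqP /= vp' _ _] := Tc _ Tp'.
    by rewrite (@tpath_inj _ _ p p') // vp vp'.
  have /and3P[vp pn _] := Tc _ Tp; rewrite /skel vp pn /=; split=> //.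
  by apply/orP; right; apply/existsP; exists p; rewrite Tp eqxx.
exists B'; split.
- by move=> k; rewrite /B' Bnil.
- move=> k w a B'w; case: (boolP (B k (rcons w a))) => [/Bpre|nB]; first by rewrite /B' => ->.
  have [p /Tc/and3P[_ /= /eqP pn Bp] pw] := B'T _ _ B'w nB.
  move: Bp; rewrite pw -cats1 take_size_cat; first by rewrite /B' => ->.
  by move: pn; rewrite pw size_rcons => -[].
- move=> k w B'w; case: (boolP (B k w)) => [/Bn/leqW //|nB].
  by have [p /Tc/and3P[_ /= /eqP pn _] <-] := B'T _ _ B'w nB; rewrite pn.
move=> l; rewrite leq_eqVlt => /orP[/eqP ->|ln]; rewrite /level; last by rewrite skl //; apply: lev.
rewrite skn; split=> //.
have [S0 SD SZ] := spans_mod_span T (pel m) (Jpow M n.+2).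
apply: Jpow_indS => // a y yJ; have [_ /(_ y yJ)[z zJ [c yE]]] := lev n (leqnn n).
rewrite -(subrK z y) scalerDr; apply: (SD); last first.
  exists (arr a *: z); first exact: Jpow_arr.
  by rewrite subrr; apply: span0.
rewrite yE act_lcomb; apply: (big_ind _ S0 SD) => -[k p] /andP[/andP[/eqP /= vp Bp] /eqP pn].
apply: SZ; rewrite /pel scalerA arr_pelt /=.
case: ifP => [/andP[/eqP sa pL]|_]; last by rewrite scale0r.
have pp : is_path (tstart p) (rcons (tarrows p) a).
  by rewrite is_path_rcons tpath_path sa eqxx.
have [|p' [p'1 p'2]] := @ex_tpath _ L _ _ pp; first by rewrite size_rcons.
rewrite -p'1 -p'2 -res_tpath -/(pelt p') -/(pel m (k, p')).
apply: Ts; rewrite /cand /valid /= p'1 p'2 vp eqxx size_rcons pn eqxx /=.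
by rewrite -cats1 take_size_cat.
Qed.

(** Descending induction on l shows that J^l M is spanned by the paths in B of length at
    least l. *)
Lemma levels_skeleton B : (forall k, ver (v k) *: m k = m k) ->
  (forall k, B k [::]) -> (forall k w a, B k (rcons w a) -> B k w) ->
  (forall l, (l <= L)%N -> level B l) -> skeleton v m B.
Proof.
move=> mv Bnil Bpre lev.
have sp l x : x \in Jpow M l -> span (fun kp => skel v B kp && (l <= len kp.2)%N) (pel m) x.
  have [n] := ubnP (L.+1 - l); elim: n l x => // n IH l x; rewrite ltnS => ln xJ.
  have [lL|lL] := ltnP L l.
    by rewrite (Jpow_top (Jpow_le lL xJ)); apply: span0.
  have [_ /(_ x xJ)[y yJ xy]] := lev l lL; rewrite -(subrK y x); apply: spanD.
    by apply: span_sub xy => kp /andP[-> /eqP ->] /=.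
  apply: span_sub (IH l.+1 y _ yJ); last by lia.
  by move=> kp /andP[-> /ltnW ->].
split=> //; last first.
  move=> k w a pw wL Bw nB; apply: sp.
  by apply: Jpow_res; rewrite size_rcons.
split=> [c c0 kp skp|x]; last by apply: span_sub (sp 0%N x (Jpow0 x)) => kp /andP[].
suff H n kp' : skel v B kp' -> (len kp'.2 < n)%N -> c kp' = 0 by apply: H (ltnSn _).
elim: n kp' {kp skp} => // n IH kp skp; rewrite ltnS => pn.
have [/IH|np] := ltnP (len kp.2) n; first exact.
have {pn np} pn : len kp.2 = n by lia.
have [fr _] : level B n by apply: lev; rewrite -pn tpath_size.
apply: (fr c); last by rewrite skp pn eqxx.
have: lcomb (skel v B) (pel m) c = 0 by [].
rewrite /lcomb (bigID (fun kp => len kp.2 == n)) /= => /eqP; rewrite addr_eq0 => /eqP E.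
rewrite /lcomb E -sumrN; apply: rpred_sum => kp' /andP[skp' pn'].
case: (ltngtP (len kp'.2) n) pn' => // [p'n|p'n] _.
  by rewrite IH // scal0 scale0r oppr0 rpred0.
rewrite -scaleNr; apply: rpredZ.
by rewrite /pel peltE; apply: Jpow_res.
Qed.

End Levels.

(** The generators m k are taken among the parts e_i x of given generators x, as a
    maximal family that is free modulo J M; then B is constructed layer by layer. *)
Theorem ex_skeleton M : fin_gen M ->
  exists (I : finType) (v : I -> vertex Q) (m : I -> M) B, skeleton v m B.
Proof.
move=> [s sM]; pose I0 := (vertex Q * 'I_(size s))%type.
pose g0 (k : I0) : M := ver k.1 *: s`_k.2.
have [T [_ Tf Ts]] := extract_free (Jpow M 1) (fun _ : I0 => true) g0.
pose I := {k : I0 | T k}; pose v (k : I) := (val k).1; pose m (k : I) := g0 (val k).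
have mv k : ver (v k) *: m k = m k by rewrite /m /g0 scalerA res_ver.
pose B0 (k : I) (w : seq (arrow Q)) := w == [::].
have T0 kp : skel v B0 kp && (len kp.2 == 0%N) = (kp.2 == triv L (v kp.1)).
  rewrite /skel /valid /B0 eq_triv; case: eqP => //= _.
  by case: (tarrows kp.2).
have pel0 k : pel m (k, triv L (v k)) = m k by rewrite /pel peltE [LHS]mv.
have lev0 : level v m B0 0.
  rewrite /level (_ : (fun kp => _) = (fun kp => kp.2 == triv L (v kp.1))); last first.
    by apply: funext => kp; exact: T0.
  split.
    apply: (free_mod_reindex (phi := fun kp => val kp.1)) Tf => [[k p] [k' p']|[k p]].
      by move=> /eqP /= -> /eqP /= -> e; have -> : k = k' by apply: val_inj.
    by move=> /eqP /= ->; rewrite pel0; split=> //; exact: (valP k).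
  move=> x _.
  have [S0 SD SZ] := spans_mod_span (fun kp : I * path => kp.2 == triv L (v kp.1))
    (pel m) (Jpow M 1).
  have Sg0 k : spans_mod (fun kp : I * path => kp.2 == triv L (v kp.1)) (pel m) (Jpow M 1) (g0 k).
    have [y yJ Sy] := Ts k isT; exists y => //; apply: span_trans Sy => k' Tk'.
    pose k'' : I := exist _ k' Tk'.
    rewrite -[g0 k']/(m k'') -pel0.
    by apply: (@span_mem _ _ _ _ _ (fun kp : I * path => kp.2 == triv L (v kp.1))); rewrite /=.
  have Sact f k : spans_mod (fun kp : I * path => kp.2 == triv L (v kp.1)) (pel m) (Jpow M 1)
      (f *: g0 k).
    rewrite tpa_act; apply: (big_ind _ S0 SD) => p _; apply: (SZ).
    case p0: (len p) => [|n]; last first.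
      exists (path_elt K p *: g0 k); last by rewrite subrr; apply: span0.
      by rewrite res_tpath; apply: Jpow_res; rewrite p0.
    have -> : p = triv L (tstart p) by apply/eqP; rewrite eq_triv eqxx -size_eq0 p0.
    rewrite res_tpath /g0 scalerA [_ * _]ver_res; case: eqP => [E|_]; last by rewrite scale0r.
    exact: Sg0.
  have /asboolP[t tX ->] := sM x; rewrite big_seq; apply: (big_ind _ S0 SD) => -[f y] /tX /= ys.
  have /(nthP 0)[j js <-] := ys; rewrite [s`_j]sum_ver scaler_sumr.
  apply: (big_ind _ S0 SD) => i _; exact: (Sact f (i, Ordinal js)).
have H n : (n <= L)%N -> exists B : I -> pred (seq (arrow Q)),
    [/\ forall k, B k [::], forall k w a, B k (rcons w a) -> B k w,
    forall k w, B k w -> (size w <= n)%N & forall l, (l <= n)%N -> level v m B l].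
  elim: n => [_|n IH nL]; last first.
    by have [B [Bnil Bpre Bn lev]] := IH (ltnW nL); apply: level_step lev.
  exists B0; split=> //.
  - by move=> k w a; rewrite /B0 -size_eq0 size_rcons.
  - by move=> k w /eqP ->.
  - by move=> l; rewrite leqn0 => /eqP ->.
have [B [Bnil Bpre _ lev]] := H L (leqnn L).
by exists I, v, m, B; apply: levels_skeleton.
Qed.

End ExistsSkeleton.

(** * Graded bases and multiplicities *)

Section Multiplicities.
Variables (K : fieldType) (Q : quiver) (L : nat).
Local Notation Lam := (tpa K Q L).
Local Notation path := (tpath Q L).
Local Notation len p := (size (tarrows p)).
Local Notation ver := (ver K L).
Local Notation arr := (arr K L).
Local Notation scal := (scal Q L).
Local Notation pelt := (pelt K).
Implicit Types M N X Y : lmodType Lam.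

(** A basis of vectors supported at vertices. The number of its members at e_i is the
    dimension of e_i X, hence the composition multiplicity of S_i in X. *)
Definition graded X (F : finType) (S : pred F) (b : F -> X) (nu : F -> vertex Q) : Prop :=
  basis S b /\ forall f, S f -> ver (nu f) *: b f = b f.

Definition count_at (F : finType) (S : pred F) (nu : F -> vertex Q) (i : vertex Q) : nat :=
  #|[pred f | S f && (nu f == i)]|.

Lemma ver_graded X (x : X) i j : ver j *: x = x -> ver i *: x = if i == j then x else 0.
Proof.
by move=> <-; rewrite scalerA [_ * _]ver_res; case: eqP => _ //; rewrite scale0r.
Qed.

Lemma span_ver X (F : finType) (S : pred F) (b : F -> X) nu i x :
  (forall f, S f -> ver (nu f) *: b f = b f) -> span S b x ->
  span (fun f => S f && (nu f == i)) b (ver i *: x).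
Proof.
move=> hb; apply: span_act => f Sf; rewrite (ver_graded _ (hb f Sf)).
case: eqP => [->|_]; last exact: span0.
by apply: (@span_mem _ _ _ _ _ (fun f' => S f' && (nu f' == nu f))); rewrite Sf eqxx.
Qed.

Lemma graded_count X Y (F G : finType) (S : pred F) (T : pred G) b d nu mu :
  lmod_iso X Y -> @graded X F S b nu -> @graded Y G T d mu ->
  forall i, count_at S nu i = count_at T mu i.
Proof.
have half X' Y' (F' G' : finType) (S' : pred F') (T' : pred G') b' d' nu' mu' i :
    lmod_iso X' Y' -> @graded X' F' S' b' nu' -> @graded Y' G' T' d' mu' ->
    (count_at S' nu' i <= count_at T' mu' i)%N.
  move=> [h /bij_inj hI] [[bf _] bh] [[_ ds] dh].
  apply: (@free_card_le _ _ _ Y' _ _ _ _ (h \o b') d') => [|f /andP[Sf /eqP fi]].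
    by apply: free_inj => //; apply: free_sub bf => f /andP[].
  have := span_ver i dh (ds (h (b' f))); rewrite -linearZ -fi bh //.
move=> XY gX gY i; apply/eqP; rewrite eqn_leq (half _ _ _ _ _ _ _ _ _ _ i XY gX gY).
by rewrite (half _ _ _ _ _ _ _ _ _ _ i (lmod_iso_sym XY) gY gX).
Qed.

(** When the arrows act by zero, only the vertices act, and they act in the same way on
    any two bases supported at the same vertices. *)
Lemma semisimple_iso X Y (F G : finType) (S : pred F) (T : pred G) b d nu mu :
  @graded X F S b nu -> @graded Y G T d mu ->
  (forall a (x : X), arr a *: x = 0) -> (forall a (y : Y), arr a *: y = 0) ->
  (forall i, count_at S nu i = count_at T mu i) -> lmod_iso X Y.
Proof.
move=> [bb bh] [[df ds] dh] aX aY cE.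
have [d' [d'f d'S d'T]] := relabel d cE.
have d's y : span S d' y.
  by apply: span_trans (ds y) => g /d'T[f [Sf _ <-]]; apply: span_mem.
apply: (basis_iso bb (conj (d'f df) d's)) => p f Sf.
have kill (Z : lmodType Lam) (z : Z) :
    (forall a (x : Z), arr a *: x = 0) -> (0 < len p)%N -> pelt p *: z = 0.
  move=> aZ; have pp := tpath_path p; rewrite peltE; move: pp.
  case/lastP: (tarrows p) => // w a; rewrite is_path_rcons => /andP[_ /eqP sa] _.
  by rewrite -arr_res // -scalerA aZ.
have [p0|p0] := posnP (len p); last first.
  by exists (fun=> 0); rewrite !lcomb0 // !kill.
have -> : p = triv L (tstart p) by apply/eqP; rewrite eq_triv eqxx -size_eq0 p0.
have [g [Tg lg dg]] := d'S f Sf.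
rewrite res_tpath; exists (fun h => if tstart p == nu f then (h == f)%:R else 0).
rewrite (ver_graded _ (bh f Sf)) dg (ver_graded _ (dh g Tg)) lg -dg.
by case: eqP => _; [rewrite !lcomb1 | rewrite !lcomb0].
Qed.

Definition has_mult X (n : vertex Q -> nat) : Prop :=
  exists (F : finType) (S : pred F) (b : F -> X) nu,
    graded S b nu /\ forall i, count_at S nu i = n i.

Lemma has_mult_uniq X Y n n' : lmod_iso X Y -> has_mult X n -> has_mult Y n' -> n =1 n'.
Proof.
move=> XY [F [S [b [nu [gX nX]]]]] [G [T [d [mu [gY nY]]]]] i.
by rewrite -nX -nY; apply: graded_count XY gX gY i.
Qed.

Lemma has_mult_iso X Y n : lmod_iso X Y -> has_mult X n -> has_mult Y n.
Proof.
move=> XY [F [S [b [nu [[[bf bs] bh] cE]]]]]; have [h hb] := XY.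
exists F, S, (h \o b), nu; split=> //; split; last by move=> f Sf; rewrite /= -linearZ bh.
split=> [|y]; first exact: (free_inj (bij_inj hb)).
have [g _ gK] := hb; have [c cE'] := bs (g y).
by exists c; rewrite -linear_lcomb -cE' gK.
Qed.

Lemma has_mult_semisimple_iso X Y n n' : has_mult X n -> has_mult Y n' -> n =1 n' ->
  (forall a (x : X), arr a *: x = 0) -> (forall a (y : Y), arr a *: y = 0) -> lmod_iso X Y.
Proof.
move=> [F [S [b [nu [gX nX]]]]] [G [T [d [mu [gY nY]]]]] nn' aX aY.
by apply: semisimple_iso gX gY aX aY _ => i; rewrite nX nY.
Qed.

Section DirectSum.
Variables (I : finType) (X : I -> lmodType Lam).

Definition din (k : I) (x : X k) : dsum X := dfwith (fun k => 0 : X k) x.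

Lemma dsum_sum (J : Type) (r : seq J) (P : pred J) (u : J -> dsum X) k :
  (\sum_(j <- r | P j) u j) k = \sum_(j <- r | P j) u j k.
Proof. by elim/big_rec2: _ => // j y z _ <-. Qed.

Lemma din_linear k (f : Lam) (x y : X k) : din (f *: x + y) = f *: din x + din y.
Proof.
apply: functional_extensionality_dep => j; change (din (f *: x + y) j = f *: din x j + din y j).
have [<-|kj] := eqVneq k j; first by rewrite /din !dfwith_in.
by rewrite /din !dfwith_out // scaler0 addr0.
Qed.

Lemma has_mult_dsum n : (forall k, has_mult (X k) (n k)) ->
  has_mult (dsum X) (fun i => \sum_k n k i)%N.
Proof.
move=> H0.
have H1 k : {F : finType & {S : pred F & {b : F -> X k & {nu : F -> vertex Q |
    graded S b nu /\ forall i, count_at S nu i = n k i}}}}.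
  by have [F /cid[S /cid[b /cid[nu ?]]]] := cid (H0 k); exists F, S, b, nu.
pose F k := projT1 (H1 k); pose S k : pred (F k) := projT1 (projT2 (H1 k)).
pose b k : F k -> X k := projT1 (projT2 (projT2 (H1 k))).
pose nu k : F k -> vertex Q := sval (projT2 (projT2 (projT2 (H1 k)))).
have H k : graded (S k) (b k) (nu k) /\ forall i, count_at (S k) (nu k) i = n k i.
  exact: svalP (projT2 (projT2 (projT2 (H1 k)))).
clearbody F S b nu.
pose G := {k : I & F k}.
pose T (t : G) := S (tag t) (tagged t).
pose d (t : G) : dsum X := din (b (tag t) (tagged t)).
pose mu (t : G) := nu (tag t) (tagged t).
have dinl k : exists h : {linear X k -> dsum X}, h =1 @din k.
  by apply: ex_linear => f x y; rewrite din_linear.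
have lc c k : lcomb T d c k = lcomb (S k) (b k) (fun f => c (Tagged F f)).
  rewrite /lcomb dsum_sum.
  pose B j (f : F j) := scal (c (Tagged F f)) *: din (b j f) k.
  rewrite (eq_bigr (fun t : G => B (tag t) (tagged t))); last by case.
  rewrite -(sig_big_dep (fun=> true) S B) /= (bigD1 k) //= [X in _ + X]big1 ?addr0.
    by apply: eq_bigr => f _; rewrite /B /din dfwith_in.
  by move=> j jk; apply: big1 => f _; rewrite /B /din dfwith_out // scaler0.
exists G, T, d, mu; split; first split; first split=> [c c0 [k f] Tf|x].
- have [[[fr _] _] _] := H k.
  apply: (fr (fun f => c (Tagged F f))) Tf; rewrite -lc c0 //.
- have sp k : exists c, x k = lcomb (S k) (b k) c by have [[[_ sp] _] _] := H k; apply: sp.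
  exists (fun t => projT1 (cid (sp (tag t))) (tagged t)).
  by apply: functional_extensionality_dep => k; rewrite lc /=; case: cid.
- case=> k f Tf; have [[_ bh] _] := H k; have [h hE] := dinl k.
  by rewrite /d /mu /= -hE -linearZ bh.
move=> i; rewrite /count_at -sum1_card.
rewrite (eq_bigl (fun t : G => S (tag t) (tagged t) && (nu (tag t) (tagged t) == i))) //.
rewrite -(sig_big_dep (fun=> true) (fun k f => S k f && (nu k f == i)) (fun _ _ => 1%N)) /=.
by apply: eq_bigr => k _; have [_ <-] := H k; rewrite sum1_card.
Qed.

Lemma dsum_arr a : (forall k (x : X k), arr a *: x = 0) -> forall x : dsum X, arr a *: x = 0.
Proof. by move=> aX x; apply: functional_extensionality_dep => k; apply: aX. Qed.

End DirectSum.

Section LayerCounts.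
Variables (M : lmodType Lam) (I : finType) (v : I -> vertex Q) (m : I -> M).
Variable B : I -> pred (seq (arrow Q)).
Hypothesis sk : skeleton v m B.

(** An arrow prolongs a path of B within B or yields, by sk_red, longer paths of B. *)
Lemma skel_Jpow l x : x \in Jpow M l <->
  span (fun kp => skel v B kp && (l <= len kp.2)%N) (pel m) x.
Proof.
split=> [|[c ->]]; last first.
  apply: rpred_sum => kp /andP[_ lp]; apply: rpredZ.
  by rewrite /pel peltE; apply: Jpow_res.
elim: l x => [|l IH] x.
  by move=> _; apply: span_sub ((sk_basis sk).2 x) => kp ->.
elim/Jpow_indS: x / => [|y z|a y /IH]; [exact: span0 | exact: spanD |].
apply: span_act => -[k p] /andP[/andP[/eqP /= vp Bp] lp].
rewrite /pel scalerA arr_pelt /=; case: ifP => [/andP[/eqP sa pL]|_]; last first.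
  by rewrite scale0r; apply: span0.
have pp : is_path (tstart p) (rcons (tarrows p) a).
  by rewrite is_path_rcons tpath_path sa eqxx.
case Bpa: (B k (rcons (tarrows p) a)); last first.
  rewrite vp in pp *; apply: span_sub (sk_red sk pp pL Bp (negbT Bpa)) => kp /andP[-> /=].
  exact: leq_ltn_trans.
have [|p' [p'1 p'2]] := @ex_tpath _ L _ _ pp; first by rewrite size_rcons.
rewrite -p'1 -p'2 -res_tpath -/(pelt p') -/(pel m (k, p')).
apply: (@span_mem _ _ _ _ _ (fun kp => skel v B kp && (l < len kp.2)%N)).
by rewrite /skel /valid /= p'1 p'2 vp eqxx Bpa size_rcons.
Qed.

Definition mult_at (l : nat) (i : vertex Q) : nat :=
  count_at (fun kp => skel v B kp && (len kp.2 == l)) (fun kp : I * path => tend kp.2) i.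

Lemma layer_graded l : exists d : I * path -> layer M l,
  graded (fun kp => skel v B kp && (len kp.2 == l)) d (fun kp => tend kp.2).
Proof.
have [|c cJ kp /andP[skp lkp]|x|d [db dh]] := @layer_basis K Q L M l _
  (fun kp => skel v B kp && (len kp.2 == l)) (pel m).
- move=> kp /andP[_ /eqP lp]; rewrite /pel peltE; apply: Jpow_res; rewrite lp //.
- have /skel_Jpow[c' cc'] := cJ.
  pose c1 kp' := if len kp'.2 == l then c kp' else 0.
  pose c2 kp' := if (l < len kp'.2)%N then c' kp' else 0.
  have E : lcomb (skel v B) (pel m) c1 = lcomb (skel v B) (pel m) c2.
    transitivity (lcomb (fun kp => skel v B kp && (len kp.2 == l)) (pel m) c).
      rewrite /lcomb [RHS]big_mkcondr; apply: eq_bigr => kp' _; rewrite /c1.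
      by case: ifP => // _; rewrite scal0 scale0r.
    rewrite cc' /lcomb [LHS]big_mkcondr; apply: eq_bigr => kp' _; rewrite /c2.
    by case: ifP => // _; rewrite scal0 scale0r.
  have := lcomb_inj (sk_basis sk).1 E skp; rewrite /c1 /c2 lkp (eqP lkp) ltnn //.
- move=> /skel_Jpow[c ->].
  exists (lcomb (fun kp => skel v B kp && (l < len kp.2)%N) (pel m) c).
    by apply/skel_Jpow; eexists.
  exists c; rewrite {1}/lcomb (bigID (fun kp : I * path => len kp.2 == l)) /=.
  set A := (X in X + _ - _); set A' := (X in _ + X - _).
  suff -> : A' = lcomb (fun kp => skel v B kp && (l < len kp.2)%N) (pel m) c.
    rewrite addrK /A /lcomb; apply: eq_bigl => kp; rewrite -andbA.
    by case: eqP => [->|]; rewrite ?leqnn ?andbF.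
  by apply: eq_bigl => kp; rewrite -andbA; congr (_ && _); rewrite ltn_neqAle eq_sym andbC.
exists d; split=> // kp skp; apply: dh => //; exact: pel_ver.
Qed.

Lemma layer_mult l : has_mult (layer M l) (mult_at l).
Proof.
have [d dg] := layer_graded l.
by exists _, (fun kp => skel v B kp && (len kp.2 == l)), d, (fun kp => tend kp.2).
Qed.

Lemma skeleton_graded : graded (skel v B) (pel m) (fun kp => tend kp.2).
Proof. by split=> [|kp _]; [exact: sk_basis | exact: pel_ver]. Qed.

End LayerCounts.

Lemma skeleton_iso M N (I : finType) (v : I -> vertex Q) (m : I -> M) B :
  lmod_iso M N -> skeleton v m B -> exists m' : I -> N, skeleton v m' B.
Proof.
move=> [h hb] sk; exists (h \o m).
have hp : h \o pel m = pel (h \o m) by apply: funext => kp; rewrite /= /pel linearZ.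
split.
- by move=> k; rewrite /= -linearZ (sk_ver sk).
- exact: sk_nil sk.
- exact: sk_pre sk.
- have [fr sp] := sk_basis sk; rewrite -hp; split=> [|y].
    exact: free_inj (bij_inj hb) fr.
  have [g _ gK] := hb; have [c cE] := sp (g y).
  by exists c; rewrite -linear_lcomb -cE gK.
move=> k w a pw wL Bw nB; have [c cE] := sk_red sk pw wL Bw nB.
by exists c; rewrite -hp -linear_lcomb -cE linearZ.
Qed.

Lemma full_skeleton (I : finType) (v : I -> vertex Q) :
  skeleton v (pgen K L v) (fun _ _ => true).
Proof.
split=> // [k|]; first exact: pgen_ver.
have [fr sp] := pcover_basis K L v.
split=> [|x]; first by apply: free_sub fr => kp /andP[].
by apply: span_sub (sp x) => kp; rewrite /skel andbT.
Qed.

Lemma proj_indec_pcover (e : vertex Q) :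
  exists h : {linear pcover K L (fun _ : unit => e) -> proj_indec K L e},
    bijective h /\ forall x, val (h x) = pcoef x tt.
Proof.
have [h hE] : exists h : {linear pcover K L (fun _ : unit => e) -> proj_indec K L e},
    h =1 (fun x => x tt) by apply: ex_linear.
exists h; split=> [|x]; last by rewrite hE.
exists (fun (u : proj_indec K L e) (_ : unit) => u) => x; rewrite hE //.
by apply: functional_extensionality_dep => -[].
Qed.

Lemma simple_at_mult (j : vertex Q) : has_mult (simple_at K L j) (fun i => (j == i) : nat).
Proof.
have [h [hb _]] := proj_indec_pcover j.
have [m sk] := skeleton_iso (ex_intro _ h hb) (full_skeleton _).
have [F [S [b [nu [gr cE]]]]] := layer_mult sk 0.
exists F, S, b, nu; split=> // i; rewrite cE /mult_at /count_at.
have [<-|ji] := eqVneq j i.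
  rewrite (eq_card (B := pred1 (tt, triv L j))) ?card1 // => -[[] p].
  rewrite !inE /skel /valid /= andbT xpair_eqE eqxx eq_triv size_eq0 eq_sym /=.
  by case: eqP => //= jp; case: eqP => //= p0; rewrite /tend p0 /endpoint /= -jp eqxx.
rewrite eq_card0 // => -[[] p]; rewrite !inE /skel /valid /= andbT size_eq0.
case: eqP => //= pj; case: eqP => //= p0.
by rewrite /tend p0 /endpoint /= pj (negbTE ji).
Qed.

Lemma simple_at_arr (j : vertex Q) a (x : simple_at K L j) : arr a *: x = 0.
Proof. exact: layer_arr. Qed.

Lemma semisimple_mult (n : vertex Q -> nat) : has_mult (semisimple K L n) n.
Proof.
have H := has_mult_dsum (fun e => has_mult_dsum (fun _ : 'I_(n e) => simple_at_mult e)).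
have [F [S [b [nu [gr cE]]]]] := H; exists F, S, b, nu; split=> // i.
rewrite cE (bigD1 i) //= [X in (_ + X)%N]big1 => [|e /negbTE ei]; last first.
  by rewrite big1 // => _ _; rewrite ei.
by rewrite addn0 (eq_bigr (fun=> 1%N)) ?sum1_card ?card_ord // => _ _; rewrite eqxx.
Qed.

Lemma semisimple_arr (n : vertex Q -> nat) a (x : semisimple K L n) : arr a *: x = 0.
Proof. by apply: dsum_arr => e y; apply: dsum_arr => _ z; apply: simple_at_arr. Qed.

End Multiplicities.

(** * The radical layering determines the projective dimension *)

Section Numerics.
Variables (K : fieldType) (Q : quiver) (L : nat).
Local Notation Lam := (tpa K Q L).
Local Notation path := (tpath Q L).
Local Notation len p := (size (tarrows p)).
Implicit Types M N X Y : lmodType Lam.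

Definition valid_at (I : finType) (v : I -> vertex Q) (l : nat) (i : vertex Q) : nat :=
  count_at (fun kp : I * path => valid v kp && (len kp.2 == l)) (fun kp => tend kp.2) i.

Definition nonskel_at (I : finType) (v : I -> vertex Q) B (l : nat) (i : vertex Q) : nat :=
  count_at (fun kp : I * path => [&& valid v kp, ~~ B kp.1 (tarrows kp.2) & len kp.2 == l])
    (fun kp => tend kp.2) i.

Section OneFamily.
Variables (I : finType) (v : I -> vertex Q) (B : I -> pred (seq (arrow Q))).

Lemma valid_atE l i : valid_at v l i = (mult_at L v B l i + nonskel_at v B l i)%N.
Proof.
rewrite /valid_at /mult_at /nonskel_at /count_at -!sum1_card.
rewrite (bigID (fun kp : I * path => B kp.1 (tarrows kp.2))) /=.
congr (_ + _)%N; apply: eq_bigl => kp; rewrite !inE /skel.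
  by rewrite -!andbA; case: valid => //=; case: (B _ _); rewrite ?andbT ?andbF.
by rewrite -!andbA; case: valid => //=; case: (B _ _); rewrite ?andbT ?andbF.
Qed.

Lemma mult_full l i : mult_at L v (fun _ _ => true) l i = valid_at v l i.
Proof. by apply: eq_card => kp; rewrite !inE /skel andbT. Qed.

Lemma mult_at0 i : (forall k, B k [::]) -> mult_at L v B 0 i = #|[pred k | v k == i]|.
Proof.
move=> Bnil; rewrite /mult_at /count_at -!sum1_card.
rewrite (eq_bigl (fun kp : I * path => (v kp.1 == i) && (kp.2 == triv L (v kp.1)))).
  rewrite -(pair_big_dep (fun k => v k == i) (fun k p => p == triv L (v k)) (fun _ _ => 1%N)) /=.
  by apply: eq_big => // k _; rewrite big_pred1_eq.
move=> -[k p]; rewrite !inE /skel /valid /= eq_triv -size_eq0.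
have [vp|_] := eqVneq (tstart p) (v k); last by rewrite /= andbF.
have [p0|_] := eqVneq (len p) 0%N; last by rewrite /= !andbF.
by rewrite (size0nil p0) Bnil /tend (size0nil p0) /endpoint /= vp andbT.
Qed.

(** Only the number of generators at each vertex matters. *)
Lemma valid_at_sum l i : valid_at v l i = (\sum_j #|[pred k | v k == j]| *
  #|[pred p : path | [&& tstart p == j, len p == l & tend p == i]]|)%N.
Proof.
rewrite /valid_at /count_at -sum1_card.
rewrite (eq_bigl (fun kp : I * path =>
  [&& tstart kp.2 == v kp.1, len kp.2 == l & tend kp.2 == i])); last first.
  by move=> kp; rewrite !inE andbA.
rewrite -(pair_big_dep xpredT (fun k (p : path) => [&& tstart p == v k, len p == l & tend p == i])
  (fun _ _ => 1%N)) /=.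
rewrite (partition_big v xpredT) //=; apply: eq_bigr => j _.
rewrite -sum1_card big_distrl /=; apply: eq_bigr => k /eqP <-.
by rewrite mul1n sum1_card.
Qed.

Lemma nonskel_atP l i : nonskel_at v B l i <> 0%N <-> exists k (p : path),
  [/\ valid v (k, p), ~~ B k (tarrows p), len p = l & tend p = i].
Proof.
rewrite /nonskel_at /count_at; split=> [/eqP|[k [p [vp nB pl pi]]]].
  rewrite -lt0n => /card_gt0P[[k p]]; rewrite !inE /= => /andP[/and3P[vp nB /eqP pl] /eqP pi].
  by exists k, p.
by apply/eqP; rewrite -lt0n; apply/card_gt0P; exists (k, p); rewrite !inE /= vp nB pl pi !eqxx.
Qed.

End OneFamily.

Lemma count_skel_len (I : finType) (v : I -> vertex Q) B i :
  count_at (skel v B) (fun kp : I * path => tend kp.2) i =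
  (\sum_(l < L.+1) mult_at L v B l i)%N.
Proof.
rewrite /count_at -sum1_card.
rewrite (partition_big (fun kp : I * path => inord (len kp.2) : 'I_L.+1) xpredT) //=.
apply: eq_bigr => l _; rewrite /mult_at /count_at -sum1_card; apply: eq_bigl => kp.
rewrite !inE /= andbAC; congr (_ && _ && _).
by rewrite -val_eqE /= inordK // ltnS tpath_size.
Qed.

Section NumericPdim.
Variables (M : lmodType Lam) (I : finType) (v : I -> vertex Q) (m : I -> M).
Variable B : I -> pred (seq (arrow Q)).
Hypothesis sk : skeleton v m B.

(** Every path outside B continues a critical one, and l-deg can only drop along
    the way: the critical paths may be replaced with all the paths outside B. *)
Lemma pd_leS_nonskel n : pd_le n.+1 M <-> forall i (l : 'I_L.+1),
  nonskel_at v B l i <> 0%N -> le_enat (ldeg L l (pathlen_sup i)) (Fin n).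
Proof.
rewrite (skeleton_pd n sk); split=> [H i l /nonskel_atP[k [p [vp nB pl pi]]]|H [k p] cp].
  have [q [u [cq pu pE]]] := critical_ex (sk_nil sk) vp nB.
  have := ldeg_suffix pu (H _ cq) => /=; rewrite -size_cat -pE pl.
  suff -> : endpoint (tend q) u = i by [].
  have /andP[/eqP /= vq _] := cq; move/eqP: vp => /= vp.
  by rewrite -pi /tend pE endpoint_cat vp vq.
have pL : (len p < L.+1)%N by rewrite ltnS tpath_size.
apply: (H (tend p) (Ordinal pL)); apply/nonskel_atP; exists k, p.
by have /and3P[vp nB _] := cp; split.
Qed.

Lemma pd_le0_nonskel : pd_le 0 M <-> forall i (l : 'I_L.+1), nonskel_at v B l i = 0%N.
Proof.
rewrite (skeleton_pd0 sk); split=> [H i l|H [k p]].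
  apply: contrapT => /nonskel_atP[k [p [vp nB _ _]]].
  by have [q [u [cq _ _]]] := critical_ex (sk_nil sk) vp nB; have := H (k, q); rewrite cq.
have pL : (len p < L.+1)%N by rewrite ltnS tpath_size.
apply/negP => /and3P[vp nB _]; have := H (tend p) (Ordinal pL).
by apply/nonskel_atP; exists k, p.
Qed.

End NumericPdim.

Lemma layers_mult_at M N (I I' : finType) (v : I -> vertex Q) (v' : I' -> vertex Q)
    (m : I -> M) (m' : I' -> N) B B' (l : nat) :
  skeleton v m B -> skeleton v' m' B' -> lmod_iso (layer M l) (layer N l) ->
  mult_at L v B l =1 mult_at L v' B' l.
Proof. by move=> sk sk' MN; apply: has_mult_uniq MN (layer_mult sk l) (layer_mult sk' l). Qed.

(** The layers count the paths in B by length and endpoint. The top layer moreover fixes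
    the number of generators at each vertex, hence the number of all paths, and so the
    paths outside B are counted as well. *)
Theorem pdim_layering M N : fin_gen M -> fin_gen N ->
  (forall l : 'I_L.+1, lmod_iso (layer M l) (layer N l)) -> pdim M = pdim N.
Proof.
move=> /ex_skeleton[I [v [m [B sk]]]] /ex_skeleton[I' [v' [m' [B' sk']]]] MN.
have mE (l : 'I_L.+1) : mult_at L v B l =1 mult_at L v' B' l.
  exact: layers_mult_at sk sk' (MN l).
have vE l i : valid_at v l i = valid_at v' l i.
  rewrite !valid_at_sum; apply: eq_bigr => j _; congr (_ * _)%N.
  by rewrite -(mult_at0 v j (sk_nil sk)) -(mult_at0 v' j (sk_nil sk')) (mE ord0).
have nE i (l : 'I_L.+1) : nonskel_at v B l i = nonskel_at v' B' l i.
  by have := vE l i; rewrite (valid_atE v B) (valid_atE v' B') mE => /addnI.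
apply: enat_le_ext => -[|n]; rewrite !pdim_leP.
  by rewrite (pd_le0_nonskel sk) (pd_le0_nonskel sk'); split=> H i l; [rewrite -nE | rewrite nE].
rewrite (pd_leS_nonskel sk) (pd_leS_nonskel sk').
by split=> H i l ni; apply: H; [rewrite nE | rewrite -nE].
Qed.

(** * Projective covers *)

(** The kernel of pcover -> M / J M lies in the radical. Lifting this map to P gives a
    surjection, which splits, so its kernel vanishes by section_kernel0. *)
Lemma projective_cover_pcover M (I : finType) (v : I -> vertex Q) (m : I -> M) B P X :
  skeleton v m B -> lmod_iso (layer M 0) X -> projective_cover P X ->
  lmod_iso (pcover K L v) P.
Proof.
move=> sk [u ub] [pP [f [fS fN]]].
have [C [i [p [m' [[iI pS ex] _ iJ]]]]] := skeleton_syzygy sk.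
have [T [j [t [jI jJ tS tK]]]] := layer_proj M 0.
have jb y : exists z, j z = y by apply/jJ/Jpow0.
have [c cE] : exists c : {linear M -> T}, forall y, j (c y) = y.
  have /choice[c' c'E] := jb; have [c cE] : exists c : {linear M -> T}, c =1 c'.
    by apply: ex_linear => a x y; apply: jI; rewrite linearP !c'E.
  by exists c => y; rewrite cE.
have [q qE] : exists q : {linear pcover K L v -> X}, q =1 u \o t \o c \o p.
  by apply: ex_linear => a x y; rewrite /= !linearP.
have qJ x : q x = 0 -> x \in Jpow (pcover K L v) 1.
  rewrite qE /= -(linear0 u) => /(bij_inj ub)/tK; rewrite cE.
  move=> /(Jpow_linear_surj pS)[x' x'J px'].
  have /ex[z zE] : p (x - x') = 0 by rewrite linearB px' subrr.
  by rewrite -(subrK x' x) -zE; apply: rpredD => //; apply: iJ.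
have [h hE] := pcover_projective (v := v) q fS.
have hS : surjective h.
  pose N := gen_by [set y : P | exists x, h x = y].
  have NP y : y \in N -> exists x, h x = y.
    move=> /asboolP[s sX ->]; rewrite big_seq.
    elim/big_ind: _ => [|y1 y2 [x1 <-] [x2 <-]|[a z] /sX /= [x <-]].
    - by exists 0; rewrite linear0.
    - by exists (x1 + x2); rewrite linearD.
    - by exists (a *: x); rewrite linearZ.
  have qS : surjective q.
    move=> x; have [g _ gK] := ub; have [z tz] := tS (g x); have [y py] := pS (j z).
    exists y; rewrite qE /= py; have -> : c (j z) = z by apply: jI; rewrite cE.
    by rewrite tz gK.
  move=> y; apply: NP; apply: (fN [the submodClosed P of N]) => {}y.
  have [x qx] := qS (f y); exists (h x); first by apply: mem_gen_by; exists x.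
  by rewrite linearB hE qx subrr.
have [id idE] := ex_linear_id P.
have [s sE] := pP _ _ h id hS.
have [r rE] : exists r : {linear pcover K L v -> pcover K L v}, r =1 fun x => x - s (h x).
  by apply: ex_linear => a x y; rewrite !linearP scalerDr addrACA.
have hJ x : h x = 0 -> x \in Jpow (pcover K L v) 1.
  by move=> hx; apply: qJ; rewrite -hE hx linear0.
have [k [kI _ kex]] := ses_kernel hS.
have k0 : forall x, k x = 0.
  apply: (section_kernel0 (h := r)) => [x|x].
    have hk : h (k x) = 0 by apply/kex; exists x.
    by rewrite rE hk linear0 subr0.
  by apply: hJ; rewrite rE linearB sE idE subrr.
apply: (@inj_surj_iso _ _ _ h) => // x y hxy.
have /kex[z] : h (x - y) = 0 by rewrite linearB hxy subrr.
by rewrite k0 => /eqP; rewrite eq_sym subr_eq0 => /eqP.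
Qed.

End Numerics.

(** * Simple modules and composition multiplicities *)

Section Composition.
Variables (K : fieldType) (Q : quiver) (L : nat).
Local Notation Lam := (tpa K Q L).
Local Notation path := (tpath Q L).
Local Notation len p := (size (tarrows p)).
Local Notation res := (res K L).
Local Notation ver := (ver K L).
Local Notation arr := (arr K L).
Local Notation scal := (scal Q L).
Implicit Types M N X Y T A C : lmodType Lam.

Lemma has_mult_ses A M C (i : {linear A -> M}) (p : {linear M -> C}) n n' :
  ses i p -> has_mult A n -> has_mult C n' -> has_mult M (fun j => n j + n' j)%N.
Proof.
move=> [iI pS ex] [F [S [b [nu [[[bf bs] bh] nA]]]]] [G [T [d [mu [[[df ds] dh] nC]]]]].
have /choice[x xE] : forall g, exists x, p x = d g by move=> g; apply: pS.
pose R (t : F + G) := match t with inl f => S f | inr g => T g end.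
pose e (t : F + G) := match t with inl f => i (b f) | inr g => ver (mu g) *: x g end.
pose rho (t : F + G) := match t with inl f => nu f | inr g => mu g end.
have lc c : lcomb R e c =
    i (lcomb S b (c \o inl)) + lcomb T (fun g => ver (mu g) *: x g) (c \o inr).
  by rewrite /lcomb big_sumType linear_lcomb.
have pe c : p (lcomb T (fun g => ver (mu g) *: x g) c) = lcomb T d c.
  by rewrite linear_lcomb; apply: eq_bigr => g Tg; congr (_ *: _); rewrite /= linearZ /= xE dh.
have pi y : p (i y) = 0 by apply/ex; exists y.
exists (F + G)%type, R, e, rho; split; first split; first split=> [c|y].
- rewrite lc => c0; have cd : forall g, T g -> c (inr g) = 0.
    by apply: (df (c \o inr)); rewrite -pe -[RHS](linear0 p) -c0 linearD pi add0r.
  have cb : forall f, S f -> c (inl f) = 0.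
    apply: (bf (c \o inl)); apply: iI; rewrite linear0 -[RHS]c0 [X in _ + X]lcomb0 ?addr0 //.
  by case=> [f /cb|g /cd].
- have [c cE] := ds (p y).
  have /ex[z zE] : p (y - lcomb T (fun g => ver (mu g) *: x g) c) = 0.
    by rewrite linearB pe -cE subrr.
  have [c' c'E] := bs z; exists (fun t => match t with inl f => c' f | inr g => c g end).
  rewrite lc; change (y = i (lcomb S b c') + lcomb T (fun g => ver (mu g) *: x g) c).
  by rewrite -c'E zE subrK.
- by case=> [f /bh bE|g _] /=; [rewrite -linearZ bE | rewrite scalerA res_ver].
move=> j; rewrite /count_at -sum1_card big_sumType /= -nA -nC /count_at.
by rewrite -!sum1_card.
Qed.

Lemma has_mult_prod X Y n n' : has_mult X n -> has_mult Y n' ->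
  has_mult (X * Y)%type (fun i => n i + n' i)%N.
Proof.
have [i iE] : exists i : {linear X -> (X * Y)%type}, i =1 fun x => (x, 0).
  by apply: ex_linear => a x y; rewrite pair_linE scaler0 addr0.
have [p pE] : exists p : {linear (X * Y)%type -> Y}, p =1 snd by apply: ex_linear.
apply: (@has_mult_ses _ _ _ i p); split=> [x y|y|[x y]].
- by rewrite !iE => -[].
- by exists (0, y); rewrite pE.
by rewrite pE /=; split=> [->|[z]]; [exists x | rewrite iE => -[]].
Qed.

Lemma has_mult_fin_gen M n : has_mult M n -> fin_gen M.
Proof.
move=> [F [S [b [nu [[[_ bs] _] _]]]]]; exists [seq b f | f <- enum F] => x.
have [c ->] := bs x; apply: rpred_sum => f _; apply: rpredZ; apply: mem_gen_by.
by apply: map_f; rewrite mem_enum.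
Qed.

Lemma has_mult_skel M (I : finType) (v : I -> vertex Q) (m : I -> M) B :
  skeleton v m B -> has_mult M (count_at (skel v B) (fun kp : I * path => tend kp.2)).
Proof. by move=> sk; do 4 eexists; split; first exact: skeleton_graded sk. Qed.

(** A numerical form of T being isomorphic to S_i. *)
Definition has_label T (i : vertex Q) : Prop :=
  has_mult T (fun j => (i == j) : nat) /\ forall a (x : T), arr a *: x = 0.

Lemma line_simple X (y : X) : y != 0 -> (forall x, exists c, x = scal c *: y) ->
  simple_module X.
Proof.
move=> y0 sp; split; first by exists y.
move=> N; have [[x [Nx x0]]|H] := pselect (exists x, x \in N /\ x != 0); last first.
  by left=> x Nx; apply/eqP; apply: contraT => x0; case: H; exists x.
right.
have [c cE] := sp x; have c0 : c != 0.
  by apply: contraNneq x0 => c0; rewrite cE c0 scal0 scale0r.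
have Ny : y \in N.
  have -> : y = scal c^-1 *: x by rewrite cE scalerA -scalM mulVf // scal1 scale1r.
  exact: rpredZ.
by move=> z; have [k ->] := sp z; apply: rpredZ.
Qed.

Lemma line_label X (y : X) i : y != 0 -> (forall x, exists c, x = scal c *: y) ->
  ver i *: y = y -> has_mult X (fun j => (i == j) : nat).
Proof.
move=> y0 sp iy; exists unit, xpredT, (fun=> y), (fun=> i); split; first split=> //.
  have lc c : lcomb xpredT (fun _ : unit => y) c = scal (c tt) *: y.
    by rewrite /lcomb (big_pred1 tt) // => -[].
  split=> [c|x]; last by have [k ->] := sp x; exists (fun=> k); rewrite lc.
  rewrite lc => c0 [] _; apply/eqP; apply: contraT => ctt; case/eqP: y0.
  by rewrite -[y]scale1r -scal1 -(mulVf ctt) scalM -scalerA c0 scaler0.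
move=> j; rewrite /count_at; case: eqP => _ /=.
  by rewrite (eq_card (B := predT)) ?card_unit.
by rewrite (eq_card (B := pred0)) ?card0.
Qed.

(** Being nilpotent, J cannot map T onto itself, so it annihilates T, and a nonzero vector
    supported at a vertex spans T over K. *)
Lemma simple_labelled T : simple_module T -> exists i, has_label T i.
Proof.
move=> [[x x0] sT].
have J1 : forall y, y \in Jpow T 1 -> y = 0.
  case: (sT [the submodClosed _ of Jpow T 1]) => // H; case/eqP: x0.
  suff Hl l : forall y, y \in Jpow T l by apply: Jpow_top.
  elim: l => [y|l IH y]; first exact: Jpow0.
  elim/Jpow_ind: (H y) => [|z z' zJ zJ'|e w z w0]; [exact: rpred0 | exact: rpredD |].
  by apply: Jpow_le (Jpow_act _ _ (IH z)); rewrite -addn1 leq_add2l.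
have aT a (y : T) : arr a *: y = 0 by apply: J1; apply: Jpow_res.
have [i xi] : exists i, ver i *: x != 0.
  apply: contrapT => /forallNP H; case/eqP: x0; rewrite [x]sum_ver big1 // => i _.
  by apply/eqP; apply: contraT => xi; case: (H i).
set y := ver i *: x in xi; have iy : ver i *: y = y by rewrite /y scalerA res_ver.
have sp z : exists c, z = scal c *: y.
  have yN : y \in gen_by [set y] by apply: mem_gen_by.
  case: (sT [the submodClosed _ of gen_by [set y]]) => [/(_ y yN) y0|/(_ z)].
    by rewrite y0 eqxx in xi.
  move=> /asboolP[s sX ->]; rewrite big_seq.
  elim/big_ind: _ => [|z1 z2 [c1 ->] [c2 ->]|[f w] /sX /= ->].
  - by exists 0; rewrite scal0 scale0r.
  - by exists (c1 + c2); rewrite scalD scalerDl.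
  exists (f (triv L i)); rewrite [LHS]tpa_act (bigD1 (triv L i)) //= res_tpath iy.
  rewrite big1 ?addr0 // => p pi.
  suff -> : (path_elt K p : Lam) *: y = 0 by rewrite scaler0.
  have [p0|p0] := posnP (len p); last by apply: J1; rewrite res_tpath; apply: Jpow_res.
  rewrite res_tpath (size0nil p0) (ver_graded _ iy) ifN //; apply: contraNneq pi => pi.
  by rewrite eq_triv pi eqxx (size0nil p0).
by exists i; split=> //; apply: line_label xi sp iy.
Qed.

Lemma labelled_iso T X i j : has_label T i -> has_label X j -> lmod_iso T X <-> i = j.
Proof.
move=> [Ti aT] [Xj aX]; split=> [TX|ij]; last first.
  by apply: has_mult_semisimple_iso Ti Xj _ aT aX => k; rewrite ij.
by have := has_mult_uniq TX Ti Xj i; rewrite eqxx; case: eqP => // ->.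
Qed.

Lemma simple_at_label i : has_label (simple_at K L i) i.
Proof. by split; [exact: simple_at_mult | move=> a x; exact: simple_at_arr]. Qed.

Lemma labelled_line T i : has_label T i -> exists2 y : T, y != 0 &
  ver i *: y = y /\ forall x, exists c, x = scal c *: y.
Proof.
move=> [[F [S [b [nu [[[bf bs] bh] cE]]]]] _].
have [f0 fE] : exists f0, [pred f | S f && (nu f == i)] =i pred1 f0.
  by apply/card1P; rewrite [#|_|]cE eqxx.
have Sf0 : S f0 && (nu f0 == i) by have := fE f0; rewrite !inE eqxx.
have /andP[S0 /eqP i0] := Sf0.
have only f : S f -> f = f0.
  move=> Sf; apply/eqP; have [fi|fi] := eqVneq (nu f) i.
    by have := fE f; rewrite !inE Sf fi eqxx /= => <-.
  have : count_at S nu (nu f) = 0%N by rewrite cE eq_sym (negbTE fi).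
  by move/card0_eq/(_ f); rewrite !inE Sf eqxx.
have lc c : lcomb S b c = scal (c f0) *: b f0.
  rewrite /lcomb (bigD1 f0) //= big1 ?addr0 // => f /andP[/only ->].
  by rewrite eqxx.
exists (b f0); last by rewrite -i0 bh //; split=> // x; have [c ->] := bs x; exists (c f0).
apply: contraTneq isT => b0; have := bf (fun=> 1); rewrite lc b0 scaler0 => /(_ erefl _ S0)/eqP.
by rewrite oner_eq0.
Qed.

Lemma labelled_simple T i : has_label T i -> simple_module T.
Proof. by move=> /labelled_line[y y0 [_ sp]]; apply: line_simple y0 sp. Qed.

(** * Counting composition factors *)

(** Multiplicities are additive along the steps of a composition series. *)
Lemma comp_mult_count T M n i : has_label T i -> comp_mult T M n ->
  exists2 m, has_mult M m & m i = n.
Proof.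
move=> Ti; elim=> {M n} [M M0|M N n sN _ [m mN <-]].
  exists (fun=> 0%N) => //; exists void, xpredT, (fun=> 0), (fun x : void => match x with end).
  split=> [|j]; last by rewrite /count_at eq_card0 // => -[].
  split; last by case.
  by split=> [c _ []|x]; rewrite (M0 x); exact: span0.
have [j Nj] := simple_labelled sN.
have [inc incE] := submodule_incl N; have [p [pS pK]] := quotmodule_proj N.
have s : ses inc p.
  split=> // [x y|x]; first by rewrite !incE => /val_inj.
  rewrite pK; split=> [xN|[y <-]]; last by rewrite incE; exact: valP y.
  by exists (exist _ x xN); rewrite incE.
exists (fun k => m k + (j == k))%N; first exact: has_mult_ses s mN Nj.1.
rewrite addnC; congr (_ + _)%N; congr nat_of_bool; apply/eqP/asboolP.
  by move=> ji; apply/(labelled_iso Nj Ti).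
by move=> /(labelled_iso Nj Ti).
Qed.

(** The class of a generator m k spans a simple quotient: the remaining elements of
    the skeleton basis span a submodule. *)
Lemma ex_maximal_submodule M n : has_mult M n -> ~ (forall x : M, x = 0) ->
  exists2 N : submodClosed M, simple_module (quotmodule N) &
    exists2 n', has_mult (submodule N) n' & (\sum_i n' i < \sum_i n i)%N.
Proof.
move=> Mn M0; have [I [v [m [B sk]]]] := ex_skeleton (has_mult_fin_gen Mn).
have [k0] : exists k : I, True.
  apply: contrapT => nI; apply: M0 => x; have [c ->] := (sk_basis sk).2 x.
  by apply: big1 => kp _; case: nI; exists kp.1.
move=> _; pose f0 : I * path := (k0, triv L (v k0)).
have skf0 : skel v B f0 by rewrite /skel /valid eqxx (sk_nil sk).
pose S' := fun kp => skel v B kp && (kp != f0).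
have actS f kp : S' kp -> span S' (pel m) (f *: pel m kp).
  move=> Skp; rewrite tpa_act; apply: span_sum => p _; apply: spanZ.
  have [p0|p0] := posnP (len p); last first.
    have : path_elt K p *: pel m kp \in Jpow M 1 by rewrite res_tpath; apply: Jpow_res.
    move=> /(skel_Jpow sk); apply: span_sub => kp' /andP[sk' p'0]; rewrite /S' sk'.
    by apply: contraTneq p'0 => ->.
  rewrite res_tpath (size0nil p0) (ver_graded _ (pel_ver m kp)); case: ifP => _.
    exact: span_mem.
  exact: span0.
pose N := gen_by [set y : M | exists2 kp, S' kp & y = pel m kp].
have NP x : x \in N <-> span S' (pel m) x.
  split=> [/asboolP[s sX ->]|[c ->]]; last first.
    by apply: rpred_sum => kp Skp; apply: rpredZ; apply: mem_gen_by; exists kp.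
  by rewrite big_seq; apply: span_sum => -[f y] /sX /= [kp Skp ->]; apply: actS.
have bf0 : pel m f0 \notin N.
  apply/negP => /NP[c cE].
  pose c' f := (f == f0)%:R - (if f == f0 then 0 else c f).
  have : lcomb (skel v B) (pel m) c' = 0.
    have -> : c' = (fun f => (f == f0)%:R + (-1) * (if f == f0 then 0 else c f)).
      by apply: funext => f; rewrite mulN1r.
    rewrite -lcombD -lcombZ lcomb1 // scalN scal1 scaleN1r cE.
    apply/eqP; rewrite subr_eq0; apply/eqP; rewrite /lcomb [LHS]big_mkcondr.
    by apply: eq_bigr => f _; case: eqP => //= _; rewrite scal0 scale0r.
  move=> /((sk_basis sk).1)/(_ f0 skf0); rewrite /c' eqxx subr0 => /eqP.
  by rewrite oner_eq0.
exists [the submodClosed M of N].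
  have [p [pS pK]] := quotmodule_proj [the submodClosed M of N].
  apply: (@line_simple _ (p (pel m f0))) => [|z].
    by apply: contraNneq bf0 => /pK.
  have [x <-] := pS z; have [c ->] := (sk_basis sk).2 x; exists (c f0).
  rewrite -linearZ; apply/eqP; rewrite -subr_eq0 -linearB; apply/eqP/pK/NP.
  rewrite /lcomb (bigD1 f0) //= addrC addrK; exists c; by [].
pose n' := count_at S' (fun kp : I * path => tend kp.2).
have skn : (\sum_i n i = #|(skel v B : pred (I * path))|)%N.
  have nE := has_mult_uniq (lmod_iso_refl M) Mn (has_mult_skel sk).
  rewrite (eq_bigr _ (fun i _ => nE i)) -sum1_card.
  rewrite (partition_big (fun kp : I * path => tend kp.2) xpredT) //=.
  by apply: eq_bigr => i _; rewrite /count_at -sum1_card.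
exists n'.
  have /choice[z zE] : forall kp, exists z : submodule [the submodClosed M of N],
      S' kp -> val z = pel m kp.
    move=> kp; case Skp: (S' kp); last by exists 0.
    have pN : pel m kp \in N by apply: mem_gen_by; exists kp.
    by exists (exist _ (pel m kp) pN).
  have [inc incE] := submodule_incl [the submodClosed M of N].
  have lc c : inc (lcomb S' z c) = lcomb S' (pel m) c.
    by rewrite linear_lcomb; apply: eq_bigr => kp Skp; rewrite /= incE zE.
  exists (I * path)%type, S', z, (fun kp => tend kp.2); split=> //.
  split; first split=> [c c0|x].
  - have : free S' (pel m) by apply: free_sub (sk_basis sk).1 => kp /andP[].
    by apply; rewrite -lc c0 linear0.
  - have /NP[c cE] := valP x; exists c; apply: val_inj; rewrite -incE -[RHS]incE lc.
    by rewrite incE.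
  - by move=> kp Skp; apply: val_inj; rewrite -[LHS]incE linearZ /= incE zE // pel_ver zE.
rewrite skn (_ : (\sum_i n' i = #|S'|)%N); last first.
  rewrite -sum1_card (partition_big (fun kp : I * path => tend kp.2) xpredT) //=.
  by apply: eq_bigr => i _; rewrite /n' /count_at -sum1_card.
apply: proper_card; apply/properP; split; first by apply/fintype.subsetP => kp /andP[].
by exists f0 => //; rewrite unfold_in /S' eqxx andbF.
Qed.

Lemma comp_mult_exists T M n : has_mult M n -> exists m, comp_mult T M m.
Proof.
have [d] := ubnP (\sum_i n i)%N; elim: d M n => // d IH M n nd Mn.
have [M0|M0] := pselect (forall x : M, x = 0); first by exists 0%N; apply: comp_mult0.
have [N sN [n' Nn' nn']] := ex_maximal_submodule Mn M0.
have [|m Nm] := IH _ n' _ Nn'; first exact: leq_trans nn' _.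
by eexists; apply: comp_multS sN Nm.
Qed.

Lemma comp_multP T M n i m : has_label T i -> has_mult M n ->
  comp_mult T M m <-> n i = m.
Proof.
move=> Ti Mn; have uniq m' : comp_mult T M m' -> n i = m'.
  move=> /(comp_mult_count Ti)[n' Mn' <-].
  exact: has_mult_uniq (lmod_iso_refl M) Mn Mn' i.
split=> [/uniq //|<-].
by have [m' Mm'] := comp_mult_exists T Mn; rewrite (uniq _ Mm').
Qed.

(** * Simple modules of infinite projective dimension *)

(** The critical paths of S_i are the arrows starting in e_i. *)
Lemma labelled_pdim T i : (0 < L)%N -> has_label T i -> pdim T = Infty <-> cyclebound i.
Proof.
move=> L0 Ti; have [y y0 [iy sp]] := labelled_line Ti.
pose v (_ : unit) := i; pose B (_ : unit) (w : seq (arrow Q)) := w == [::].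
have sk : skeleton v (fun=> y) B.
  have skE kp : skel v B kp = (kp == (tt, triv L i)).
    case: kp => -[] p; rewrite xpair_eqE eqxx eq_triv /skel /valid /=; by [].
  have py : pel (fun _ : unit => y) (tt, triv L i) = y by rewrite /pel peltE.
  have lc c : lcomb (skel v B) (pel (fun=> y)) c = scal (c (tt, triv L i)) *: y.
    by rewrite /lcomb (big_pred1 (tt, triv L i)) // py.
  split=> //.
  - by move=> k w a; rewrite /B -size_eq0 size_rcons.
  - split=> [c|x]; last by have [k ->] := sp x; exists (fun=> k); rewrite lc.
    rewrite lc => c0 kp; rewrite skE => /eqP ->; apply/eqP; apply: contraT => ctt.
    by case/eqP: y0; rewrite -[y]scale1r -scal1 -(mulVf ctt) scalM -scalerA c0 scaler0.
  move=> k w a pw wL _ _; suff -> : res (v k) (rcons w a) *: y = 0 by apply: span0.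
  move: pw; rewrite is_path_rcons => /andP[_ /eqP sa].
  by rewrite -arr_res // -scalerA Ti.2.
have critE kp : critical v B kp = (tstart kp.2 == i) && (len kp.2 == 1%N).
  rewrite /critical /valid /B; congr (_ && _); case: (tarrows kp.2) => [|a w] //=.
  by rewrite -size_eq0 size_take /=; case: ltnP; case: w.
have pdS n : pd_le n.+1 T <-> forall a, source a = i ->
    le_enat (ldeg L 1 (pathlen_sup (target a))) (Fin n).
  rewrite (skeleton_pd n sk); split=> [H a sa|H [k p]].
    have pa : is_path i [:: a] by rewrite /= sa eqxx.
    have [|p [p1 p2]] := @ex_tpath _ L _ _ pa; first exact: L0.
    by have := H (tt, p); rewrite critE /tend /= p1 p2 eqxx => /(_ isT).
  rewrite critE /= => /andP[/eqP p1]; have := tpath_path p.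
  rewrite p1 /tend; case: (tarrows p) => [|a [|b w]] //= /andP[/eqP sa _] _.
  exact: H.
split=> [pT|ci].
  apply: contrapT => ni; have /neq_Infty[N cN] : pathlen_sup i <> Infty.
    by move=> /cyclebound_pathlen.
  suff : le_enat (pdim T) (Fin (N + N.+1).+1) by rewrite pT.
  apply/pdim_leP/pdS => a sa.
  have /(pathlen_suffix (u := [:: a]))[] := cN; first by rewrite /= sa eqxx.
  move=> _ /=; case: pathlen_sup => //= k kN.
  by apply: leq_add; apply: leq_trans (leq_div _ _) _; lia.
case pT: (pdim T) => [n|//].
have : pd_le n.+1 T by apply/pdim_leP; rewrite pT /=.
move/pdS => H; have ci' := (cyclebound_pathlen i).1 ci.
have [w pw sw] : exists2 w, is_path i w & (1 <= size w)%N.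
  apply: contrapT => H'; have : ~ le_enat (pathlen_sup i) (Fin 0) by rewrite ci'.
  apply; apply/pathlen_leP => w pw; rewrite leqNgt; apply/negP => sw.
  by apply: H'; exists w.
have [u [pu su] Hu] := pathlen_prefix pw sw.
case: u pu su Hu => [|a [|b u]] //= /andP[/eqP sa _] _; rewrite /endpoint /= => Hu.
move: (H a sa) Hu; case: pathlen_sup => //= k _ /(_ k (leqnn k)).
by rewrite ci'.
Qed.

End Composition.

(** * The formula for the projective dimension of a layering *)

Section Formula.
Variables (K : fieldType) (Q : quiver) (L : nat).
Local Notation Lam := (tpa K Q L).
Implicit Types M N X Y T P : lmodType Lam.

Section OneLayering.
Variables (M P : lmodType Lam) (S : 'I_L.+1 -> lmodType Lam).
Variables (s r : vertex Q -> 'I_L.+1 -> nat).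
Hypothesis L0 : (0 < L)%N.
Hypothesis fgM : fin_gen M.
Hypothesis MS : forall l : 'I_L.+1, lmod_iso (layer M l) (S l).
Hypothesis Ss : forall l, lmod_iso (S l) (semisimple K L (fun i => s i l)).
Hypothesis PS : projective_cover P (S ord0).
Hypothesis Psr : forall l : 'I_L.+1, lmod_iso (layer P l)
  (semisimple K L (fun i => s i l) * semisimple K L (fun i => r i l))%type.

(** P is the direct sum of the modules Lambda (v k) for the generators m k of a skeleton
    of M, so s + r counts all the paths starting at the v k. Those in the skeleton are
    counted by s, hence those outside by r. *)
Lemma layering_skeleton : exists (I : finType) (v : I -> vertex Q) (m : I -> M) B,
  [/\ skeleton v m B, forall i (l : 'I_L.+1), nonskel_at L v B l i = r i l &
      has_mult P (fun i => \sum_(l < L.+1) (s i l + r i l))%N].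
Proof.
have [I [v [m [B sk]]]] := ex_skeleton fgM.
have vP := projective_cover_pcover sk (MS ord0) PS.
have [m' skP] := skeleton_iso vP (full_skeleton K L v).
have sE i (l : 'I_L.+1) : mult_at L v B l i = s i l.
  have MsI := lmod_iso_trans (MS l) (Ss l).
  exact: (has_mult_uniq MsI (layer_mult sk l) (semisimple_mult K L _) i).
have vE i (l : 'I_L.+1) : valid_at L v l i = (s i l + r i l)%N.
  rewrite -mult_full; have := has_mult_uniq (Psr l) (layer_mult skP l).
  by move=> /(_ _ (has_mult_prod (semisimple_mult K L _) (semisimple_mult K L _)) i).
exists I, v, m, B; split=> // [i l|].
  by have := vE i l; rewrite (valid_atE L v B) sE => /addnI.
have [F [T [b [nu [gr cE]]]]] := has_mult_skel skP.
exists F, T, b, nu; split=> // i; rewrite cE count_skel_len.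
by apply: eq_bigr => l _; rewrite mult_full vE.
Qed.

Lemma has_mult_layers : has_mult (dsum S) (fun i => \sum_(l < L.+1) s i l)%N.
Proof.
apply: (@has_mult_dsum _ _ _ _ S (fun l i => s i l)) => l.
by apply: has_mult_iso (lmod_iso_sym (Ss l)) _; apply: semisimple_mult.
Qed.

Lemma pd_leS_layering n : pd_le n.+1 M <-> forall i (l : 'I_L.+1),
  r i l <> 0%N -> le_enat (ldeg L l (pathlen_sup i)) (Fin n).
Proof.
have [I [v [m [B [sk rE _]]]]] := layering_skeleton.
by rewrite (pd_leS_nonskel sk); split=> H i l rl; apply: H; [rewrite rE | rewrite -rE].
Qed.

Lemma pdim_formula : le_enat (Fin 1) (pdim M) ->
  pdim M = esucc (esup [set v | exists i, exists2 l : 'I_L.+1,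
    r i l <> 0%N & v = ldeg L l (pathlen_sup i)]).
Proof.
move=> M1; apply: enat_le_ext => -[|n].
  split; last by case: esup.
  by case: (pdim M) M1 => [[|k]|].
rewrite le_esucc esup_leP pdim_leP pd_leS_layering.
split=> [H _ [i [l rl ->]]|H i l rl]; first exact: H.
by apply: H; exists i, l.
Qed.

Lemma pdim_finite : pdim M <> Infty <->
  forall i (l : 'I_L.+1), cyclebound i -> r i l = 0%N.
Proof.
rewrite neq_Infty; split=> [[n Mn] i l ci|H].
  apply: contrapT => rl; have : pd_le n.+1 M.
    apply/pdim_leP; apply: le_enat_trans Mn _; exact: leqnSn.
  move=> /pd_leS_layering/(_ i l rl).
  by move/cyclebound_pathlen: ci => ->.
pose N (i : vertex Q) (l : 'I_L.+1) :=
  if ldeg L l (pathlen_sup i) is Fin n then n else 0%N.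
exists (\max_i \max_l N i l).+1; apply/pdim_leP/pd_leS_layering => i l rl.
have : ldeg L l (pathlen_sup i) <> Infty.
  case cE: (pathlen_sup i) => //= _; apply: rl; apply: H.
  exact/cyclebound_pathlen.
move=> ne; apply: (@le_enat_trans (Fin (N i l))).
  by move: ne; rewrite /N; case: ldeg => [n|] //= _.
rewrite /=; apply: leq_trans (leq_bigmax i).
exact: (leq_bigmax (F := N i) l).
Qed.

(** The multiplicities of S_i in P and in S differ by the sum of the r(i,l). *)
Lemma pdim_finite_comp : pdim M <> Infty <->
  forall T, simple_module T -> pdim T = Infty ->
    exists m : nat, comp_mult T P m /\ comp_mult T (dsum S) m.
Proof.
have [I [v [m [B [_ _ mP]]]]] := layering_skeleton; have mS := has_mult_layers.
rewrite pdim_finite; split=> [H T sT|H i l ci].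
  have [i Ti] := simple_labelled sT.
  move=> /(labelled_pdim L0 Ti) ci; exists (\sum_(l < L.+1) s i l)%N.
  split; last by apply/(comp_multP _ Ti mS).
  by apply/(comp_multP _ Ti mP); apply: eq_bigr => l _; rewrite H // addn0.
have Ti := simple_at_label K L i.
have [|k [/(comp_multP _ Ti mP) <- /(comp_multP _ Ti mS)]] := H _ (labelled_simple Ti).
  exact/(labelled_pdim L0 Ti).
rewrite big_split /= -[LHS]addn0 => /addnI/esym/eqP.
by rewrite sum_nat_eq0 => /forallP/(_ l)/eqP.
Qed.

End OneLayering.

End Formula.

(** * Regular functions and irreducibility *)

Section FunctionAlgebras.
Variables (K : fieldType) (T : Type).

(** Used for the regular functions on the module variety, for the polynomial functions of
    one variable, and for the functions that become polynomial along a curve. *)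
Record fun_algebra (A : set (T -> K)) : Prop := FunAlgebra {
  fa_const : forall c, A (fun=> c);
  fa_add : forall f g, A f -> A g -> A (fun t => f t + g t);
  fa_mul : forall f g, A f -> A g -> A (fun t => f t * g t)
}.

Variables (A : set (T -> K)) (hA : fun_algebra A).

Lemma fa_big (op : K -> K -> K) idx (I : Type) (r : seq I) (P : pred I) (f : I -> T -> K) :
  (forall g h, A g -> A h -> A (fun t => op (g t) (h t))) ->
  (forall i, P i -> A (f i)) -> A (fun t => \big[op/idx]_(i <- r | P i) f i t).
Proof.
move=> opA fA; elim: r => [|i r IH].
  rewrite (_ : (fun _ => _) = fun=> idx); first exact: fa_const.
  by apply: funext => t; rewrite big_nil.
case Pi: (P i).
  rewrite (_ : (fun _ => _) = fun t => op (f i t) (\big[op/idx]_(j <- r | P j) f j t)).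
    by apply: opA => //; apply: fA.
  by apply: funext => t; rewrite big_cons Pi.
rewrite (_ : (fun _ => _) = fun t => \big[op/idx]_(j <- r | P j) f j t) //.
by apply: funext => t; rewrite big_cons Pi.
Qed.

Lemma fa_sum (I : Type) (r : seq I) (P : pred I) (f : I -> T -> K) :
  (forall i, P i -> A (f i)) -> A (fun t => \sum_(i <- r | P i) f i t).
Proof. exact: fa_big (fa_add hA). Qed.

Lemma fa_prod (I : Type) (r : seq I) (P : pred I) (f : I -> T -> K) :
  (forall i, P i -> A (f i)) -> A (fun t => \prod_(i <- r | P i) f i t).
Proof. exact: fa_big (fa_mul hA). Qed.

Lemma fa_exp (f : T -> K) n : A f -> A (fun t => f t ^+ n).
Proof.
move=> fA; rewrite (_ : (fun _ => _) = fun t => \prod_(i < n) f t); last first.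
  by apply: funext => t; rewrite prodr_const card_ord.
exact: fa_prod.
Qed.

Definition fa_mx m n (X : T -> 'M[K]_(m, n)) : Prop := forall i j, A (fun t => X t i j).

Lemma fa_mx_const m n (X : 'M[K]_(m, n)) : fa_mx (fun=> X).
Proof. by move=> i j; apply: fa_const. Qed.

Lemma fa_mxM m n p (X : T -> 'M[K]_(m, n)) (Y : T -> 'M[K]_(n, p)) :
  fa_mx X -> fa_mx Y -> fa_mx (fun t => X t *m Y t).
Proof.
move=> XA YA i j; rewrite (_ : (fun _ => _) = fun t => \sum_k X t i k * Y t k j); last first.
  by apply: funext => t; rewrite mxE.
by apply: fa_sum => k _; apply: fa_mul.
Qed.

Lemma fa_mxD m n (X Y : T -> 'M[K]_(m, n)) : fa_mx X -> fa_mx Y -> fa_mx (fun t => X t + Y t).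
Proof.
move=> XA YA i j; rewrite (_ : (fun _ => _) = fun t => X t i j + Y t i j).
  exact: fa_add.
by apply: funext => t; rewrite mxE.
Qed.

Lemma fa_mxZ m n (c : T -> K) (X : T -> 'M[K]_(m, n)) :
  A c -> fa_mx X -> fa_mx (fun t => c t *: X t).
Proof.
move=> cA XA i j; rewrite (_ : (fun _ => _) = fun t => c t * X t i j).
  exact: fa_mul.
by apply: funext => t; rewrite mxE.
Qed.

Lemma fa_mxT m n (X : T -> 'M[K]_(m, n)) : fa_mx X -> fa_mx (fun t => (X t)^T).
Proof.
move=> XA i j; rewrite (_ : (fun _ => _) = fun t => X t j i); first exact: XA.
by apply: funext => t; rewrite mxE.
Qed.

Lemma fa_mx_sum m n (I : Type) (r : seq I) (P : pred I) (X : I -> T -> 'M[K]_(m, n)) :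
  (forall i, P i -> fa_mx (X i)) -> fa_mx (fun t => \sum_(i <- r | P i) X i t).
Proof.
move=> XA i j; rewrite (_ : (fun _ => _) = fun t => \sum_(k <- r | P k) X k t i j).
  by apply: fa_sum => k Pk; apply: XA.
by apply: funext => t; rewrite summxE.
Qed.

Lemma fa_det n (X : T -> 'M[K]_n) : fa_mx X -> A (fun t => \det (X t)).
Proof.
move=> XA; rewrite /determinant; apply: fa_sum => s _.
apply: (fa_mul hA (f := fun=> (-1) ^+ perm.odd_perm s)); first exact: fa_const.
exact: fa_prod.
Qed.

Lemma fa_adj n (X : T -> 'M[K]_n) : fa_mx X -> fa_mx (fun t => \adj (X t)).
Proof.
move=> XA i j; rewrite (_ : (fun _ => _) = fun t => cofactor (X t) j i); last first.
  by apply: funext => t; rewrite mxE.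
rewrite /cofactor; apply: (fa_mul hA (f := fun=> (-1) ^+ (j + i))); first exact: fa_const.
apply: fa_det => i' j'; rewrite (_ : (fun _ => _) = fun t => X t (lift j i') (lift i j')).
  exact: XA.
by apply: funext => t; rewrite !mxE.
Qed.

Lemma fa_mpoly n (p : {mpoly K[n]}) (c : 'I_n -> T -> K) :
  (forall k, A (c k)) -> A (fun t => p.@[c^~ t]).
Proof.
move=> cA; rewrite (_ : (fun _ => _) = fun t => \sum_(m <- msupp p) p@_m * \prod_i c i t ^+ m i).
  apply: fa_sum => m _; apply: (fa_mul hA (f := fun=> p@_m)); first exact: fa_const.
  by apply: fa_prod => i _; apply: fa_exp.
by apply: funext => t; rewrite mevalE.
Qed.

Lemma fa_eval_mx (Q : quiver) d (z : T -> generator Q -> 'M[K]_d) t :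
  (forall a, fa_mx (fun s => z s a)) -> fa_mx (fun s => eval_mx (z s) t).
Proof.
move=> zA; elim: t => [g|k|t1 IH1 t2 IH2|t1 IH1 t2 IH2] /=.
- exact: zA.
- exact: fa_mx_const.
- exact: fa_mxD.
- exact: fa_mxM.
Qed.

End FunctionAlgebras.

Section Points.
Variables (K : fieldType) (Q : quiver) (L d : nat).
Local Notation Lam := (tpa K Q L).
Local Notation var := (modvar K Q L d).

Definition regular : set (var -> K) := [set f | exists p, f = fun y => p.@[coords y]].

Lemma regular_algebra : fun_algebra regular.
Proof.
split=> [c|f g [p ->] [q ->]|f g [p ->] [q ->]].
- by exists (c%:MP); apply: funext => y; rewrite mevalC.
- by exists (p + q); apply: funext => y; rewrite mevalD.
- by exists (p * q); apply: funext => y; rewrite mevalM.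
Qed.

Lemma coordsE (y : var) a i j : coords y (enum_rank (a, i, j)) = val y a i j.
Proof. by rewrite /coords enum_rankK. Qed.

Lemma regular_entry a : fa_mx regular (fun y : var => val y a).
Proof.
move=> i j; exists 'X_(enum_rank (a, i, j)).
by apply: funext => y; rewrite mevalXU coordsE.
Qed.

Lemma regular_act (f : Lam) : fa_mx regular (fun y : var => point_act y f).
Proof.
apply: (fa_eval_mx regular_algebra (z := fun (y : var) a => val y a)) => a.
exact: regular_entry.
Qed.

Lemma open_nonzero f : regular f -> open [set y : var | f y <> 0].
Proof.
move=> [p ->]; exists [set p]; apply/seteqP; split=> y /=.
  by move=> yp H; apply: yp; apply: H.
by move=> yp p0; apply: yp => q ->.
Qed.

Lemma closed_separate (A : set var) x : closed A -> ~ A x ->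
  exists p, p.@[coords x] <> 0 /\ forall y, A y -> p.@[coords y] = 0.
Proof.
move=> cA Ax; have : open (~` A) by rewrite openC.
move=> [F FE]; have : (~` A) x by [].
rewrite FE => /existsNP[p /not_implyP[Fp px]]; exists p; split=> // y Ay.
by apply: contrapT => py; have : (~` A) y by rewrite FE => /(_ p Fp).
Qed.

Lemma infinite_nonroot (p : {poly K}) : infinite_set [set: K] -> p != 0 -> exists t, p.[t] != 0.
Proof.
move=> Kinf p0; apply: contrapT => /forallNP H.
suff [s [us ss]] : exists s : seq K, uniq s /\ size s = size p.
  have := max_poly_roots p0 _ us; rewrite ss ltnn => H'; apply/notF/H'.
  by apply/allP => t _; apply/eqP; apply: contrapT => /eqP; exact: H.
elim: (size p) => [|n [s [us ss]]]; first by exists [::].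
have [t ts] : exists t, t \notin s.
  apply: contrapT => /forallNP sK; apply: Kinf; apply/finite_seqP; exists s.
  by apply/seteqP; split=> // t _ /=; apply: contrapT => /negP; exact: sK.
by exists (t :: s); rewrite /= ts us ss.
Qed.

Definition polynomial : set (K -> K) := [set f | exists p : {poly K}, f = fun t => p.[t]].

Lemma polynomial_algebra : fun_algebra polynomial.
Proof.
split=> [c|f g [p ->] [q ->]|f g [p ->] [q ->]].
- by exists (c%:P); apply: funext => y; rewrite hornerC.
- by exists (p + q); apply: funext => y; rewrite hornerD.
- by exists (p * q); apply: funext => y; rewrite hornerM.
Qed.

Definition interpolate m n (X Y : 'M[K]_(m, n)) (t : K) := (1 - t) *: X + t *: Y.

Lemma interpolate0 m n (X Y : 'M[K]_(m, n)) : interpolate X Y 0 = X.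
Proof. by rewrite /interpolate subr0 scale1r scale0r addr0. Qed.

Lemma interpolate1 m n (X Y : 'M[K]_(m, n)) : interpolate X Y 1 = Y.
Proof. by rewrite /interpolate subrr scale1r scale0r add0r. Qed.

Lemma polynomial_interpolate m n (X Y : 'M[K]_(m, n)) : fa_mx polynomial (interpolate X Y).
Proof.
have P := polynomial_algebra.
have id : polynomial id by exists 'X; apply: funext => t; rewrite hornerX.
apply: fa_mxD => //; apply: fa_mxZ => //; try exact: fa_mx_const.
exists (1 - 'X); apply: funext => t.
by rewrite hornerD hornerN hornerX hornerC.
Qed.

(** On the curve t |-> h(t) z(t) h(t)^-1, with h and z affine in t, the coordinates are
    the entries of h(t) z(t) adj h(t), divided by det h(t). *)
Lemma regular_on_curve (h1 h2 : 'M[K]_d) (z1 z2 : generator Q -> 'M[K]_d) (p : {mpoly K[_]}) :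
  exists N (F : {poly K}), forall t (y : var), interpolate h1 h2 t \in unitmx ->
    (forall a, val y a = interpolate h1 h2 t *m interpolate (z1 a) (z2 a) t
                         *m invmx (interpolate h1 h2 t)) ->
    \det (interpolate h1 h2 t) ^+ N * p.@[coords y] = F.[t].
Proof.
have P := polynomial_algebra; have Ph := polynomial_interpolate h1 h2.
have [D DE] : polynomial (fun t => \det (interpolate h1 h2 t)) by apply: fa_det.
have DE' t : \det (interpolate h1 h2 t) = D.[t] by rewrite -[LHS]/((fun t => _) t) DE.
pose good t (y : var) := interpolate h1 h2 t \in unitmx /\
    forall a, val y a = interpolate h1 h2 t *m interpolate (z1 a) (z2 a) t
                         *m invmx (interpolate h1 h2 t).
pose A : set (var -> K) := [set f | exists N (F : {poly K}), forall t y, good t y ->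
  \det (interpolate h1 h2 t) ^+ N * f y = F.[t]].
have AA : fun_algebra A.
  split=> [c|f g [N [F fF]] [N' [G gG]]|f g [N [F fF]] [N' [G gG]]].
  - by exists 0%N, c%:P => t y _; rewrite mul1r hornerC.
  - exists (N + N')%N, (F * D ^+ N' + G * D ^+ N) => t y ty.
    rewrite hornerD !hornerM !horner_exp -!DE' -(fF t y ty) -(gG t y ty) exprD.
    by rewrite mulrDr mulrAC; congr (_ + _); rewrite -mulrA mulrC.
  - exists (N + N')%N, (F * G) => t y ty.
    by rewrite hornerM -(fF t y ty) -(gG t y ty) exprD mulrACA.
have coordA k : A ((fun k (y : var) => coords y k) k).
  case E: (enum_val k) => [[a i] j].
  have [F FE] : polynomial (fun t => (interpolate h1 h2 t *m interpolate (z1 a) (z2 a) t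
      *m \adj (interpolate h1 h2 t)) i j).
    apply: fa_mxM => //; last exact: fa_adj.
    by apply: fa_mxM => //; apply: polynomial_interpolate.
  exists 1%N, F => t y [hu yE]; rewrite /coords E yE expr1.
  rewrite -[F.[t]]/((fun t => F.[t]) t) -FE /invmx hu -scalemxAr [in LHS]mxE.
  by rewrite mulrA mulfV ?mul1r // -unitfE -unitmxE.
have [N [F H]] := fa_mpoly AA p coordA.
by exists N, F => t y hu yE; apply: (H t y).
Qed.

(** Two nonempty relatively open subsets of C meet on such a curve joining a point of one
    to a point of the other: each contains all but finitely many points of the curve. *)
Lemma irreducible_curves (C : set var) : infinite_set [set: K] -> C !=set0 ->
  (forall x1 x2, C x1 -> C x2 ->
    exists (h1 h2 : 'M[K]_d) (z1 z2 : generator Q -> 'M[K]_d) (beta : {poly K}),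
    [/\ h1 \in unitmx /\ h2 \in unitmx, beta != 0,
        forall a, val x1 a = h1 *m z1 a *m invmx h1,
        forall a, val x2 a = h2 *m z2 a *m invmx h2 &
        forall t h, beta.[t] != 0 -> h \in unitmx -> exists2 y, C y &
          forall a, val y a = h *m interpolate (z1 a) (z2 a) t *m invmx h]) ->
  irreducible C.
Proof.
move=> Kinf C0 curve; split=> // A B cA cB CAB; apply: contrapT => /not_orP[CA CB].
have [x1 [Cx1 Ax1]] : exists x, C x /\ ~ A x.
  by apply: contrapT => H; apply: CA => x Cx; apply: contrapT => Ax; apply: H; exists x.
have [x2 [Cx2 Bx2]] : exists x, C x /\ ~ B x.
  by apply: contrapT => H; apply: CB => x Cx; apply: contrapT => Bx; apply: H; exists x.
have [p [px1 pA]] := closed_separate cA Ax1; have [q [qx2 qB]] := closed_separate cB Bx2.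
have [h1 [h2 [z1 [z2 [beta [[h1u h2u] b0 x1E x2E H]]]]]] := curve x1 x2 Cx1 Cx2.
have [N [F FE]] := regular_on_curve h1 h2 z1 z2 p.
have [N' [G GE]] := regular_on_curve h1 h2 z1 z2 q.
have [D DE] : polynomial (fun t => \det (interpolate h1 h2 t)).
  by apply: fa_det; [exact: polynomial_algebra | exact: polynomial_interpolate].
have DE' t : \det (interpolate h1 h2 t) = D.[t] by rewrite -[LHS]/((fun t => _) t) DE.
have D0 : D != 0.
  apply/eqP => D0; have := DE' 0; rewrite interpolate0 D0 horner0 => dh.
  by move: h1u; rewrite unitmxE dh unitr0.
have F0 : F != 0.
  apply/eqP => F0; have := FE 0 x1; rewrite interpolate0 F0 horner0 => /(_ h1u).
  have E a : val x1 a = h1 *m interpolate (z1 a) (z2 a) 0 *m invmx h1 by rewrite interpolate0.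
  move=> /(_ E)/eqP; rewrite mulf_eq0 expf_eq0 => /orP[/andP[_]|/eqP //].
  by move: h1u; rewrite unitmxE unitfE => /negbTE ->.
have G0 : G != 0.
  apply/eqP => G0; have := GE 1 x2; rewrite interpolate1 G0 horner0 => /(_ h2u).
  have E a : val x2 a = h2 *m interpolate (z1 a) (z2 a) 1 *m invmx h2 by rewrite interpolate1.
  move=> /(_ E)/eqP; rewrite mulf_eq0 expf_eq0 => /orP[/andP[_]|/eqP //].
  by move: h2u; rewrite unitmxE unitfE => /negbTE ->.
have [t] : exists t, (F * G * (D * beta)).[t] != 0.
  by apply: infinite_nonroot => //; rewrite !mulf_neq0.
rewrite !hornerM !mulf_eq0 !negb_or => /andP[/andP[Ft Gt] /andP[Dt bt]].
have hu : interpolate h1 h2 t \in unitmx by rewrite unitmxE DE' unitfE.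
have [y Cy yE] := H t _ bt hu.
case: (CAB y Cy) => [/pA py|/qB qy].
  by move: Ft; rewrite -(FE t y hu yE) py mulr0 eqxx.
by move: Gt; rewrite -(GE t y hu yE) qy mulr0 eqxx.
Qed.

End Points.

Lemma irreducible_closure (X : topologicalType) (C : set X) :
  irreducible C -> irreducible (closure C).
Proof.
move=> [[x Cx] irr]; split; first by exists x; apply: subset_closure.
move=> A B cA cB CAB; have [|CA|CB] := irr A B cA cB.
- by move=> y Cy; apply: CAB; apply: subset_closure.
- by left; rewrite ((closure_id A).1 cA); apply: closure_subset.
- by right; rewrite ((closure_id B).1 cB); apply: closure_subset.
Qed.

(** * Ranks, and the strata as locally closed sets *)

Section Ranks.
Variables (K : fieldType) (Q : quiver) (L d : nat).
Local Notation Lam := (tpa K Q L).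
Local Notation path := (tpath Q L).
Local Notation var := (modvar K Q L d).
Local Notation len p := (size (tarrows p)).
Local Notation scal := (scal Q L).
Local Notation pelt := (pelt K).
Local Notation ver := (ver K L).
Implicit Types (x y : var).

Lemma point_scal y c (u : point_module y) : scal c *: u = (c *: (u : 'cV[K]_d))%R.
Proof.
change (point_act y (scal c) *m u = c *: (u : 'cV[K]_d)).
by rewrite -(@point_actP _ _ _ _ y (NCconst Q c)) // mul_scalar_mx.
Qed.

Lemma point_lcomb y (F : finType) (S : pred F) (b : F -> point_module y) c :
  lcomb S b c = \sum_(f | S f) c f *: (b f : 'cV[K]_d).
Proof. by apply: eq_bigr => f _; rewrite point_scal. Qed.

Lemma mul_lcomb x y (A : 'M[K]_d) (F : finType) (S : pred F) (b : F -> point_module y) c :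
  A *m (lcomb S b c : 'cV[K]_d) = lcomb S (fun f => A *m (b f : 'cV[K]_d) : point_module x) c.
Proof.
rewrite !point_lcomb mulmx_sumr; apply: eq_bigr => f _.
by rewrite scalemxAr.
Qed.

Lemma point_fin_gen y : fin_gen (point_module y).
Proof.
exists [seq (delta_mx i 0 : 'cV[K]_d) | i <- enum 'I_d] => u.
have -> : u = \sum_i scal ((u : 'cV[K]_d) i 0) *: (delta_mx i 0 : point_module y).
  rewrite (eq_bigr _ (fun i _ => point_scal _ _)).
  rewrite [LHS](matrix_sum_delta (u : 'cV[K]_d)); apply: eq_bigr => i _.
  by rewrite big_ord1.
apply: rpred_sum => i _; apply: rpredZ; apply: mem_gen_by.
by apply: map_f; rewrite mem_enum.
Qed.

(** The row space of jmx is the transpose of e_i J^l M, for the module M in which the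
    paths act by the matrices A, since e_i J^l M is the sum of the images of the paths of
    length l ending in e_i. *)
Definition jmx (A : path -> 'M[K]_d) (l : nat) (i : vertex Q) : 'M[K]_d :=
  (\sum_(p : path | (len p == l) && (tend p == i)) (A p)^T)%MS.

Definition jrank y (l : nat) (i : vertex Q) : nat :=
  \rank (jmx (fun p => point_act y (pelt p)) l i).

Definition rows_of (F : finType) (S : pred F) (b : F -> 'cV[K]_d) : 'M[K]_(#|S|, d) :=
  \matrix_j (b (enum_val j))^T.

Lemma row_rows_of (F : finType) (S : pred F) (b : F -> 'cV[K]_d) f : S f ->
  exists j, row j (rows_of S b) = (b f)^T.
Proof. by move=> Sf; exists (enum_rank_in (Sf : f \in S) f); rewrite rowK enum_rankK_in. Qed.

Lemma col_rows_of (F : finType) (S : pred F) (b : F -> 'cV[K]_d) f (Sf : f \in S) :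
  b f = (rows_of S b)^T *m delta_mx (enum_rank_in Sf f) 0.
Proof. by rewrite -colE -tr_row rowK enum_rankK_in // trmxK. Qed.

Lemma rows_of_free y (F : finType) (S : pred F) (b : F -> point_module y) :
  free S b -> row_free (rows_of S b).
Proof.
move=> fr; rewrite -kermx_eq0; apply/rowV0P => u /sub_kermxP uB.
have [c cE] := ex_enum_coef (fun j : 'I_#|S| => u 0 j).
apply/rowP => j; rewrite -cE mxE; apply: (fr c); last exact: (enum_valP j).
rewrite lcomb_enum; apply: trmx_inj; rewrite trmx0 -uB mulmx_sum_row linear_sum /=.
by apply: eq_bigr => k _; rewrite cE point_scal linearZ /= rowK.
Qed.

Lemma jmx_sub y (A : path -> 'M[K]_d) l i (F : finType) (S : pred F) (b : F -> point_module y) :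
  (forall (p : path) (u : 'cV[K]_d), len p = l -> tend p = i ->
     span S b (A p *m u : point_module y)) ->
  (jmx A l i <= rows_of S b)%MS.
Proof.
move=> H; apply/sumsmx_subP => p /andP[/eqP pl /eqP pi]; apply/row_subP => j.
have -> : row j (A p)^T = (A p *m delta_mx j 0)^T.
  by rewrite trmx_mul trmx_delta -rowE.
have [c cE] := H p (delta_mx j 0) pl pi.
rewrite [A p *m _]cE point_lcomb linear_sum; apply: summx_sub => f Sf; rewrite linearZ /=.
by have [k <-] := row_rows_of b Sf; apply: scalemx_sub; apply: row_sub.
Qed.

Lemma jrank_skel y (I : finType) (v : I -> vertex Q) (m : I -> point_module y) B l i :
  skeleton v m B -> jrank y l i =
  count_at (fun kp => skel v B kp && (l <= len kp.2)%N) (fun kp : I * path => tend kp.2) i.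
Proof.
move=> sk; pose S : pred (I * path) :=
  fun kp => skel v B kp && (l <= len kp.2)%N && (tend kp.2 == i).
rewrite /count_at; change (jrank y l i = #|S|).
pose b kp : 'cV[K]_d := pel m kp.
pose Bm := rows_of S b; have rowB j : row j Bm = (b (enum_val j))^T by rewrite rowK.
have rB : row_free Bm.
  by apply: (@rows_of_free y); apply: free_sub (sk_basis sk).1 => kp /andP[/andP[]].
have eqB : (jmx (fun p => point_act y (pelt p)) l i :=: Bm)%MS.
  apply/eqmxP/andP; split.
    apply: (@jmx_sub y) => p z pl pi.
    change (span S (pel m) (pelt p *: (z : point_module y))).
    have : span (fun kp => skel v B kp && (l <= len kp.2)%N) (pel m)
        (pelt p *: (z : point_module y)).
      by apply/(skel_Jpow sk); rewrite peltE; apply: Jpow_res; rewrite pl.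
    move=> /(span_ver i (fun kp _ => pel_ver m kp)).
    by rewrite scalerA -[X in ver X * _]pi pelt_tend.
  apply/row_subP => j; rewrite rowB; have := enum_valP j; case: (enum_val j) => k p.
  move=> /andP[/andP[/andP[/eqP /= pk _] lp] pi].
  have pp := tpath_path p.
  pose w1 := take (len p - l) (tarrows p); pose w2 := drop (len p - l) (tarrows p).
  have wE : tarrows p = w1 ++ w2 by rewrite cat_take_drop.
  have pw2 : is_path (endpoint (tstart p) w1) w2.
    by move: pp; rewrite wE is_path_cat => /andP[].
  have sw2 : size w2 = l by rewrite size_drop subKn.
  have [|p2 [p21 p22]] := @ex_tpath _ L _ _ pw2.
    by rewrite sw2; apply: leq_trans lp (tpath_size p).
  apply: (sumsmx_sup p2).
    by rewrite p22 sw2 eqxx /= /tend p21 p22 -endpoint_cat -wE.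
  have -> : b (k, p) = point_act y (pelt p2) *m (res K L (tstart p) w1 *: m k : point_module y).
    change (b (k, p) = pelt p2 *: (res K L (tstart p) w1 *: m k)).
    by rewrite scalerA peltE p21 p22 res_cat -wE /b /pel peltE.
  by rewrite trmx_mul submxMl.
by rewrite /jrank eqB; apply/eqP.
Qed.

Lemma jrank_mult y (I : finType) (v : I -> vertex Q) (m : I -> point_module y) B l i :
  skeleton v m B -> jrank y l i = (\sum_(k < L.+1 | (l <= k)%N) mult_at L v B k i)%N.
Proof.
move=> sk; rewrite (jrank_skel l i sk) /count_at -sum1_card.
rewrite (partition_big (fun kp : I * path => inord (len kp.2) : 'I_L.+1)
  (fun k : 'I_L.+1 => (l <= k)%N)) /=; last first.
  by move=> kp /andP[/andP[_ lp] _]; rewrite inordK // ltnS tpath_size.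
apply: eq_bigr => k lk; rewrite /mult_at /count_at -sum1_card; apply: eq_bigl => kp.
rewrite !inE /= -val_eqE /= inordK ?ltnS ?tpath_size //.
by case: (len kp.2 =P k :> nat) => [->|_]; rewrite ?lk ?andbT ?andbF.
Qed.

Lemma jrank_iso x y l i : lmod_iso (point_module x) (point_module y) -> jrank x l i = jrank y l i.
Proof.
have [I [v [m [B sk]]]] := ex_skeleton (point_fin_gen x).
by move=> /skeleton_iso/(_ sk)[m' sk']; rewrite (jrank_skel l i sk) (jrank_skel l i sk').
Qed.

(** Some r combinations of the rows, with coefficients u, are free, r being the rank;
    they remain free for all A' at which a certain minor does not vanish. *)
Lemma rank_minor (A : path -> 'M[K]_d) l i :
  exists (u : path -> 'M[K]_(\rank (jmx A l i), d)) V,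
    \det ((\sum_(p : path | (len p == l) && (tend p == i)) u p *m (A p)^T) *m V) != 0 /\
    forall A' : path -> 'M[K]_d,
      \det ((\sum_(p : path | (len p == l) && (tend p == i)) u p *m (A' p)^T) *m V) != 0 ->
      (\rank (jmx A l i) <= \rank (jmx A' l i))%N.
Proof.
set r := \rank _; pose B := row_base (jmx A l i).
have /sub_sumsmxP[u BE] : (B <= jmx A l i)%MS by rewrite eq_row_base.
have /row_freeP[V BV] : row_free B by exact: row_base_free.
exists u, V; split; first by rewrite -BE BV det1 oner_eq0.
move=> A' d0; set X := \sum_(p | _) _ in d0.
have XA' : (X <= jmx A' l i)%MS by apply/sub_sumsmxP; exists u.
apply: leq_trans (mxrankS XA'); apply: leq_trans (mxrankM_maxl X V).
have E : \rank (X *m V) = r by apply: mxrank_unit; rewrite unitmxE unitfE.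
by rewrite E.
Qed.

Lemma open_jrank k l i : open [set y | (k <= jrank y l i)%N].
Proof.
rewrite (_ : [set y | _] = \bigcup_(U in [set U | open U /\
    U `<=` [set y | (k <= jrank y l i)%N]]) U); first by apply: bigcup_open => U [].
apply/seteqP; split=> [x kx|x [U [_ UA] /UA //]].
have [u [V [dx dU]]] := rank_minor (fun p => point_act x (pelt p)) l i.
pose f y : K := \det ((\sum_(p : path | (len p == l) && (tend p == i))
    u p *m (point_act y (pelt p))^T) *m V).
exists [set y | f y <> 0]; last exact/eqP.
split; last first.
  by move=> y /eqP /dU; apply: leq_trans.
apply: open_nonzero; have R := regular_algebra K Q L d.
apply: (fa_det R); apply: (fa_mxM R); last exact: fa_mx_const.
apply: (fa_mx_sum R) => p _; apply: (fa_mxM R); first exact: fa_mx_const.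
apply: fa_mxT; exact: regular_act.
Qed.

Section Stratum.
Variables (S : 'I_L.+1 -> lmodType Lam) (s : vertex Q -> 'I_L.+1 -> nat).
Hypothesis Ss : forall l, lmod_iso (S l) (semisimple K L (fun i => s i l)).

Definition srank (l : nat) (i : vertex Q) : nat := (\sum_(k < L.+1 | (l <= k)%N) s i k)%N.

(** The radical layering is encoded in the ranks: s i l is the difference of two
    consecutive ranks. *)
Lemma stratumP x : rad_stratum S d x <-> forall (l : 'I_L.+1) i, jrank x l i = srank l i.
Proof.
have [I [v [m [B sk]]]] := ex_skeleton (point_fin_gen x).
have xS : rad_stratum S d x <-> forall (l : 'I_L.+1) i, mult_at L v B l i = s i l.
  split=> H l.
    have MsI := lmod_iso_trans (H l) (Ss l).
    exact: (has_mult_uniq MsI (layer_mult sk l) (semisimple_mult K L _)).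
  apply: lmod_iso_trans (lmod_iso_sym (Ss l)).
  apply: (has_mult_semisimple_iso (layer_mult sk l) (semisimple_mult K L (fun i => s i l))).
  - by move=> i; rewrite H.
  - by move=> a y; apply: layer_arr.
  - by move=> a y; apply: semisimple_arr.
rewrite xS; split=> H l i.
  by rewrite (jrank_mult l i sk); apply: eq_bigr => k _; rewrite H.
suff Hn n (k : 'I_L.+1) : (L - k < n)%N -> mult_at L v B k i = s i k by apply: (Hn (L - l).+1).
elim: n k => // n IH k; rewrite ltnS => kn.
have := H k i; rewrite (jrank_mult k i sk) /srank (bigD1 k) //= [RHS](bigD1 k) //=.
set X := (\sum_(j < _ | _) mult_at _ _ _ _ _)%N; set Y := (\sum_(j < _ | _) _)%N.
suff -> : X = Y by move/addIn.
apply: eq_bigr => j /andP[kj jk]; apply: IH.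
have {kj jk} : (k < j)%N by rewrite ltn_neqAle eq_sym jk.
by have := ltn_ord j; lia.
Qed.

Lemma stratum_closure x : closure (rad_stratum S d) x ->
  (forall (l : 'I_L.+1) i, srank l i <= jrank x l i)%N -> rad_stratum S d x.
Proof.
move=> xS le; apply/stratumP => l i; apply/eqP; rewrite eqn_leq le andbT leqNgt.
apply/negP => lt.
have Cl : closed (~` [set y | (srank l i < jrank y l i)%N]) by rewrite closedC; apply: open_jrank.
have : closure (rad_stratum S d) `<=` ~` [set y | (srank l i < jrank y l i)%N].
  rewrite [X in _ `<=` X]((closure_id _).1 Cl); apply: closure_subset => y /stratumP yS /=.
  by rewrite yS ltnn.
by move=> /(_ x xS) /=; apply.
Qed.

(** Ranks can only drop in the closure of the stratum, and not dropping is an open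
    condition: the stratum is open in its closure. *)
Lemma stratum_generic (v : enat) : (forall x, rad_stratum S d x -> pdim_at x = v) ->
  generic_value (@pdim_at K Q L d) (closure (rad_stratum S d)) v.
Proof.
move=> Sv; pose O : set var := \bigcap_(li in [set: 'I_L.+1 * vertex Q])
  [set y | (srank li.1 li.2 <= jrank y li.1 li.2)%N].
exists O; split.
- have oN (r : seq ('I_L.+1 * vertex Q)) : open [set y : var | forall li, li \in r ->
      (srank li.1 li.2 <= jrank y li.1 li.2)%N].
    elim: r => [|li r IH].
      rewrite (_ : [set y | _] = setT); first exact: openT.
      by apply/seteqP; split.
    rewrite (_ : [set y | _] = [set y | (srank li.1 li.2 <= jrank y li.1 li.2)%N] `&`
      [set y | forall li, li \in r -> (srank li.1 li.2 <= jrank y li.1 li.2)%N]).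
      by apply: openI => //; apply: open_jrank.
    apply/seteqP; split=> y H.
      by split=> [|li' r']; apply: H; rewrite inE ?eqxx // r' orbT.
    by move=> li'; rewrite inE => /orP[/eqP ->|]; [case: H | case: H => _ H'; exact: H'].
  rewrite (_ : O = [set y : var | forall li, li \in enum [set: 'I_L.+1 * vertex Q]%SET ->
      (srank li.1 li.2 <= jrank y li.1 li.2)%N]) //.
  apply/seteqP; split=> y H li; last by move=> _; apply: H; rewrite mem_enum inE.
  by move=> _; apply: H.
- apply: closure_subset => x xS; split; first exact: subset_closure.
  by move=> [l i] _ /=; move/stratumP: xS => ->.
- move=> x [xS xO]; apply: Sv; apply: stratum_closure => // l i.
  exact: (xO (l, i) I).
Qed.

End Stratum.

End Ranks.

(** * Constructing points, and irreducibility of strata and orbits *)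

Section Construct.
Variables (K : fieldType) (Q : quiver) (L d : nat).
Local Notation Lam := (tpa K Q L).
Local Notation path := (tpath Q L).
Local Notation var := (modvar K Q L d).
Local Notation len p := (size (tarrows p)).
Local Notation pelt := (pelt K).
Local Notation ver := (ver K L).
Local Notation arr := (arr K L).
Implicit Types (x y : var) (z : generator Q -> 'M[K]_d).

Definition wmx z (e : vertex Q) (w : seq (arrow Q)) : 'M[K]_d :=
  foldl (fun A a => z (inr a) *m A) (z (inl e)) w.

Lemma wmx_rcons z e w a : wmx z e (rcons w a) = z (inr a) *m wmx z e w.
Proof. by rewrite /wmx foldl_rcons. Qed.

Lemma eval_nc_path_mx z (p : path) : eval_mx z (nc_path K p) = wmx z (tstart p) (tarrows p).
Proof.
rewrite /nc_path; elim/last_ind: (tarrows p) => // w a IH.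
by rewrite foldl_rcons wmx_rcons -IH.
Qed.

Lemma point_act_pelt y p : point_act y (pelt p) = wmx (val y) (tstart p) (tarrows p).
Proof. by rewrite -(point_actP y (eval_nc_path K p)) eval_nc_path_mx. Qed.

(** The defining relations: orthogonal idempotents with sum 1, arrows between the right
    vertices, and no nonzero path of length L + 1. *)
Record relations z : Prop := Relations {
  rel_one : \sum_i z (inl i) = 1%:M;
  rel_idem : forall i j, z (inl i) *m z (inl j) = if i == j then z (inl i) else 0;
  rel_source : forall a, z (inr a) *m z (inl (source a)) = z (inr a);
  rel_target : forall a, z (inl (target a)) *m z (inr a) = z (inr a);
  rel_long : forall e w, is_path e w -> (L < size w)%N -> wmx z e w = 0
}.

Section Representation.
Variable z : generator Q -> 'M[K]_d.
Hypothesis rz : relations z.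

Let rho (f : Lam) : 'M[K]_d := \sum_p f p *: wmx z (tstart p) (tarrows p).

Let rho_pelt p : rho (pelt p) = wmx z (tstart p) (tarrows p).
Proof.
rewrite /rho (bigD1 p) //= ffunE eqxx scale1r big1 ?addr0 // => q qp.
by rewrite ffunE (negbTE qp) scale0r.
Qed.

Let rhoD f g : rho (f + g) = rho f + rho g.
Proof. by rewrite /rho -big_split; apply: eq_bigr => p _; rewrite ffunE scalerDl. Qed.

Let rhoZ k (f : Lam) : rho (k *: f) = k *: rho f.
Proof. by rewrite /rho scaler_sumr; apply: eq_bigr => p _; rewrite ffunE scalerA. Qed.

Let rho0 : rho 0 = 0.
Proof. by rewrite /rho big1 // => p _; rewrite ffunE scale0r. Qed.

Let rho_sum (I : finType) (F : I -> Lam) : rho (\sum_i F i) = \sum_i rho (F i).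
Proof. by elim/big_rec2: _ => [|i A f _ <-]; [exact: rho0 | rewrite rhoD]. Qed.

Let rho_res e w : is_path e w -> rho (res K L e w) = wmx z e w.
Proof.
move=> pw; have [wL|wL] := leqP (size w) L; last by rewrite res_long // rho0 (rel_long rz).
by have [p [<- <-]] := ex_tpath pw wL; rewrite -res_tpath rho_pelt.
Qed.

Let wmx_end e w : is_path e w -> z (inl (endpoint e w)) *m wmx z e w = wmx z e w.
Proof.
case/lastP: w => [_|w a _]; first by rewrite /wmx /endpoint /= (rel_idem rz) eqxx.
by rewrite endpoint_rcons wmx_rcons mulmxA (rel_target rz).
Qed.

Let wmx_cat e w w' : is_path e w -> wmx z (endpoint e w) w' *m wmx z e w = wmx z e (w ++ w').
Proof.
move=> pw; elim/last_ind: w' => [|w' a IH]; first by rewrite cats0 /wmx -/(wmx z e w) wmx_end.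
by rewrite wmx_rcons -mulmxA IH -rcons_cat wmx_rcons.
Qed.

Let wmx_start e w i : i != e -> is_path e w -> wmx z e w *m z (inl i) = 0.
Proof.
move=> ie; elim/last_ind: w => [_|w a IH].
  by rewrite /wmx /= (rel_idem rz) eq_sym (negbTE ie).
by rewrite is_path_rcons => /andP[/IH pw _]; rewrite wmx_rcons -mulmxA pw mulmx0.
Qed.

Let rhoM (f g : Lam) : rho (f * g) = rho f *m rho g.
Proof.
have -> : f * g = \sum_p \sum_q (f p * g q) *:
    (if tend q == tstart p then res K L (tstart q) (tarrows q ++ tarrows p) else 0) by [].
rewrite rho_sum /rho mulmx_suml; apply: eq_bigr => p _.
rewrite -/(rho _) rho_sum mulmx_sumr; apply: eq_bigr => q _.
rewrite rhoZ -scalemxAl -scalemxAr scalerA; congr (_ *: _).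
have [pp pq] := (tpath_path p, tpath_path q).
case: eqP => [qp|/eqP qp]; last first.
  by rewrite rho0 -(wmx_end pq) mulmxA wmx_start // mul0mx.
by rewrite rho_res ?is_path_cat ?pq -/(tend q) ?qp // -qp /tend wmx_cat.
Qed.

Let rho1 : rho 1 = 1%:M.
Proof.
rewrite -(ver_sum K Q L) rho_sum -(rel_one rz); apply: eq_bigr => i _.
exact: rho_res.
Qed.

(** The matrices of the paths define an algebra homomorphism rho from Lambda, so every
    relation between the generators of Lambda holds for z. *)
Lemma relations_point : exists y, forall a, val y a = z a.
Proof.
have ev t : eval_mx z t = rho (eval_tpa L t).
  elim: t => [[i|a]|k|t1 IH1 t2 IH2|t1 IH1 t2 IH2].
  - by rewrite -[RHS]/(rho (res K L i [::])) rho_res.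
  - rewrite -[RHS]/(rho (res K L (source a) [:: a])) rho_res /= ?eqxx //.
    by rewrite /wmx /= (rel_source rz).
  - by rewrite -[RHS]/(rho (k *: (1 : Lam))) rhoZ rho1 scalemx1.
  - by rewrite -[RHS]/(rho (eval_tpa L t1 + eval_tpa L t2)) rhoD -IH1 -IH2.
  - by rewrite -[RHS]/(rho (eval_tpa L t1 * eval_tpa L t2)) rhoM -IH1 -IH2.
pose z' : {ffun generator Q -> 'M[K]_d} := [ffun a => z a].
have z'z : (z' : generator Q -> 'M[K]_d) = z by apply: funext => a; rewrite ffunE.
have zP : `[< forall t, eval_tpa L t = 0 -> eval_mx z' t = 0 >].
  by apply/asboolP => t t0; rewrite z'z ev t0 rho0.
by exists (exist _ z' zP) => a; rewrite /= ffunE.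
Qed.

End Representation.

Lemma eval_mx_conj (h : 'M[K]_d) z z' t : h \in unitmx ->
  (forall a, z' a = h *m z a *m invmx h) -> eval_mx z' t = h *m eval_mx z t *m invmx h.
Proof.
move=> hu zz'; elim: t => [a|k|t1 IH1 t2 IH2|t1 IH1 t2 IH2].
- exact: zz'.
- by rewrite /eval_mx /= mul_mx_scalar -scalemxAl mulmxV // scalemx1.
- by rewrite -[LHS]/(eval_mx z' t1 + eval_mx z' t2) IH1 IH2 -mulmxDl -mulmxDr.
- rewrite -[LHS]/(eval_mx z' t1 *m eval_mx z' t2) IH1 IH2.
  by rewrite !mulmxA mulmxKV // -!mulmxA.
Qed.

Lemma conj_iso (h : 'M[K]_d) x y : h \in unitmx ->
  (forall a, val y a = h *m val x a *m invmx h) ->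
  lmod_iso (point_module x) (point_module y).
Proof.
move=> hu xy.
have [f fE] : exists f : {linear point_module x -> point_module y},
    f =1 (fun u => h *m (u : 'cV[K]_d)).
  apply: ex_linear => a u v.
  change (h *m (point_act x a *m (u : 'cV[K]_d) + (v : 'cV[K]_d)) =
    point_act y a *m (h *m (u : 'cV[K]_d)) + h *m (v : 'cV[K]_d)).
  by rewrite mulmxDr /point_act (eval_mx_conj _ hu xy) !mulmxA mulmxKV.
apply: (@inj_surj_iso _ _ _ f) => [u v|u].
  by rewrite !fE => E; rewrite -[LHS](mulKmx hu) E mulKmx.
by exists (invmx h *m (u : 'cV[K]_d)); rewrite fE mulKVmx.
Qed.

Lemma conj_point (h : 'M[K]_d) x : h \in unitmx ->
  exists y, forall a, val y a = h *m val x a *m invmx h.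
Proof.
move=> hu; pose z' : {ffun generator Q -> 'M[K]_d} := [ffun a => h *m val x a *m invmx h].
have zP : `[< forall t, eval_tpa L t = 0 -> eval_mx z' t = 0 >].
  apply/asboolP => t t0; rewrite (@eval_mx_conj h (val x)) // => [|a]; last by rewrite ffunE.
  by have /asboolP/(_ t t0) -> := valP x; rewrite mulmx0 mul0mx.
by exists (exist _ z' zP) => a; rewrite /= ffunE.
Qed.

Lemma orbit_iso x y : GL_orbit x y -> lmod_iso (point_module x) (point_module y).
Proof. by move=> [h hu xy]; apply: conj_iso hu xy. Qed.

Lemma irreducible_orbit x : infinite_set [set: K] -> irreducible (GL_orbit x).
Proof.
move=> Kinf; apply: irreducible_curves => // [|x1 x2 [h1 h1u x1E] [h2 h2u x2E]].
  by exists x; exists 1%:M; [exact: unitmx1 | move=> a; rewrite invmx1 mulmx1 mul1mx].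
exists h1, h2, (val x), (val x), 1; split=> //; first exact: oner_neq0.
move=> t h _ hu; have [y yE] := conj_point x hu; exists y; first by exists h.
by move=> a; rewrite yE /interpolate -scalerDl subrK scale1r.
Qed.

(** * Normal forms of the points of a stratum *)

Section NormalForm.
Variables (x0 : var) (F : finType) (S : pred F).
Variables (b : F -> point_module x0) (nu : F -> vertex Q) (lam : F -> nat).
Hypothesis b_basis : basis S b.
Hypothesis lamL : forall f, S f -> (lam f <= L)%N.

(** The vertices act as prescribed by nu, the arrows raise the level lam. These are
    affine conditions on z, so lines through two normal forms consist of normal forms. *)
Record normal z : Prop := Normal {
  nf_ver : forall i f, S f -> z (inl i) *m b f = if nu f == i then b f else 0;
  nf_arr0 : forall a f, S f -> nu f != source a -> z (inr a) *m b f = 0;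
  nf_arr : forall a f, S f ->
    span (fun f' => [&& S f', lam f < lam f' & nu f' == target a]%N) b
      (z (inr a) *m b f : point_module x0)
}.

Lemma mx_ext (A A' : 'M[K]_d) : (forall f, S f -> A *m b f = A' *m b f) -> A = A'.
Proof.
move=> AA'; have E (u : 'cV[K]_d) : A *m u = A' *m u.
  have [c ->] := b_basis.2 u; rewrite !(mul_lcomb x0).
  by apply: eq_bigr => f Sf; rewrite AA'.
apply/matrixP => i j; have := congr1 (fun X : 'cV[K]_d => X i 0) (E (delta_mx j 0)).
by rewrite -!colE !mxE.
Qed.

Lemma span_mul (A : 'M[K]_d) (T T' : pred F) (u : point_module x0) :
  (forall f, T f -> span T' b (A *m b f : point_module x0)) -> span T b u ->
  span T' b (A *m (u : 'cV[K]_d) : point_module x0).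
Proof. by move=> H [c ->]; rewrite (mul_lcomb x0); apply: span_sum => f /H; apply: spanZ. Qed.

Lemma normal_wmx z e w (u : 'cV[K]_d) : normal z -> is_path e w ->
  span (fun f => [&& S f, size w <= lam f & nu f == endpoint e w]%N) b
    (wmx z e w *m u : point_module x0).
Proof.
move=> nz; have [c ->] := b_basis.2 u; rewrite (mul_lcomb x0) => pw.
apply: span_sum => f Sf; apply: spanZ.
elim/last_ind: w pw => [_|w a IH].
  rewrite /wmx /= (nf_ver nz) //; case: eqP => [fe|_]; last exact: span0.
  by apply: (@span_mem _ _ _ _ _ (fun f => [&& S f, 0 <= lam f & nu f == e]%N)); rewrite Sf fe eqxx.
rewrite is_path_rcons => /andP[/IH H _]; rewrite wmx_rcons -mulmxA endpoint_rcons size_rcons.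
apply: span_mul H => f' /and3P[Sf' wf' _].
apply: span_sub (nf_arr nz a Sf') => f'' /and3P[-> f'f'' ->] /=.
by rewrite andbT; apply: leq_ltn_trans f'f''.
Qed.

Lemma normal_relations z : normal z -> relations z.
Proof.
move=> nz; split.
- apply: mx_ext => f Sf; rewrite mulmx_suml mul1mx (bigD1 (nu f)) //= (nf_ver nz) // eqxx.
  rewrite big1 ?addr0 // => i; rewrite (nf_ver nz) // eq_sym => /negbTE ->.
  by [].
- move=> i j; apply: mx_ext => f Sf; rewrite -mulmxA (nf_ver nz j Sf).
  case: (nu f =P j) => [fj|fj].
    rewrite (nf_ver nz i Sf) fj eq_sym; case: (i =P j) => [ij|_]; last by rewrite mul0mx.
    by rewrite (nf_ver nz i Sf) fj ij eqxx.
  rewrite mulmx0; case: (i =P j) => [ij|_]; last by rewrite mul0mx.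
  by rewrite (nf_ver nz i Sf) ij; case: (nu f =P j).
- move=> a; apply: mx_ext => f Sf; rewrite -mulmxA (nf_ver nz _ Sf).
  case: eqP => // /eqP fa; by rewrite mulmx0 (nf_arr0 nz).
- move=> a; apply: mx_ext => f Sf; rewrite -mulmxA; have [c ->] := nf_arr nz a Sf.
  rewrite (mul_lcomb x0); apply: eq_bigr => f' /and3P[Sf' _ f'a].
  by rewrite (nf_ver nz) // f'a.
move=> e w pw Lw; apply: mx_ext => f Sf; rewrite mul0mx.
have [c ->] := normal_wmx (b f) nz pw.
rewrite point_lcomb big_pred0 // => f'; apply/negP => /and3P[/lamL fL wf _].
by move: (leq_trans wf fL); rewrite leqNgt Lw.
Qed.

Lemma normal_interpolate z1 z2 t : normal z1 -> normal z2 ->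
  normal (fun a => interpolate (z1 a) (z2 a) t).
Proof.
have E a (u : 'cV[K]_d) : interpolate (z1 a) (z2 a) t *m u =
    (1 - t) *: (z1 a *m u) + t *: (z2 a *m u) by rewrite mulmxDl !scalemxAl.
move=> n1 n2; split=> [i f Sf|a f Sf fa|a f Sf].
- rewrite E (nf_ver n1) // (nf_ver n2) //; case: eqP => _; last by rewrite !scaler0 addr0.
  by rewrite -scalerDl subrK scale1r.
- by rewrite E (nf_arr0 n1) // (nf_arr0 n2) // !scaler0 addr0.
rewrite E; have := spanD (spanZ (1 - t) (nf_arr n1 a Sf)) (spanZ t (nf_arr n2 a Sf)).
by rewrite !point_scal.
Qed.

(** The members of b of level at least l at e_i span a space containing e_i J^l. *)
Lemma normal_jrank z y l i : normal z -> (forall a, val y a = z a) ->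
  (jrank y l i <= count_at (fun f => S f && (l <= lam f)%N) nu i)%N.
Proof.
move=> nz yz; pose S' : pred F := fun f => S f && (l <= lam f)%N && (nu f == i).
rewrite /count_at; change (jrank y l i <= #|S'|)%N.
apply: leq_trans (rank_leq_row (rows_of S' b)); apply: mxrankS.
apply: (@jmx_sub _ _ _ _ x0) => p u pl pi.
rewrite point_act_pelt (_ : (val y : generator Q -> 'M[K]_d) = z); last exact: funext.
apply: span_sub (normal_wmx u nz (tpath_path p)) => f.
by rewrite pl -/(tend p) pi /S' andbA.
Qed.

Lemma polynomial_wmx z1 z2 e w :
  fa_mx (@polynomial K) (fun t => wmx (fun a => interpolate (z1 a) (z2 a) t) e w).
Proof.
have P := polynomial_algebra K.
elim/last_ind: w => [|w a IH]; first exact: polynomial_interpolate.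
have := fa_mxM P (polynomial_interpolate (z1 (inr a)) (z2 (inr a))) IH.
by congr fa_mx; apply: funext => t; rewrite wmx_rcons.
Qed.

(** Ranks drop only at the roots of finitely many minors. *)
Lemma generic_rank z1 z2 : exists2 beta : {poly K}, beta != 0 &
  forall t, beta.[t] != 0 -> forall (l : 'I_L.+1) i,
    (\rank (jmx (fun p : path => wmx z1 (tstart p) (tarrows p)) l i) <=
     \rank (jmx (fun p : path =>
       wmx (fun a => interpolate (z1 a) (z2 a) t) (tstart p) (tarrows p)) l i))%N.
Proof.
have P := polynomial_algebra K.
have /choice[g gP] : forall li : 'I_L.+1 * vertex Q, exists g : {poly K}, g != 0 /\
    forall t, g.[t] != 0 ->
    (\rank (jmx (fun p : path => wmx z1 (tstart p) (tarrows p)) li.1 li.2) <=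
     \rank (jmx (fun p : path =>
       wmx (fun a => interpolate (z1 a) (z2 a) t) (tstart p) (tarrows p)) li.1 li.2))%N.
  move=> [l i] /=.
  have [u [V [d0 dP]]] := rank_minor (fun p : path => wmx z1 (tstart p) (tarrows p)) l i.
  have [g gE] : polynomial (fun t => \det ((\sum_(p : path | (len p == l) && (tend p == i))
      u p *m (wmx (fun a => interpolate (z1 a) (z2 a) t) (tstart p) (tarrows p))^T) *m V)).
    apply: (fa_det P); apply: (fa_mxM P); last exact: fa_mx_const.
    apply: (fa_mx_sum P) => p _; apply: (fa_mxM P); first exact: fa_mx_const.
    by apply: fa_mxT; apply: polynomial_wmx.
  have gE' t : \det ((\sum_(p : path | (len p == l) && (tend p == i))
      u p *m (wmx (fun a => interpolate (z1 a) (z2 a) t) (tstart p) (tarrows p))^T) *m V) = g.[t].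
    by rewrite -[LHS]/((fun t => _) t) gE.
  exists g; split; last by move=> t; rewrite -gE' => /dP.
  apply/eqP => g0; have := gE' 0; rewrite g0 horner0; apply/eqP.
  rewrite (_ : (fun a => interpolate (z1 a) (z2 a) 0) = z1) //.
  by apply: funext => a; rewrite interpolate0.
exists (\prod_li g li).
  by apply/prodf_neq0 => li _; have [] := gP li.
move=> t; rewrite horner_prod => /prodf_neq0 H l i.
by have [_] := gP (l, i); apply; apply: H.
Qed.

End NormalForm.

Lemma basis_inverse x (F : finType) (S : pred F) (b : F -> point_module x) : basis S b ->
  exists C, C *m (rows_of S b)^T = 1%:M /\ (rows_of S b)^T *m C = 1%:M.
Proof.
move=> bb; set B := (rows_of S b)^T.
have /row_freeP[C' C'E] := rows_of_free bb.1.
have CB : C'^T *m B = 1%:M by rewrite -trmx_mul C'E trmx1.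
exists C'^T; split=> //; apply: (mx_ext bb) => f Sf; rewrite mul1mx.
by rewrite [b f](col_rows_of b (Sf : f \in S)) -!mulmxA (mulmxA C'^T) CB mul1mx.
Qed.

Lemma basis_change x1 x2 (F : finType) (S : pred F) (b1 : F -> point_module x1)
    (b2 : F -> point_module x2) : basis S b1 -> basis S b2 ->
  exists2 G : 'M[K]_d, G \in unitmx & forall f, S f -> G *m b1 f = b2 f.
Proof.
move=> /basis_inverse[C1 [C1B B1C]] /basis_inverse[C2 [C2B B2C]].
exists ((rows_of S b2)^T *m C1).
  have H : (rows_of S b2)^T *m C1 *m ((rows_of S b1)^T *m C2) = 1%:M.
    by rewrite -mulmxA (mulmxA C1) C1B mul1mx.
  by have [] := mulmx1_unit H.
move=> f Sf; rewrite [b1 f](col_rows_of b1 (Sf : f \in S)) -!mulmxA (mulmxA C1) C1B mul1mx.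
by rewrite -col_rows_of.
Qed.

(** A skeleton basis puts the point in normal form. *)
Lemma skeleton_leveled y (I : finType) (v : I -> vertex Q) (m : I -> point_module y) B a kp :
  skeleton v m B ->
  span (fun kp' => [&& skel v B kp', len kp.2 < len kp'.2 & tend kp'.2 == target a]%N) (pel m)
    (arr a *: pel m kp).
Proof.
move=> sk; have : arr a *: pel m kp \in Jpow (point_module y) (len kp.2).+1.
  by apply: Jpow_arr; rewrite /pel peltE; apply: Jpow_res.
move=> /(skel_Jpow sk)/(span_ver (target a) (fun kp _ => pel_ver m kp)).
rewrite scalerA [ver _ * _]ver_res eqxx.
by apply: span_sub => kp' /andP[/andP[-> ->] ->].
Qed.

(** Any two points of the stratum are joined by a curve in it, up to finitely many
    points: normal form and base change are interpolated at the same time. *)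
Lemma irreducible_stratum (S : 'I_L.+1 -> lmodType Lam) (s : vertex Q -> 'I_L.+1 -> nat) :
  (forall l, lmod_iso (S l) (semisimple K L (fun i => s i l))) ->
  infinite_set [set: K] -> rad_stratum S d !=set0 -> irreducible (rad_stratum S d).
Proof.
move=> Ss Kinf S0; apply: irreducible_curves => // x1 x2 Sx1 Sx2.
have [I1 [v1 [m1 [B1 sk1]]]] := ex_skeleton (point_fin_gen x1).
have [I2 [v2 [m2 [B2 sk2]]]] := ex_skeleton (point_fin_gen x2).
pose lab (I : finType) (kp : I * path) : vertex Q * 'I_L.+1 := (tend kp.2, inord (len kp.2)).
have cE (il : vertex Q * 'I_L.+1) : #|[pred kp : I1 * path | skel v1 B1 kp && (lab I1 kp == il)]| =
    #|[pred kp : I2 * path | skel v2 B2 kp && (lab I2 kp == il)]|.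
  case: il => i l.
  have mE (I : finType) (v : I -> vertex Q) B :
      #|[pred kp : I * path | skel v B kp && (lab I kp == (i, l))]| = mult_at L v B l i.
    apply: eq_card => kp; rewrite !inE xpair_eqE -val_eqE /= inordK ?ltnS ?tpath_size //.
    by rewrite -andbA; congr (_ && _); rewrite andbC.
  rewrite !mE.
  have LL := lmod_iso_trans (Sx1 l) (lmod_iso_sym (Sx2 l)).
  exact: (layers_mult_at sk1 sk2 LL).
(* The skeleton bases of the two points are matched so that endpoints and lengths agree;
   then both points have normal forms with respect to the same basis. *)
have [b [bfr b1 b2]] := relabel (pel m2) cE.
have labE (I I' : finType) (kp : I * path) (kp' : I' * path) : lab I kp = lab I' kp' ->
    tend kp.2 = tend kp'.2 /\ len kp.2 = len kp'.2.
  move=> [-> /(congr1 val)] /=; rewrite !inordK ?ltnS ?tpath_size //.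
have bb : basis (skel v1 B1) b.
  split; first exact: bfr (sk_basis sk2).1.
  by move=> u; apply: span_trans ((sk_basis sk2).2 u) => g /b2[f [Sf _ <-]]; apply: span_mem.
have [G Gu GE] := basis_change (sk_basis sk1) bb.
pose nu (kp : I1 * path) := tend kp.2; pose lam (kp : I1 * path) := len kp.2.
pose z1 a := G *m val x1 a *m invmx G.
have lamL f : skel v1 B1 f -> (lam f <= L)%N by move=> _; apply: tpath_size.
have z1b a f : skel v1 B1 f -> z1 a *m b f = G *m (val x1 a *m pel m1 f).
  by move=> Sf; rewrite -(GE f Sf) /z1 -!mulmxA mulKmx.
have Gspan (T : pred (I1 * path)) u : (forall f, T f -> skel v1 B1 f) -> span T (pel m1) u ->
    span T b (G *m (u : 'cV[K]_d) : point_module x2).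
  move=> TS [c ->]; exists c; rewrite (mul_lcomb x2).
  by apply: eq_bigr => f /TS/GE ->.
have genE (y : var) a (u : point_module y) : val y a *m (u : 'cV[K]_d) = gen_elt K L a *: u.
  by rewrite -point_act_gen.
have n1 : normal (skel v1 B1) b nu lam z1.
  split=> [i f Sf|a f Sf fa|a f Sf]; rewrite z1b // genE.
  - rewrite -[gen_elt _ _ _]/(ver i) (ver_graded _ (pel_ver m1 f)) eq_sym.
    by case: eqP => _; [exact: GE | rewrite mulmx0].
  - rewrite -[gen_elt _ _ _]/(arr a) -(pel_ver m1 f) scalerA [_ * _]res_mul0 ?scale0r ?mulmx0 //.
    by rewrite eq_sym.
  - apply: Gspan; first by move=> f' /and3P[].
    exact: (skeleton_leveled a f sk1).
have n2 : normal (skel v1 B1) b nu lam (val x2).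
  split=> [i f Sf|a f Sf fa|a f Sf]; rewrite genE; have [g [Sg lg ->]] := b1 f Sf;
    have [tg leng] := labE _ _ _ _ lg.
  - rewrite -[gen_elt _ _ _]/(ver i) (ver_graded _ (pel_ver m2 g)) tg eq_sym /nu.
    by case: eqP.
  - rewrite -[gen_elt _ _ _]/(arr a) -(pel_ver m2 g) scalerA [_ * _]res_mul0 ?scale0r //.
    by rewrite tg eq_sym.
  - apply: span_trans (skeleton_leveled a g sk2) => g' /and3P[Sg' lg' tg'].
    have [f' [Sf' lf' <-]] := b2 g' Sg'; have [tf' lenf'] := labE _ _ _ _ lf'.
    apply: (@span_mem _ _ _ _ _
      (fun f' => [&& skel v1 B1 f', lam f < lam f' & nu f' == target a]%N)).
    by rewrite Sf' /lam /nu lenf' -leng lg' tf' tg'.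
have [beta beta0 betaP] := generic_rank z1 (val x2).
exists (invmx G), 1%:M, z1, (val x2), beta; split=> //.
- by rewrite unitmx_inv unitmx1.
- by move=> a; rewrite invmxK /z1 !mulmxA mulVmx // mul1mx mulmxKV.
- by move=> a; rewrite invmx1 mulmx1 mul1mx.
move=> t h bt hu.
have nt := normal_interpolate t n1 n2.
have [yt ytE] := relations_point (normal_relations bb lamL nt).
have [y yE] := conj_point yt hu.
exists y; last by move=> a; rewrite yE ytE.
apply/(stratumP Ss) => l i; rewrite -(jrank_iso l i (conj_iso hu yE)).
have [y1 y1E] := conj_point x1 Gu.
have x1E : jrank x1 l i = srank s l i by move/(stratumP Ss): Sx1 => ->.
(* The normal form bounds the ranks from above, the choice of t from below. *)
apply/eqP; rewrite eqn_leq; apply/andP; split.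
  by have := normal_jrank bb l i nt ytE; rewrite -x1E (jrank_skel l i sk1).
rewrite -x1E (jrank_iso l i (conj_iso Gu y1E)) /jrank.
have := betaP t bt l i.
rewrite (_ : (fun p : path => wmx z1 _ _) = fun p => point_act y1 (pelt p)); last first.
  apply: funext => p; rewrite point_act_pelt; congr wmx.
  by apply: funext => a; rewrite y1E.
rewrite (_ : (fun p : path => wmx _ _ _) = fun p => point_act yt (pelt p)) //.
apply: funext => p; rewrite point_act_pelt; congr wmx.
by apply: funext => a; rewrite ytE.
Qed.

End Construct.

(** * Points from modules *)

Section ModulePoint.
Variables (K : fieldType) (Q : quiver) (L : nat).
Local Notation Lam := (tpa K Q L).
Local Notation path := (tpath Q L).
Local Notation scal := (scal Q L).
Local Notation pelt := (pelt K).
Local Notation arr := (arr K L).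

(** The point consists of the matrices of the generators with respect to the basis b. *)
Lemma ex_point (X : lmodType Lam) (F : finType) (S : pred F) (b : F -> X) :
  basis S b -> exists x : modvar K Q L #|S|, lmod_iso (point_module x) X.
Proof.
move=> [fr sp]; set d := #|S|.
pose theta (u : 'cV[K]_d) : X := \sum_j scal (u j 0) *: b (enum_val j).
have thetaD u u' : theta (u + u') = theta u + theta u'.
  by rewrite -big_split; apply: eq_bigr => j _; rewrite mxE scalD scalerDl.
have thetaZ k u : theta (k *: u) = scal k *: theta u.
  by rewrite scaler_sumr; apply: eq_bigr => j _; rewrite mxE scalM scalerA.
have theta0 : theta 0 = 0 by rewrite -(scale0r 0) thetaZ scal0 scale0r.
have theta_sum (u : 'I_d -> 'cV[K]_d) : theta (\sum_j u j) = \sum_j theta (u j).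
  by elim/big_rec2: _ => // j x y _ <-.
have theta_inj u : theta u = 0 -> u = 0.
  have [c cE] := ex_enum_coef (fun j : 'I_#|S| => u j 0).
  have -> : theta u = lcomb S b c by rewrite lcomb_enum; apply: eq_bigr => j _; rewrite cE.
  move=> /fr c0; apply/colP => j; rewrite mxE -cE; exact: (c0 _ (enum_valP j)).
have /choice[inv invE] : forall y, exists u, theta u = y.
  move=> y; have [c ->] := sp y; exists (\col_j c (enum_val j)).
  by rewrite lcomb_enum; apply: eq_bigr => j _; rewrite mxE.
pose z a : 'M[K]_d := \matrix_(i, j) inv (gen_elt K L a *: b (enum_val j)) i 0.
have zE a u : theta (z a *m u) = gen_elt K L a *: theta u.
  have -> : z a *m u = \sum_j u j 0 *: inv (gen_elt K L a *: b (enum_val j)).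
    apply/colP => i; rewrite mxE summxE; apply: eq_bigr => j _.
    by rewrite !mxE mulrC.
  rewrite theta_sum scaler_sumr; apply: eq_bigr => j _.
  by rewrite thetaZ invE !scalerA scalC.
have evE t u : theta (eval_mx z t *m u) = eval_tpa L t *: theta u.
  elim: t u => [a|k|t1 IH1 t2 IH2|t1 IH1 t2 IH2] u.
  - exact: zE.
  - by rewrite -[eval_mx _ _]/(k%:M) mul_scalar_mx thetaZ.
  - rewrite -[eval_mx _ _]/(eval_mx z t1 + eval_mx z t2) mulmxDl thetaD IH1 IH2.
    by rewrite -scalerDl.
  - by rewrite -[eval_mx _ _]/(eval_mx z t1 *m eval_mx z t2) -mulmxA IH1 IH2 scalerA.
pose z' : {ffun generator Q -> 'M[K]_d} := [ffun a => z a].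
have z'z : (z' : generator Q -> 'M[K]_d) = z by apply: funext => a; rewrite ffunE.
have zP : `[< forall t, eval_tpa L t = 0 -> eval_mx z' t = 0 >].
  apply/asboolP => t t0; rewrite z'z; apply/matrixP => i j.
  have : eval_mx z t *m (delta_mx j 0 : 'cV[K]_d) = 0 by apply: theta_inj; rewrite evE t0 scale0r.
  by rewrite -colE => /colP/(_ i); rewrite !mxE.
pose x : modvar K Q L d := exist _ z' zP.
exists x; have [h hE] : exists h : {linear point_module x -> X}, h =1 theta.
  apply: ex_linear => f u u'.
  change (theta (point_act x f *m u + u') = f *: theta u + theta u').
  by rewrite thetaD /point_act /= z'z evE eval_nc_of.
apply: (@inj_surj_iso _ _ _ h) => [u u'|y]; last by exists (inv y); rewrite hE invE.
move=> huu; have : theta (u - u') = 0 by rewrite -hE linearB huu subrr.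
by move=> /theta_inj/eqP; rewrite subr_eq0 => /eqP.
Qed.

(** * Open orbits *)

(** A module with one generator m and basis the paths p m, p in B, whose arrows
    leaving B end in vertices where the module vanishes: every module near it of the
    same dimension is again generated by the vector m, with the same relations. *)
Lemma open_orbit d (x : modvar K Q L d) (e : vertex Q) (m : unit -> point_module x) B :
  skeleton (fun=> e) m B ->
  (forall (p : path) a, skel (fun=> e) B (tt, p) -> source a = tend p ->
     ~~ B tt (rcons (tarrows p) a) ->
     forall kp : unit * path, skel (fun=> e) B kp -> tend kp.2 != target a) ->
  exists U, [/\ open U, U x & U `<=` GL_orbit x].
Proof.
move=> sk H; set S := skel (fun=> e) B in H *.
pose u0 : 'cV[K]_d := m tt.
pose fam (y : modvar K Q L d) (kp : unit * path) : 'cV[K]_d := point_act y (pelt kp.2) *m u0.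
have famx kp : fam x kp = pel m kp by case: kp => -[].
have bx := sk_basis sk; rewrite -/S in bx.
have [C [CB BC]] := basis_inverse bx.
have xB : rows_of S (pel m) = rows_of S (fam x).
  by apply/row_matrixP => j; rewrite !rowK famx.
rewrite xB in CB BC.
(* The matrix g y maps each basis vector p m of x to p m computed in the module of y;
   where it is invertible, it turns out to be an isomorphism. *)
pose g y := (rows_of S (fam y))^T *m C.
exists [set y | \det (g y) <> 0]; split.
- apply: open_nonzero; have R := regular_algebra K Q L d.
  apply: (fa_det R); apply: (fa_mxM R); last exact: fa_mx_const.
  apply: fa_mxT => i j; rewrite (_ : (fun _ => _) = fun y => fam y (enum_val i) j 0).
    by apply: (fa_mxM R (@regular_act _ _ _ _ _)); exact: fa_mx_const.
  by apply: funext => y; rewrite !mxE.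
- by rewrite /= /g BC det1; apply/eqP; exact: oner_neq0.
move=> y /= /eqP dy; have gu : g y \in unitmx by rewrite unitmxE unitfE.
have gx : g x = 1%:M by exact: BC.
have gE w kp : S kp -> g w *m fam x kp = fam w kp.
  move=> Skp; rewrite (col_rows_of (fam x) (Skp : kp \in S)).
  by rewrite [RHS](col_rows_of (fam w) (Skp : kp \in S)) -!mulmxA (mulmxA C) CB mul1mx.
have genE (w : modvar K Q L d) a (p : path) :
    val w a *m fam w (tt, p) = point_act w (gen_elt K L a * pelt p) *m u0.
  rewrite -point_act_gen mulmxA; congr (_ *m _).
  rewrite -(@point_actP _ _ _ _ w (NCmul (nc_of (gen_elt K L a)) (nc_of (pelt p)))
    (gen_elt K L a * pelt p)) //.
  by rewrite eval_tpaM !eval_nc_of.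
have act0 (w : modvar K Q L d) : point_act w 0 = 0.
  by rewrite -(@point_actP _ _ _ _ w (NCconst Q 0) 0) ?[LHS]scale0r // -[LHS]/(0%:M) raddf0.
have key (w : modvar K Q L d) (p : path) a : g w \in unitmx -> S (tt, p) ->
    val w a *m fam w (tt, p) = g w *m (val x a *m fam x (tt, p)).
  move=> gwu Sp; rewrite !genE; case: a => [i|a].
    have -> : gen_elt K L (inl i) * pelt p = if i == tend p then pelt p else 0.
      by rewrite [pelt p]peltE [LHS]ver_res.
    case: eqP => _; last by rewrite !act0 !mul0mx mulmx0.
    by rewrite -[RHS]/(g w *m fam x (tt, p)) gE.
  have -> : gen_elt K L (inr a) * pelt p = arr a * pelt p by [].
  rewrite arr_pelt; case: ifP => [/andP[/eqP sa pL]|_]; last by rewrite !act0 !mul0mx mulmx0.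
  have pp : is_path (tstart p) (rcons (tarrows p) a).
    by rewrite is_path_rcons tpath_path sa eqxx.
  have [|p' [p'1 p'2]] := @ex_tpath _ L _ _ pp; first by rewrite size_rcons.
  rewrite -p'1 -p'2 -peltE -[LHS]/(fam w (tt, p')) -[in RHS]/(fam x (tt, p')).
  case Bp: (B tt (rcons (tarrows p) a)).
    rewrite gE // /S /skel /valid /= p'1 p'2 Bp andbT.
    by have /andP[] := Sp.
  (* The path p' ends in a vertex at which the modules of w' with invertible g vanish. *)
  have kill (w' : modvar K Q L d) : g w' \in unitmx -> fam w' (tt, p') = 0.
    move=> gw'; have ver0 : val w' (inl (target a)) = 0.
      have : val w' (inl (target a)) *m g w' = 0.
        apply: (mx_ext bx) => -[[] q] Sq; rewrite mul0mx -famx -mulmxA gE // genE.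
        have -> : gen_elt K L (inl (target a)) * pelt q = 0.
          rewrite [pelt q]peltE [LHS]ver_res ifN // eq_sym.
          exact: (H p a Sp sa (negbT Bp) (tt, q)).
        by rewrite act0 mul0mx.
      by move/(congr1 (mulmx^~ (invmx (g w')))); rewrite mulmxK // mul0mx.
    have tp' : tend p' = target a by rewrite /tend p'2 endpoint_rcons.
    have <- : val w' (inl (target a)) *m fam w' (tt, p') = fam w' (tt, p').
      by rewrite genE [_ * _](_ : _ = pelt p') // -tp' [LHS]pelt_tend.
    by rewrite ver0 mul0mx.
  by rewrite !kill ?mulmx0 // gx unitmx1.
exists (g y) => // a.
suff -> : g y *m val x a = val y a *m g y by rewrite mulmxK.
apply: (mx_ext bx) => -[[] p] Sp; rewrite -famx -[LHS]mulmxA -[RHS]mulmxA.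
by rewrite -key // gE.
Qed.

End ModulePoint.

(** * The tree modules of maximal finite projective dimension *)

Section Trees.
Variables (K : fieldType) (Q : quiver) (L : nat).
Local Notation Lam := (tpa K Q L).
Local Notation path := (tpath Q L).
Local Notation len p := (size (tarrows p)).
Local Notation pelt := (pelt K).
Local Notation ver := (ver K L).

Lemma ldeg_bound : exists N, forall (i : vertex Q) (l : nat), ~ cyclebound i -> (l <= L)%N ->
  le_enat (ldeg L l (pathlen_sup i)) (Fin N).
Proof.
pose c (i : vertex Q) := if pathlen_sup i is Fin n then n else 0%N.
exists (\max_i (c i) + (\max_i (c i) + L))%N => i l ni lL.
case cE: (pathlen_sup i) => [n|] /=; last by case: ni; apply/cyclebound_pathlen.
have nc : (n <= \max_i c i)%N by apply: leq_trans (leq_bigmax i); rewrite /c cE.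
by apply: leq_add; apply: leq_trans (leq_div _ _) _; lia.
Qed.

Section OneTree.
Variable e : vertex Q.

(** In a module of finite projective dimension, the paths outside a skeleton end in
    vertices that are not cyclebound: here, all such paths of positive length are outside. *)
Definition tree_set : set path :=
  [set p | [/\ tstart p = e, (0 < len p)%N & ~ cyclebound (tend p)]].

Definition tree_gens : set (proj_indec K L e) :=
  [set u | exists2 p, tree_set p & val u = path_elt K p].

Definition tree_mod : lmodType Lam := quotmodule (gen_by tree_gens).

Definition tree_B (_ : unit) (w : seq (arrow Q)) : bool :=
  (w == [::]) || is_path e w && `[< cyclebound (endpoint e w) >].

Lemma tree_B_pre k w a : tree_B k (rcons w a) -> tree_B k w.
Proof.
rewrite /tree_B -size_eq0 size_rcons is_path_rcons => /andP[/andP[pw /eqP sa] /asboolP ca].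
rewrite pw /=; apply/orP; right; apply/asboolP; rewrite endpoint_rcons in ca; rewrite -sa.
by apply: (@cyclebound_cat _ _ [:: a]) => //=; rewrite eqxx.
Qed.

Lemma tree_setE p : tree_set p <-> tstart p = e /\ ~~ tree_B tt (tarrows p).
Proof.
rewrite /tree_set /tree_B /=; split=> [[pe p0 pc]|[pe]].
  split=> //; rewrite -size_eq0 -leqn0 leqNgt p0 /= -pe tpath_path /=.
  by apply/negP => /asboolP; exact: pc.
rewrite negb_or -size_eq0 -lt0n -pe tpath_path /= => /andP[p0 /asboolP pc].
by split.
Qed.

Lemma tree_skeleton : exists m : unit -> tree_mod, skeleton (fun=> e) m tree_B.
Proof.
pose v (_ : unit) := e.
have [h [hb hE]] := proj_indec_pcover K L e.
pose m0 (k : unit) : proj_indec K L e := h (pgen K L v k).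
have m0pel : h \o pel (pgen K L v) = pel m0.
  by apply: funext => kp; rewrite /= /pel linearZ.
have [fr0 sp0] : basis (valid v) (pel m0).
  have [fr sp] := pcover_basis K L v; rewrite -m0pel; split=> [|y].
    exact: free_inj (bij_inj hb) fr.
  have [g _ gK] := hb; have [c cE] := sp (g y).
  by exists c; rewrite -linear_lcomb -cE gK.
have m0E (p : path) : tstart p = e -> val (pel m0 (tt, p)) = path_elt K p.
  move=> pe; rewrite -m0pel /= hE /pel pcoefZ pgenE eqxx.
  by change (pelt p * ver e = pelt p); rewrite -pe peltE res_ver.
pose N := gen_by tree_gens.
pose out (kp : unit * path) := valid v kp && ~~ tree_B kp.1 (tarrows kp.2).
have B0 (w u : seq (arrow Q)) : tree_B tt (w ++ u) -> tree_B tt w.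
  exact: (skel_prefix tree_B_pre).
(* The relations generate the span of the paths outside tree_B. *)
have NP x : x \in N <-> span out (pel m0) x.
  split=> [/asboolP[s sX ->]|[c ->]]; last first.
    apply: rpred_sum => -[[] p] /andP[/eqP /= pe nB]; apply: rpredZ; apply: mem_gen_by.
    by exists p; [apply/tree_setE | exact: m0E].
  rewrite big_seq; apply: span_sum => -[f u] /sX /= [p /tree_setE[pe nB] uE].
  have -> : u = pel m0 (tt, p) by apply: val_inj; rewrite uE m0E.
  rewrite tpa_act; apply: span_sum => q _; apply: spanZ; rewrite /pel scalerA pelt_mul.
  case: ifP => [/andP[/eqP qp pqL]|_]; last by rewrite scale0r; apply: span0.
  have [s1 s2] := tcatP qp pqL.
  rewrite -/(pel m0 (tt, tcat p q)); apply: span_mem.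
  rewrite /out /valid /= s1 pe eqxx s2 /=; apply: contra nB; exact: B0.
have [pr [prS prK]] := quotmodule_proj N.
exists (pr \o m0).
have prpel : pr \o pel m0 = pel (pr \o m0).
  by apply: funext => kp; rewrite /= /pel linearZ.
have pr_out kp : out kp -> pel (pr \o m0) kp = 0.
  by move=> okp; rewrite -prpel; apply/prK/NP/span_mem.
have splitE c : lcomb (valid v) (pel m0) c =
    lcomb (skel v tree_B) (pel m0) c + lcomb out (pel m0) c.
  by rewrite /lcomb (bigID (fun kp => tree_B kp.1 (tarrows kp.2))).
split=> [k|//|k w a||].
- by rewrite /= -linearZ /m0 -linearZ pgen_ver.
- exact: tree_B_pre.
- split=> [c c0 kp /andP[vkp Bkp]|x].
    have /NP[c' c'E] : lcomb (skel v tree_B) (pel m0) c \in N.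
      by apply/prK; rewrite linear_lcomb prpel.
    pose c1 kp := if tree_B kp.1 (tarrows kp.2) then c kp else - c' kp.
    have <- : c1 kp = c kp by rewrite /c1 Bkp.
    apply: (fr0 c1) vkp; rewrite splitE.
    have -> : lcomb (skel v tree_B) (pel m0) c1 = lcomb (skel v tree_B) (pel m0) c.
      by apply: eq_lcomb => f /andP[_ Bf]; rewrite /c1 Bf.
    have -> : lcomb out (pel m0) c1 = lcomb out (pel m0) (fun f => (-1) * c' f).
      by apply: eq_lcomb => f /andP[_ /negbTE Bf]; rewrite /c1 Bf mulN1r.
    by rewrite c'E -lcombZ scalN scal1 scaleN1r subrr.
  have [y <-] := prS x; have [c ->] := sp0 y; rewrite splitE linearD.
  rewrite [X in _ + X](_ : _ = 0) ?addr0; first by exists c; rewrite linear_lcomb prpel.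
  by rewrite linear_lcomb prpel; apply: big1 => kp /pr_out ->; exact: scaler0.
move=> [] w a pw wL Bw nB.
have [|p [p1 p2]] := @ex_tpath _ L _ _ pw; first by rewrite size_rcons.
suff -> : res K L (v tt) (rcons w a) *: (pr \o m0) tt = 0 by apply: span0.
have -> : res K L (v tt) (rcons w a) = pelt p by rewrite peltE p1 p2.
rewrite -/(pel (pr \o m0) (tt, p)); apply: pr_out.
by rewrite /out /valid /= p1 eqxx p2.
Qed.

Lemma tree_is_tree T : lmod_iso T tree_mod -> is_tree_module e T.
Proof. by move=> TT; exists tree_set => // p [-> p0 _]. Qed.

Lemma tree_nonskel (p : path) : tstart p = e -> (0 < len p)%N -> ~ cyclebound (tend p) ->
  ~~ tree_B tt (tarrows p).
Proof. by move=> pe p0 pc; have [] := (tree_setE p).1. Qed.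

Lemma tree_finite : pdim tree_mod <> Infty.
Proof.
have [m sk] := tree_skeleton; have [N NP] := ldeg_bound.
apply/neq_Infty; exists N.+1; apply/pdim_leP/(skeleton_pd N sk) => -[[] p] cp.
apply: NP; last exact: tpath_size.
have /and3P[/eqP /= pe nB _] := cp.
by have [] := (tree_setE p).2 (conj pe nB).
Qed.

End OneTree.

(** The critical paths of M end in vertices that are not cyclebound, as the projective
    dimension is finite; such a path starting in e is zero in the tree module with root
    e, so its l-deg already contributes to the projective dimension of that module. *)
Lemma pdim_tree_bound (M : lmodType Lam) N : fin_gen M -> pdim M <> Infty ->
  (forall e, le_enat (pdim (tree_mod e)) (Fin N)) -> le_enat (pdim M) (Fin N).
Proof.
move=> /ex_skeleton[I [v [m [B sk]]]] /neq_Infty[n0 Mn0] TN.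
have Mfin : pd_le n0.+1 M.
  by apply/pdim_leP; apply: le_enat_trans Mn0 _; exact: leqnSn.
have crit_nc k (q : path) : critical v B (k, q) ->
    [/\ (0 < len q)%N, ~ cyclebound (tend q) & ~~ tree_B (v k) tt (tarrows q)].
  move=> cq; have [q0 _] := criticalP (sk_nil sk) cq.
  have nc : ~ cyclebound (tend q).
    move=> /cyclebound_pathlen cI; have := (skeleton_pd n0 sk).1 Mfin _ cq.
    by rewrite /= cI.
  by split=> //; apply: tree_nonskel => //; have /andP[/eqP] := cq.
have nonskel k (q : path) : critical v B (k, q) ->
    nonskel_at L (fun _ : unit => v k) (tree_B (v k)) (len q) (tend q) <> 0%N.
  move=> cq; have [_ _ nB] := crit_nc _ _ cq; apply/nonskel_atP; exists tt, q; split=> //.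
  by have /andP[/eqP /= qk _] := cq; rewrite /valid /= qk.
apply/pdim_leP; case: N TN => [|N] TN.
  apply/(skeleton_pd0 sk) => -[k q]; apply/negP => cq.
  have [mt skt] := tree_skeleton (v k).
  have qL : (len q < L.+1)%N by rewrite ltnS tpath_size.
  have /pdim_leP/(pd_le0_nonskel skt)/(_ (tend q) (Ordinal qL)) := TN (v k).
  exact: nonskel.
apply/(skeleton_pd N sk) => -[k q] cq.
have [mt skt] := tree_skeleton (v k).
have qL : (len q < L.+1)%N by rewrite ltnS tpath_size.
have /pdim_leP/(pd_leS_nonskel skt)/(_ (tend q) (Ordinal qL)) := TN (v k).
by apply; exact: nonskel.
Qed.

Lemma findim_tree : (0 < #|vertex Q|)%N -> exists e, pdim (tree_mod e) = findim Lam.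
Proof.
move=> /card_gt0P[e0 _].
pose N e := if pdim (tree_mod e) is Fin n then n else 0%N.
have NE e : pdim (tree_mod e) = Fin (N e).
  by rewrite /N; have := @tree_finite e; case: pdim.
have [e _ maxe] := arg_maxnP (P := xpredT) N (isT : xpredT e0).
exists e; apply: enat_le_ext => n; rewrite /findim esup_leP; split=> [en u|H].
  move=> [M [fM <- Mf]]; apply: pdim_tree_bound => // e'.
  by apply: le_enat_trans en; rewrite !NE /=; exact: maxe.
apply: H; exists (tree_mod e); split=> //; last exact: tree_finite.
have [m sk] := tree_skeleton e; apply: has_mult_fin_gen (has_mult_skel sk).
Qed.

Lemma tree_point e : exists d (x : modvar K Q L d), lmod_iso (point_module x) (tree_mod e).
Proof.
have [m sk] := tree_skeleton e; have [x xT] := ex_point (sk_basis sk).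
by exists _, x.
Qed.

(** A path that leaves tree_B ends in a vertex f that is not cyclebound, and the tree
    module vanishes at f: its basis paths of positive length end in cyclebound vertices,
    and f = e would make e cyclebound. *)
Lemma tree_open_orbit e d (x : modvar K Q L d) : lmod_iso (point_module x) (tree_mod e) ->
  exists U, [/\ open U, U x & U `<=` GL_orbit x].
Proof.
move=> xT; have [m sk] := tree_skeleton e.
have [m' sk'] := skeleton_iso (lmod_iso_sym xT) sk.
apply: (open_orbit sk') => p a /andP[/eqP /= pe Bp] sa nB [[] q] /andP[/eqP /= qe Bq].
have pp : is_path e (rcons (tarrows p) a).
  by rewrite is_path_rcons -pe tpath_path /= sa.
have nca : ~ cyclebound (target a).
  move=> ca; case/negP: nB; apply/orP; right; rewrite pp endpoint_rcons; exact/asboolP.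
apply/eqP => qa; move: Bq; rewrite /tree_B.
have -> : endpoint e (tarrows q) = target a by rewrite -qa /tend qe.
rewrite (asboolF nca) andbF orbF => /eqP q0.
have ea : e = target a by rewrite -qa /tend q0 -qe.
move: Bp => /orP[/eqP p0|/andP[_ /asboolP cp]].
  case: nca; exists [::] => //; exists [:: a]; split=> //=.
    by rewrite andbT sa /tend p0 /endpoint /= pe ea.
apply: nca; rewrite -ea; apply: (@cyclebound_cat _ _ (tarrows p)) => //.
by rewrite -pe tpath_path.
Qed.

End Trees.

(** * Components and generic values *)

(** An irreducible set D that contains O is covered by the closure of O and the complement
    of U, and is not contained in the latter. *)
Lemma component_of_open (X : topologicalType) (O U : set X) x :
  irreducible O -> open U -> U x -> U `<=` O -> irreducible_component (closure O).
Proof.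
move=> irrO oU Ux UO; split; first exact: irreducible_closure.
move=> D [_ irrD] OD; apply/seteqP; split=> //.
have Ox : closure O x by apply: subset_closure; apply: UO.
have [|||//|DU] := irrD (closure O) (~` U).
- exact: closed_closure.
- by rewrite closedC.
- move=> y _; have [Uy|nUy] := pselect (U y); last by right.
  by left; apply: subset_closure; apply: UO.
by have := DU x (OD x Ox).
Qed.

(** Nonempty open subsets of an irreducible set are dense. *)
Lemma generic_open (X : topologicalType) (T : Type) (f : X -> T) (C U : set X) x v :
  irreducible C -> open U -> U x -> C x -> (forall y, U y -> f y = v) ->
  generic_value f C v.
Proof.
move=> [_ irrC] oU Ux Cx fv; exists U; split=> // [|y [_ /fv]//].
have [|||//|CU] := irrC (closure (C `&` U)) (~` U).
- exact: closed_closure.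
- by rewrite closedC.
- move=> y Cy; have [Uy|nUy] := pselect (U y); last by right.
  by left; apply: subset_closure.
by have := CU x Cx.
Qed.

Section FiniteField.
Variables (K : fieldType) (Q : quiver) (L d : nat).
Local Notation var := (modvar K Q L d).

Lemma open_singleton (x : var) : finite_set [set: K] -> open [set x].
Proof.
move=> /finite_seqP[s sE].
(* The polynomial f vanishes everywhere except at x. *)
pose f (y : var) : K := \prod_k \prod_(c <- s | c != coords x k) (coords y k - c).
rewrite (_ : [set x] = [set y | f y <> 0]).
  apply: open_nonzero; have R := regular_algebra K Q L d.
  apply: (fa_prod R) => k _; apply: (fa_prod R) => c _.
  apply: (fa_add R); last exact: (fa_const R).
  by exists 'X_k; apply: funext => y; rewrite mevalXU.
apply/seteqP; split=> [y -> /eqP|y /= fy].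
  rewrite /f => /eqP; apply/eqP/prodf_neq0 => k _.
  rewrite big_seq_cond; elim/big_ind: _ => [|a b|c /andP[_ ne]].
  - exact: oner_neq0.
  - exact: mulf_neq0.
  - by rewrite subr_eq0 eq_sym.
have yx k : coords y k = coords x k.
  apply/eqP; apply: contrapT => /negP ne; apply: fy.
  have ys : coords y k \in s by have : [set: K] (coords y k) by []; rewrite sE.
  rewrite /f (bigD1 k) //= (_ : \prod_(c <- s | _) _ = 0) ?mul0r //.
  by rewrite (big_rem _ ys) /= ne subrr mul0r.
apply: val_inj; apply/ffunP => a; apply/matrixP => i j.
by rewrite -!coordsE yx.
Qed.

End FiniteField.

(** Over an infinite field, take the closure of the open orbit; over a finite field, the
    topology is discrete, and the point x alone is a component. *)
Lemma generic_component (K : fieldType) (Q : quiver) (L d : nat) (x : modvar K Q L d) U :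
  open U -> U x -> U `<=` GL_orbit x ->
  exists C : set (modvar K Q L d),
    irreducible_component C /\ generic_value (@pdim_at K Q L d) C (pdim_at x).
Proof.
move=> oU Ux UO; have [Kinf|/contrapT Kfin] := pselect (infinite_set [set: K]).
  have irrO := irreducible_orbit x Kinf.
  exists (closure (GL_orbit x)); split; first exact: component_of_open oU Ux UO.
  apply: (generic_open (irreducible_closure irrO) oU Ux) => [|y /UO Oy].
    by apply: subset_closure; apply: UO.
  by apply: esym; apply: pdim_iso; apply: orbit_iso.
have ox := open_singleton x Kfin.
have irrx : irreducible [set x].
  split; first by exists x.
  move=> A B _ _ xAB; have [Ax|Bx] := xAB x erefl; [left|right] => y ->; exact: id.
exists (closure [set x]); split; first exact: (component_of_open irrx ox erefl).
apply: (generic_open (irreducible_closure irrx) ox erefl) => [|y ->] //.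
by apply: subset_closure; exact: erefl.
Qed.

Lemma generic_value_attained (X : topologicalType) (T : Type) (f : X -> T) (C : set X) v :
  irreducible C -> generic_value f C v -> exists x, f x = v.
Proof.
move=> [[x Cx] _] [O [_ CO fv]].
have [y [COy _]] := CO x Cx _ filterT.
by exists y; apply: fv.
Qed.


Theorem theorem11 (K : fieldType) (Q : quiver) (L : nat)
    (hL : (0 < L)%N) (hQ : (0 < #|vertex Q|)%N) :
  (forall M N : lmodType (tpa K Q L), fin_gen M -> fin_gen N ->
     (forall l : 'I_L.+1, lmod_iso (layer M l) (layer N l)) -> pdim M = pdim N)
  /\
  (forall (S : 'I_L.+1 -> lmodType (tpa K Q L)) (s : vertex Q -> 'I_L.+1 -> nat) (d : nat),
     (forall l, lmod_iso (S l) (semisimple K L (fun i => s i l))) ->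
     d = (\sum_(l < L.+1) \sum_(i : vertex Q) s i l)%N ->
     rad_stratum S d !=set0 ->
     exists pdimS : enat,
       [/\ forall x : modvar K Q L d, rad_stratum S d x -> pdim_at x = pdimS,
           infinite_set [set: K] -> irreducible (closure (rad_stratum S d)),
           generic_value (@pdim_at K Q L d) (closure (rad_stratum S d)) pdimS
         & forall (P : lmodType (tpa K Q L)) (r : vertex Q -> 'I_L.+1 -> nat),
             projective_cover P (S ord0) ->
             (forall l : 'I_L.+1, lmod_iso (layer P l)
                (semisimple K L (fun i => s i l) * semisimple K L (fun i => r i l))%type) ->
             [/\ le_enat (Fin 1) pdimS ->
                 pdimS = esucc (esup [set v | exists i, exists2 l : 'I_L.+1,
                                   r i l <> 0%N & v = ldeg L l (pathlen_sup i)]),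
                 pdimS <> Infty <->
                   (forall i (l : 'I_L.+1), cyclebound i -> r i l = 0%N)
               & pdimS <> Infty <->
                   (forall T : lmodType (tpa K Q L), simple_module T -> pdim T = Infty ->
                      exists m : nat, comp_mult T P m /\ comp_mult T (dsum S) m)]])
  /\
  generic_findim K Q L = findim (tpa K Q L)
  /\
  (exists (e : vertex Q) (d' : nat) (x : modvar K Q L d'),
     [/\ is_tree_module e (point_module x),
         pdim_at x = findim (tpa K Q L)
       & infinite_set [set: K] -> irreducible_component (closure (GL_orbit x))]).
Proof.
have part1 := @pdim_layering K Q L.
have [e eT] := findim_tree K L hQ; have [d [x xT]] := tree_point K L e.
have [U [oU Ux UO]] := tree_open_orbit xT.
have xE : pdim_at x = findim (tpa K Q L) by rewrite -eT; apply: pdim_iso.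
split=> //; split=> [S s d1 Ss _ S0|].
  have [x0 Sx0] := S0; exists (pdim_at x0).
  have const y : rad_stratum S d1 y -> pdim_at y = pdim_at x0.
    move=> Sy; apply: part1 => [||l]; try exact: point_fin_gen.
    exact: lmod_iso_trans (Sy l) (lmod_iso_sym (Sx0 l)).
  split=> // [Kinf||P r PS Psr].
  - exact: irreducible_closure (irreducible_stratum Ss Kinf S0).
  - exact: stratum_generic Ss _ const.
  split.
  - exact: (pdim_formula (point_fin_gen x0) Sx0 Ss PS Psr).
  - exact: (pdim_finite (point_fin_gen x0) Sx0 Ss PS Psr).
  - exact: (pdim_finite_comp hL (point_fin_gen x0) Sx0 Ss PS Psr).
split; last first.
  exists e, d, x; split=> // [|Kinf]; first exact: tree_is_tree.
  exact: component_of_open (irreducible_orbit x Kinf) oU Ux UO.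
apply: enat_le_ext => n; split=> [/esup_leP H|/esup_leP H].
  have [C [cC CV]] := generic_component oU Ux UO; rewrite -xE; apply: H.
  split; last by exists d, C.
  by rewrite xE -eT; exact: tree_finite.
apply/esup_leP => u [uf [d1 [C [[irrC _] CV]]]].
have [y yu] := generic_value_attained irrC CV.
by apply: H; exists (point_module y); split=> //; exact: point_fin_gen.
Qed.
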